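(* Let $n$ be a positive integer and let $p$ be a prime with $p\equiv 1\pmod{n+1}$. Then there is a lens space $L(p,b)$ of dimension $2n+1$ whose tangent bundle admits a Parseval frame of size $2n+2$ (with respect to any Riemannian metric).
   Context: Let $p$ be a prime and $b=(b_0,\dots,b_n)$ a tuple of integers with $1\le b_i\le p-1$. Consider the $\mathbb{Z}/p\mathbb{Z}$-action on $\mathbb{C}^{n+1}$ generated by $(z_0,\dots,z_n)\mapsto(\lambda^{b_0}z_0,\dots,\lambda^{b_n}z_n)$, where $\lambda$ is a fixed primitive $p$th root of unity. It restricts to a free action on the standard sphere $S^{2n+1}\subset\mathbb{C}^{n+1}$, and the lens space $L(p,b)$ is the $(2n+1)$-dimensional quotient manifold. A Parseval frame of size $m$ for the tangent bundle of a Riemannian manifold $M$ is a collection of $m$ smooth vector fields $\sigma_1,\dots,\sigma_m$ on $M$ such that for every $x\in M$ and $v\in T_xM$, $\sum_{j=1}^m|\langle v,\sigma_j(x)\rangle|^2=\|v\|^2$. *)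

(* Defs.v *)
From HB Require Import structures.
From mathcomp Require Import all_boot all_order all_algebra.
From mathcomp Require Import complex.
From mathcomp Require Import all_classical all_reals all_analysis.
From mathcomp Require Import ring lra zify.

Set Implicit Arguments.
Unset Strict Implicit.
Unset Printing Implicit Defensive.

Import Order.TTheory GRing.Theory Num.Theory.
Import numFieldNormedType.Exports.

Local Open Scope ring_scope.
Local Open Scope classical_set_scope.

Section Smoothness.
Variables (R : realType) (V W : normedModType R).
Implicit Types (f g : V -> W) (A : set V).

(* Meant for x in an open set: for A open, smooth_on A f says that all iterated
   directional derivatives of f exist and are differentiable on A. *)
Fixpoint Ck_at (k : nat) (f : V -> W) (x : V) : Prop :=
  if k is k'.+1 then
    differentiable f x /\ forall v : V, Ck_at k' (fun y => 'D_v f y) x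
  else {for x, continuous f}.

Definition smooth_on (A : set V) (f : V -> W) : Prop :=
  forall k x, A x -> Ck_at k f x.

End Smoothness.

Section SmoothTheory.
Variable (R : realType).
Implicit Types (V W : normedModType R).

Lemma near_eq_differentiable V W (f g : V -> W) x :
  (\near x, f x = g x) -> differentiable f x -> differentiable g x.
Proof.
move=> fg df.
have fgx : f x = g x := nbhs_singleton fg.
have [dc /eqaddoP dE] := (diff_locallyP x f).1 df.
have gE : g \o shift x = cst (g x) + 'd f x +o_ 0 id.
  apply/eqaddoP => _/posnumP[e].
  have := dE e%:num _; move=> /(_ [gt0 of e%:num]) H.
  have fg0 : \forall h \near (0 : V), f (h + x) = g (h + x).
    by have := fg; rewrite (near_shift 0) /=; apply: filterS => h;
       rewrite /= ?subr0.
  near=> h.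
  have -> : (g \o shift x - (cst (g x) + 'd f x)) h
          = (f \o shift x - (cst (f x) + 'd f x)) h.
    rewrite !fctE /= fgx; congr (_ - _); apply/esym; near: h; exact: fg0.
  near: h; exact: H.
apply/diff_locallyP; rewrite (diff_unique dc gE); split => //.
Unshelve. all: by end_near. Qed.

Lemma Ck_near V W k (f g : V -> W) x :
  (\near x, f x = g x) -> Ck_at k f x -> Ck_at k g x.
Proof.
elim: k f g => [|k IH] f g fg /=.
  move=> fc; change (g y @[y --> x] --> g x); rewrite -(nbhs_singleton fg).
  by apply: cvg_trans fc; apply: near_eq_cvg.
move=> [df Df]; split; first exact: near_eq_differentiable df.
move=> v; apply: IH (Df v).
near=> y; apply: near_eq_derive.
near: y; exact: near_join.
Unshelve. all: by end_near. Qed.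

Lemma CkW V W k (f : V -> W) x : Ck_at k.+1 f x -> Ck_at k f x.
Proof.
elim: k f => [|k IH] f [df Df]; first exact: differentiable_continuous.
by split => // v; apply: IH; exact: Df.
Qed.

Lemma Ck_le V W k l (f : V -> W) x : (k <= l)%N -> Ck_at l f x -> Ck_at k f x.
Proof.
move=> /subnK <-; elim: (l - k)%N => // m IH; rewrite addSn => /CkW; exact: IH.
Qed.

Lemma Ck_diff V W k (f : V -> W) x : Ck_at k.+1 f x -> differentiable f x.
Proof. by case. Qed.

Lemma Ck_cst V W k (a : W) (x : V) : Ck_at k (fun=> a) x.
Proof.
elim: k a => [|k IH] a /=; first exact: cvg_cst.
split; first exact: differentiable_cst.
move=> v; have -> : (fun y => 'D_v (fun=> a) y) = (fun=> 0 : W).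
  by apply/funext => y; rewrite derive_cst.
exact: IH.
Qed.

Definition Ck_on V W k (A : set V) (f : V -> W) := forall x, A x -> Ck_at k f x.

Lemma Ck_on_ext V W k (A : set V) (f g : V -> W) : open A ->
  (forall x, A x -> f x = g x) -> Ck_on k A f -> Ck_on k A g.
Proof.
move=> oA fg Hf x Ax; apply: Ck_near (Hf x Ax).
by apply: filterS (open_nbhs_nbhs (conj oA Ax)) => y; exact: fg.
Qed.

Lemma Ck_onS V W k (A : set V) (f : V -> W) :
  Ck_on k.+1 A f <-> (forall x, A x -> differentiable f x) /\
                     forall v, Ck_on k A (fun y => 'D_v f y).
Proof.
split=> [H|[H1 H2] x Ax]; first by split=> [x /H[]//|v x /H[_]]; exact.
by split; [exact: H1|move=> v; exact: H2].
Qed.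

Lemma Ck_onW V W k (A : set V) (f : V -> W) : Ck_on k.+1 A f -> Ck_on k A f.
Proof. by move=> H x /H /CkW. Qed.

Lemma Ck_on_sub V W k (A B : set V) (f : V -> W) :
  A `<=` B -> Ck_on k B f -> Ck_on k A f.
Proof. by move=> AB H x /AB /H. Qed.

Lemma Ck_onD V W k (A : set V) (f g : V -> W) : open A ->
  Ck_on k A f -> Ck_on k A g -> Ck_on k A (fun x => f x + g x).
Proof.
move=> oA; elim: k f g => [|k IH] f g.
  by move=> Hf Hg x Ax /=; apply: cvgD; [exact: Hf|exact: Hg].
move=> /Ck_onS[df Df] /Ck_onS[dg Dg]; apply/Ck_onS; split=> [x Ax|v].
  by apply: differentiableD; [exact: df|exact: dg].
apply: Ck_on_ext (IH _ _ (Df v) (Dg v)) => // x Ax.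
by apply/esym; apply: deriveD; apply: diff_derivable; [exact: df|exact: dg].
Qed.

Lemma Ck_onM V k (A : set V) (f g : V -> R) : open A ->
  Ck_on k A f -> Ck_on k A g -> Ck_on k A (fun x => f x * g x).
Proof.
move=> oA; elim: k f g => [|k IH] f g.
  by move=> Hf Hg x Ax /=; apply: cvgM; [exact: Hf|exact: Hg].
move=> Hf Hg.
have [df Df] := (Ck_onS _ _ _).1 Hf; have [dg Dg] := (Ck_onS _ _ _).1 Hg.
apply/Ck_onS; split=> [x Ax|v].
  by apply: differentiableM; [exact: df|exact: dg].
apply: (@Ck_on_ext _ _ _ _ (fun x => f x * 'D_v g x + g x * 'D_v f x)) => //.
  move=> x Ax; apply/esym.
  by apply: deriveM; apply: diff_derivable; [exact: df|exact: dg].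
by apply: Ck_onD => //; apply: IH => //; exact: Ck_onW.
Qed.

Lemma Ck_on_sum V W k (A : set V) (I : Type) (r : seq I) (f : I -> V -> W) :
  open A -> (forall i, Ck_on k A (f i)) ->
  Ck_on k A (fun x => \sum_(i <- r) f i x).
Proof.
move=> oA Hf; elim: r => [|i r IH].
  apply: (@Ck_on_ext _ _ _ _ (fun=> 0)) => //; last by move=> x _; exact: Ck_cst.
  by move=> x _; rewrite big_nil.
apply: Ck_on_ext (Ck_onD oA (Hf i) IH) => // x _.
by rewrite big_cons.
Qed.

Lemma Ck_onV V k (A : set V) (f : V -> R) : open A ->
  (forall x, A x -> f x != 0) -> Ck_on k A f -> Ck_on k A (fun x => (f x)^-1).
Proof.
move=> oA f0; elim: k => [|k IH] Hf.
  by move=> x Ax /=; apply: cvgV; [exact: f0|exact: Hf].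
have [df Df] := (Ck_onS _ _ _).1 Hf.
apply/Ck_onS; split=> [x Ax|v].
  by apply: differentiableV; [exact: df|exact: f0].
have Vk := IH (Ck_onW Hf).
apply: (@Ck_on_ext _ _ _ _ (fun x => -1 * ((f x)^-1 * (f x)^-1 * 'D_v f x))) => //.
  move=> x Ax; rewrite deriveV ?f0//; last exact/diff_derivable/df.
  by rewrite mulN1r scaleNr expr2 invfM.
apply: Ck_onM => //; first by move=> x _; exact: Ck_cst.
by apply: Ck_onM => //; apply: Ck_onM.
Qed.

Lemma differentiable_mx V m n (f : V -> 'M[R]_(m, n)) x :
  (forall i j, differentiable (fun y => f y i j : R) x) -> differentiable f x.
Proof.
move=> Hf.
have -> : f = \sum_(i < m) \sum_(j < n) (fun y => f y i j *: delta_mx i j).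
  apply/funext => y; rewrite [LHS]matrix_sum_delta fct_sumE.
  by apply: eq_bigr => i _; rewrite fct_sumE.
apply: differentiable_sum => i; apply: differentiable_sum => j.
exact: differentiableZl.
Qed.

Lemma Ck_on_coord V m n k (A : set V) (f : V -> 'M[R]_(m, n)) i j : open A ->
  Ck_on k A f -> Ck_on k A (fun x => f x i j : R).
Proof.
move=> oA; elim: k f => [|k IH] f Hf.
  move=> x Ax /=; apply: (@continuous_comp _ _ _ f (fun N : 'M[R]_(m, n) => N i j)).
    exact: Hf.
  exact: coord_continuous.
have [df Df] := (Ck_onS _ _ _).1 Hf.
apply/Ck_onS; split=> [x Ax|v].
  apply: (@differentiable_comp _ _ _ _ f (fun N : 'M[R]_(m, n) => N i j : R)).
    exact: df.
  exact: differentiable_coord.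
apply: Ck_on_ext oA _ (IH _ (Df v)) => x Ax.
by rewrite derive_mx ?mxE//; apply: diff_derivable; exact: df.
Qed.

Lemma Ck_on_mx V m n k (A : set V) (f : V -> 'M[R]_(m, n)) : open A ->
  (forall i j, Ck_on k A (fun x => f x i j : R)) -> Ck_on k A f.
Proof.
move=> oA; elim: k f => [|k IH] f Hf.
  move=> x Ax /=; apply/cvgrPdist_lt => e e0.
  have : \forall t \near x, forall p : 'I_m * 'I_n,
      `|f x p.1 p.2 - f t p.1 p.2| < e.
    apply: filter_forall => -[i j] /=.
    by have /cvgrPdist_lt := Hf i j x Ax; exact.
  apply: filterS => t Ht.
  rewrite [ltLHS]/Num.Def.normr/= mx_normrE.
  by apply/bigmax_ltP; split => // p _; rewrite !mxE.
have dc i j x : A x -> differentiable (fun y => f y i j : R) x.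
  by move=> Ax; have [] := Hf i j x Ax.
have df x : A x -> differentiable f x.
  by move=> Ax; apply: differentiable_mx => i j; exact: dc.
apply/Ck_onS; split=> // v; apply: IH => i j.
have [_ /(_ v)] := (Ck_onS _ _ _).1 (Hf i j).
apply: Ck_on_ext => // x Ax.
by rewrite derive_mx ?mxE//; apply: diff_derivable; exact: df.
Qed.

Lemma Ck_on_id V k (A : set V) : open A -> Ck_on k A (fun x : V => x).
Proof.
move=> oA x _; case: k => [|k] /=; first exact: cvg_id.
split; first exact: (@ex_diff _ _ _ _ _ _ _ (is_diff_id x)).
move=> v; have -> : (fun y => 'D_v (fun x : V => x) y) = (fun=> v).
  by apply/funext => y; rewrite derive_id.
exact: Ck_cst.
Qed.

Lemma Ck_on_comp V m n k (A : set V) (B : set 'M[R]_(m, n))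
    (f : V -> 'M[R]_(m, n)) (g : 'M[R]_(m, n) -> R) :
  open A -> open B -> (forall x, A x -> B (f x)) ->
  Ck_on k A f -> Ck_on k B g -> Ck_on k A (fun x => g (f x)).
Proof.
move=> oA oB AB; elim: k g => [|k IH] g Hf Hg.
  by move=> x Ax /=; apply: continuous_comp; [exact: Hf|exact/Hg/AB].
have [df Df] := (Ck_onS _ _ _).1 Hf; have [dg Dg] := (Ck_onS _ _ _).1 Hg.
apply/Ck_onS; split=> [x Ax|v].
  by apply: differentiable_comp; [exact: df|exact/dg/AB].
pose D x := \sum_i \sum_j ('D_v f x) i j * 'D_(delta_mx i j) g (f x).
apply: (@Ck_on_ext _ _ _ _ D) => //.
  move=> x Ax; rewrite (deriveE _ (differentiable_comp (df x Ax) (dg _ (AB _ Ax)))).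
  rewrite (diff_comp (df x Ax) (dg _ (AB _ Ax))) /= -(deriveE _ (df x Ax)).
  rewrite [in RHS](matrix_sum_delta ('D_v f x)) linear_sum; apply: eq_bigr => i _.
  rewrite linear_sum; apply: eq_bigr => j _.
  by rewrite linearZ /= (deriveE _ (dg _ (AB _ Ax))).
apply: Ck_on_sum => // i; apply: Ck_on_sum => // j; apply: Ck_onM => //.
  exact: Ck_on_coord.
exact: (IH (fun y => 'D_(delta_mx i j) g y) (Ck_onW Hf) (Dg _)).
Qed.

Lemma smooth_on_comp V m n p q (A : set V) (B : set 'M[R]_(m, n))
    (f : V -> 'M[R]_(m, n)) (g : 'M[R]_(m, n) -> 'M[R]_(p, q)) :
  open A -> open B -> (forall x, A x -> B (f x)) ->
  smooth_on A f -> smooth_on B g -> smooth_on A (g \o f).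
Proof.
move=> oA oB AB Hf Hg k; apply: Ck_on_mx => // i j.
apply: (Ck_on_comp (g := fun y => g y i j) oA oB AB); first exact: Hf.
by apply: Ck_on_coord => //; exact: Hg.
Qed.

End SmoothTheory.

Section Charts.
Variables (R : realType) (T : topologicalType) (d : nat).

Record chart := Chart {
  cdom : set T;
  cimg : set 'rV[R]_d;
  cmap : T -> 'rV[R]_d;
  cinv : 'rV[R]_d -> T;
  cdom_open : open cdom;
  cimg_open : open cimg;
  cmap_img : forall x, cdom x -> cimg (cmap x);
  cinv_dom : forall y, cimg y -> cdom (cinv y);
  cmapK : forall x, cdom x -> cinv (cmap x) = x;
  cinvK : forall y, cimg y -> cmap (cinv y) = y;
  cmap_continuous : forall x, cdom x -> {for x, continuous cmap};
  cinv_continuous : forall y, cimg y -> {for y, continuous cinv} }.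

Definition transition (c c' : chart) : 'rV[R]_d -> 'rV[R]_d :=
  cmap c' \o cinv c.

Definition overlap (c c' : chart) : set 'rV[R]_d :=
  cimg c `&` cinv c @^-1` cdom c'.

End Charts.

Arguments cdom_open {R T d} c.
Arguments cimg_open {R T d} c.

Section Manifold.
Variable R : realType.

Record manifold (d : nat) := Manifold {
  carrier :> topologicalType;
  carrier_hausdorff : hausdorff_space carrier;
  carrier_second_countable : @second_countable carrier;
  atlas : set (chart R carrier d);
  atlas_cover : forall x : carrier, exists2 c, atlas c & cdom c x;
  atlas_smooth : forall c c', atlas c -> atlas c' ->
    smooth_on (overlap c c') (transition c c') }.

Variables (d : nat) (M : manifold d).

(* A tangent vector at x is given by its coordinates in every chart of the atlas
   around x, subject to the change of coordinates rule; the value at the other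
   charts is irrelevant and is set to 0. *)
Definition is_tangent (x : M) (v : chart R M d -> 'rV[R]_d) : Prop :=
  (forall c, ~ (atlas c /\ cdom c x) -> v c = 0) /\
  (forall c c', atlas c -> atlas c' -> cdom c x -> cdom c' x ->
     v c' = 'd (transition c c') (cmap c x) (v c)).

Definition tangent_pred (x : M) : {pred chart R M d -> 'rV[R]_d} :=
  [pred v | `[< is_tangent x v >]].

Lemma tangent_submod_closed (x : M) : submod_closed (tangent_pred x).
Proof.
split=> [|a u v]; rewrite ?inE.
  by split=> // c c' _ _ _ _; rewrite linear0.
move=> [u0 uE] [v0 vE]; split=> [c nc|c c' Ac Ac' cx c'x].
  by rewrite !fctE u0// v0// scaler0 addr0.
by rewrite !fctE (uE c)// (vE c)// linearP.
Qed.

HB.instance Definition _ (x : M) :=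
  GRing.isSubmodClosed.Build R (chart R M d -> 'rV[R]_d) (tangent_pred x)
    (tangent_submod_closed x).

Record tangent (x : M) := Tangent {
  tcoord :> chart R M d -> 'rV[R]_d;
  tcoordP : tcoord \in tangent_pred x }.

HB.instance Definition _ (x : M) := [isSub for @tcoord x].
HB.instance Definition _ (x : M) := [Choice of tangent x by <:].
HB.instance Definition _ (x : M) :=
  [SubChoice_isSubLmodule of tangent x by <:].

Record vector_field := VectorField {
  vfield :> forall x : M, tangent x;
  vfield_smooth : forall c, atlas c ->
    smooth_on (cimg c) (fun y => vfield (cinv c y) c) }.

Record riemannian_metric := RiemannianMetric {
  metric :> forall x : M, tangent x -> tangent x -> R;
  metric_sym : forall x u v, metric (x := x) u v = metric v u;
  metric_linear : forall x (w : tangent x) (a : R) (u v : tangent x),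
    metric (a *: u + v) w = a * metric u w + metric v w;
  metric_pos : forall x (u : tangent x), u != 0 -> 0 < metric u u;
  (* G is the matrix of the metric in the coordinates given by c *)
  metric_smooth : forall c, atlas c -> exists2 G : 'rV[R]_d -> 'M[R]_d,
    smooth_on (cimg c) G &
    forall x (u v : tangent x), cdom c x ->
      metric u v = (u c *m G (cmap c x) *m (v c)^T) 0 0 }.

Definition parseval_frame (g : riemannian_metric) (m : nat)
    (sigma : 'I_m -> vector_field) : Prop :=
  forall (x : M) (v : tangent x), \sum_(j < m) `|g x v (sigma j x)| ^+ 2 = g x v v.

End Manifold.

Section ChartTheory.
Variables (R : realType) (T : topologicalType) (d : nat).
Implicit Types c : chart R T d.

Lemma open_cinv c (U : set T) : open U -> open (cimg c `&` cinv c @^-1` U).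
Proof.
move=> oU; rewrite openE => y [Cy Uy]; apply: filterI.
  exact: (open_nbhs_nbhs (conj (cimg_open c) Cy)).
exact: (cinv_continuous Cy (open_nbhs_nbhs (conj oU Uy))).
Qed.

Lemma open_cmap c (U : set 'rV[R]_d) :
  open U -> open (cdom c `&` cmap c @^-1` U).
Proof.
move=> oU; rewrite openE => y [Cy Uy]; apply: filterI.
  exact: (open_nbhs_nbhs (conj (cdom_open c) Cy)).
exact: (cmap_continuous Cy (open_nbhs_nbhs (conj oU Uy))).
Qed.

Lemma open_overlap c c' : open (overlap c c').
Proof. exact/open_cinv/cdom_open. Qed.

End ChartTheory.

Section Sphere.
Variables (R : realType) (n : nat).

(* C^{n+1} is seen as R^{(n+1) x 2}, a normed space over R: row j of x holds the
   real and imaginary parts of the complex coordinate z_j, see zcoord *)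
Definition sphere_set : set 'M[R]_(n.+1, 2) :=
  [set x | \sum_(j < n.+1) \sum_(k < 2) x j k ^+ 2 = 1].

Definition sphere : topologicalType := set_type sphere_set.

Definition sphere_val (x : sphere) : 'M[R]_(n.+1, 2) := set_val x.

(* The standard smooth structure: smoothness of the two directions of a chart is
   smoothness for the ambient space. *)
Definition sphere_atlas : set (chart R sphere (2 * n + 1)) :=
  [set c | smooth_on (cimg c) (sphere_val \o cinv c) /\
    exists (O : set 'M[R]_(n.+1, 2)) (F : 'M[R]_(n.+1, 2) -> 'rV[R]_(2 * n + 1)),
      [/\ open O, smooth_on O F &
          forall x, cdom c x -> O (sphere_val x) /\ F (sphere_val x) = cmap c x]].

Lemma sphere_val_inj : injective sphere_val.
Proof. exact: val_inj. Qed.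

Lemma sphere_valP (x : sphere) : sphere_set (sphere_val x).
Proof. exact: set_mem (valP x). Qed.

Definition Sphere x (Hx : sphere_set x) : sphere :=
  exist (fun x => x \in sphere_set) x (mem_set Hx).

Lemma SphereK x (Hx : sphere_set x) : sphere_val (Sphere Hx) = x.
Proof. by []. Qed.

Lemma sphere_val_continuous : continuous sphere_val.
Proof. exact: initial_continuous. Qed.

Lemma sphere_continuous_at (T : topologicalType) (f : T -> sphere) (t : T) :
  {for t, continuous (sphere_val \o f)} -> {for t, continuous f}.
Proof.
move=> cf; change (f y @[y --> t] --> f t) => A /= [B [[C oC CB] Bft BA]].
have : nbhs t ((sphere_val \o f) @^-1` C).
  by apply: cf; apply: open_nbhs_nbhs; split => //; move: Bft; rewrite -CB.
by apply: filterS => s Cs; apply: BA; rewrite -CB.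
Qed.

Lemma sphere_hausdorff : hausdorff_space sphere.
Proof.
rewrite open_hausdorff => x y xy.
have : hausdorff_space 'M[R]_(n.+1, 2) by exact: norm_hausdorff.
rewrite open_hausdorff => /(_ (sphere_val x) (sphere_val y)) [].
  by apply: contra xy => /eqP /sphere_val_inj ->.
move=> [A B] /= [xA yB] [oA oB AB].
exists (sphere_val @^-1` A, sphere_val @^-1` B) => /=.
  by rewrite !inE; split; [move: xA|move: yB]; rewrite inE.
split; [by exists A|by exists B|].
apply/eqP; rewrite -subset0 => z [Az Bz].
by move/eqP: AB; rewrite -subset0; apply; split; [exact: Az|exact: Bz].
Qed.

Let rat_ball (q : 'M[rat]_(n.+1, 2) * nat) : set sphere :=
  sphere_val @^-1` (ball (map_mx ratr q.1 : 'M[R]_(n.+1, 2)) q.2.+1%:R^-1).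

Lemma sphere_second_countable : @second_countable sphere.
Proof.
exists (range rat_ball).
  exact: (card_le_trans (card_image_le _ _) (countableP _)).
split=> [_ [q _ <-]|x V Vx].
  exists (ball (map_mx ratr q.1 : 'M[R]_(n.+1, 2)) q.2.+1%:R^-1) => //.
  exact: ball_open.
have [B [[C oC CB] Bx BV]] := Vx.
have : nbhs (sphere_val x) C.
  by apply: open_nbhs_nbhs; split => //; move: Bx; rewrite -CB.
move=> /nbhs_ballP[e /= e0 eC].
have [m me] : exists m, m.+1%:R^-1 < e / 2 :> R.
  have [m] := ltr_add_invr (divr_gt0 e0 (ltr0n _ 2)).
  by rewrite add0r => ?; exists m.
have m0 : 0 < m.+1%:R^-1 :> R by rewrite invr_gt0.
have Hq j k : exists r : rat, `|ratr r - sphere_val x j k| < m.+1%:R^-1.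
  set a := sphere_val x j k.
  have [|r] := @rat_in_itvoo R (a - m.+1%:R^-1) (a + m.+1%:R^-1).
    by rewrite ltrBlDr -addrA ltrDl addr_gt0.
  rewrite in_itv /= => /andP[r1 r2]; exists r.
  by rewrite ltr_norml ltrBDr [- _ + _]addrC r1 ltrBlDl.
pose q := \matrix_(j, k) projT1 (cid (Hq j k)).
have bq : ball (map_mx ratr q : 'M[R]_(n.+1, 2)) m.+1%:R^-1 (sphere_val x).
  rewrite -ball_normE /= [ltLHS]/Num.Def.normr /= mx_normrE.
  apply/bigmax_ltP; split => // -[j k] _ /=.
  by rewrite !mxE; exact: projT2 (cid (Hq j k)).
exists (rat_ball (q, m)); first by split => //; exists (q, m).
move=> z zq; apply: BV; rewrite -CB; apply: eC.
suff : ball (sphere_val x) (e / 2 + e / 2) (sphere_val z) by rewrite -splitr.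
have bq' := ball_sym (le_ball (ltW me) bq).
exact: ball_triangle bq' (le_ball (ltW me) zq).
Qed.

Lemma sphere_atlas_smooth c c' : sphere_atlas c -> sphere_atlas c' ->
  smooth_on (overlap c c') (transition c c').
Proof.
move=> [cs _] [_ [U [F [oU sF cF]]]] k.
apply: (@Ck_on_ext _ _ _ _ _ (F \o (sphere_val \o cinv c))).
- exact: open_overlap.
- by move=> y [_ cy]; have [_ cFE] := cF _ cy; rewrite /= cFE.
- apply: (smooth_on_comp (B := U)) => //; first exact: open_overlap.
    by move=> y [_ cy]; have [] := cF _ cy.
  by move=> l y [Cy _]; exact: cs.
Qed.

End Sphere.

Arguments sphere_val {R n} x.

Section Stereographic.
Variables (R : realType) (n : nat).
Let Q := ('I_n.+1 * 'I_2)%type.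
Let d := (2 * n + 1)%N.
Variable q0 : Q.

Let others := [pred q : Q | q != q0].

Lemma card_others : #|others| = d.
Proof. by rewrite cardC1 card_prod !card_ord /d; lia. Qed.

Definition idx (l : 'I_d) : Q := enum_val (cast_ord (esym card_others) l).

Lemma idx_neq l : idx l != q0.
Proof. exact: (enum_valP (cast_ord (esym card_others) l)). Qed.

Lemma idx_bij : exists pos : Q -> 'I_d,
  cancel idx pos /\ (forall q, q != q0 -> idx (pos q) = q).
Proof.
have l0 : 'I_d by rewrite /d addn1; exact: ord0.
pose q1 := idx l0; have q1P : q1 \in others := idx_neq l0.
exists (fun q => cast_ord card_others (enum_rank_in q1P q)); split=> [l|q qq].
  by rewrite /idx enum_valK_in cast_ordKV.
by rewrite /idx cast_ordK enum_rankK_in.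
Qed.

Definition pos : Q -> 'I_d := projT1 (cid idx_bij).
Lemma idxK : cancel idx pos. Proof. exact: (projT2 (cid idx_bij)).1. Qed.
Lemma posK q : q != q0 -> idx (pos q) = q.
Proof. exact: (projT2 (cid idx_bij)).2. Qed.

Lemma sum_idx (F : Q -> R) :
  \sum_j \sum_k F (j, k) = F q0 + \sum_(l < d) F (idx l).
Proof.
rewrite pair_big /= (bigD1 q0) //=; congr (_ + _); first by case: q0.
rewrite (reindex_onto idx pos) /=; last by move=> q; exact: posK.
by apply: eq_big => [l|l _]; rewrite ?idx_neq ?idxK ?eqxx //; case: (idx l).
Qed.

Definition ster_dom : set (sphere R n) :=
  [set x | sphere_val x q0.1 q0.2 != 1].
Definition ster_fun (x : 'M[R]_(n.+1, 2)) : 'rV[R]_d :=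
  \row_l (x (idx l).1 (idx l).2 * (1 - x q0.1 q0.2)^-1).
Let sqn (y : 'rV[R]_d) : R := \sum_l y 0 l * y 0 l.
Definition ster_inv_fun (y : 'rV[R]_d) : 'M[R]_(n.+1, 2) :=
  \matrix_(j, k) ((if (j, k) == q0 then sqn y + - 1
                   else 2 * y 0 (pos (j, k))) * (sqn y + 1)^-1).

Let sqn_ge0 y : 0 <= sqn y.
Proof. by apply: sumr_ge0 => l _; rewrite -expr2 sqr_ge0. Qed.
Let sqn1_neq0 y : sqn y + 1 != 0.
Proof. by rewrite gt_eqF// ltr_wpDl. Qed.

Lemma ster_inv_subproof y : sphere_set (ster_inv_fun y).
Proof.
rewrite /sphere_set /=.
rewrite (sum_idx (fun q => ster_inv_fun y q.1 q.2 ^+ 2)) /=.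
rewrite mxE -surjective_pairing eqxx.
rewrite (eq_bigr (fun l => (2 / (sqn y + 1)) ^+ 2 * (y 0 l * y 0 l))).
  by rewrite -mulr_sumr -/(sqn y); field; exact: sqn1_neq0.
move=> l _; rewrite mxE -surjective_pairing (negbTE (idx_neq l)) idxK.
by field; exact: sqn1_neq0.
Qed.

Definition ster_inv y : sphere R n := Sphere (ster_inv_subproof y).

Lemma ster_inv_dom y : ster_dom (ster_inv y).
Proof.
rewrite /ster_dom /= SphereK mxE -surjective_pairing eqxx.
apply/eqP => /(congr1 (fun t => t * (sqn y + 1))).
rewrite divfK ?sqn1_neq0// mul1r => /addrI /eqP.
by rewrite eq_sym -subr_eq0 opprK (_ : 1 + 1 = 2%:R) ?pnatr_eq0.
Qed.

Lemma ster_invK y : ster_fun (sphere_val (ster_inv y)) = y.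
Proof.
apply/rowP => l; rewrite !mxE -!surjective_pairing eqxx (negbTE (idx_neq l)) idxK.
have s0 := sqn1_neq0 y.
have -> : 1 - (sqn y + -1) / (sqn y + 1) = 2 / (sqn y + 1).
  by field.
by field; rewrite s0.
Qed.

Lemma sterK x : ster_dom x -> ster_inv (ster_fun (sphere_val x)) = x.
Proof.
rewrite /ster_dom /= => x1; apply: sphere_val_inj; rewrite SphereK.
set X := sphere_val x in x1 *; set h := X q0.1 q0.2 in x1 *.
have h1 : 1 - h != 0 by rewrite subr_eq0 eq_sym.
have XS : h ^+ 2 + \sum_(l < d) X (idx l).1 (idx l).2 ^+ 2 = 1.
  rewrite -(sum_idx (fun q => X q.1 q.2 ^+ 2)) /=; exact: sphere_valP.
have sE : sqn (ster_fun X) = (1 + h) / (1 - h).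
  rewrite /sqn (eq_bigr (fun l =>
      (1 - h)^-1 ^+ 2 * X (idx l).1 (idx l).2 ^+ 2)); last first.
    by move=> l _; rewrite mxE -/h; field.
  rewrite -mulr_sumr (_ : \sum_(l < d) _ = 1 - h ^+ 2); last by rewrite -XS addrC addKr.
  by field.
have h2 : 1 + h + (1 - h) != 0.
  by rewrite (_ : _ + _ = 2) ?pnatr_eq0//; ring.
apply/matrixP => j k; rewrite mxE; case: ifPn => [/eqP jk|jk].
  have -> : X j k = h by rewrite /h -jk.
  by rewrite sE; field; rewrite ?h1 ?h2.
rewrite mxE posK//= -/h sE.
by field; rewrite ?h1 ?h2.
Qed.

End Stereographic.

Section StereographicChart.
Variables (R : realType) (n : nat) (q0 : 'I_n.+1 * 'I_2).
Let d := (2 * n + 1)%N.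

Let O : set 'M[R]_(n.+1, 2) := [set x | x q0.1 q0.2 != 1].

Let Ck_coord m p k (A : set 'M[R]_(m, p)) i j :
  open A -> Ck_on k A (fun x : 'M[R]_(m, p) => x i j : R).
Proof. by move=> oA; apply: Ck_on_coord => //; exact: Ck_on_id. Qed.

Let O_open : open O.
Proof.
have : open ((fun x : 'M[R]_(n.+1, 2) => x q0.1 q0.2) @^-1` [set t : R | t != 1]).
  apply: open_comp; last exact: open_neq.
  by move=> x _; exact: coord_continuous.
by [].
Qed.

Lemma ster_fun_smooth : smooth_on O (ster_fun q0).
Proof.
move=> k; apply: Ck_on_mx => // i l.
apply: (@Ck_on_ext _ _ _ _ _ (fun x : 'M[R]_(n.+1, 2) =>
  x (idx q0 l).1 (idx q0 l).2 * (1 + -1 * x q0.1 q0.2)^-1)) => //.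
  by move=> x _; rewrite mxE mulN1r.
apply: Ck_onM => //; first exact: Ck_coord.
apply: Ck_onV => //.
  by move=> x Ox; rewrite mulN1r subr_eq0 eq_sym.
apply: Ck_onD => //; first by move=> x _; exact: Ck_cst.
by apply: Ck_onM => //; [move=> x _; exact: Ck_cst|exact: Ck_coord].
Qed.

Lemma ster_inv_smooth : smooth_on setT (@ster_inv_fun R n q0).
Proof.
have oT : open [set: 'rV[R]_d] := openT.
have Sk k : Ck_on k setT (fun y : 'rV[R]_d => \sum_l y 0 l * y 0 l).
  apply: Ck_on_sum => // l.
  by apply: Ck_onM => //; exact: Ck_coord.
have cst k (a : R) : Ck_on k setT (fun _ : 'rV[R]_d => a).
  by move=> x _; exact: Ck_cst.
move=> k; apply: Ck_on_mx => // i j.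
apply: (@Ck_on_ext _ _ _ _ _ (fun y : 'rV[R]_d =>
  (if (i, j) == q0 then \sum_l y 0 l * y 0 l + - 1 else 2 * y 0 (pos q0 (i, j)))
  * (\sum_l y 0 l * y 0 l + 1)^-1)) => //.
  by move=> y _; rewrite mxE.
apply: Ck_onM => //.
  case: ((i, j) == q0); first exact: Ck_onD.
  by apply: Ck_onM => //; exact: Ck_coord.
apply: Ck_onV => //; last exact: Ck_onD.
move=> y _; rewrite gt_eqF// ltr_wpDl//.
by apply: sumr_ge0 => l _; rewrite -expr2 sqr_ge0.
Qed.

Let ster_map (x : sphere R n) := ster_fun q0 (sphere_val x).

Let dom_open : open (ster_dom q0 : set (sphere R n)).
Proof. by exists O. Qed.
Let map_img (x : sphere R n) : ster_dom q0 x -> setT (ster_map x).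
Proof. by []. Qed.
Let inv_dom y : setT y -> ster_dom q0 (@ster_inv R n q0 y).
Proof. by move=> _; exact: ster_inv_dom. Qed.
Let invK y : setT y -> ster_map (@ster_inv R n q0 y) = y.
Proof. by move=> _; exact: ster_invK. Qed.
Let map_cont x : ster_dom q0 x -> {for x, continuous ster_map}.
Proof.
move=> dx; apply: (@continuous_comp _ _ _ (@sphere_val R n) (ster_fun q0)).
  exact: sphere_val_continuous.
exact: (ster_fun_smooth 0%N dx).
Qed.
Let inv_cont y : setT y -> {for y, continuous (@ster_inv R n q0)}.
Proof. by move=> _; apply: sphere_continuous_at; exact: (ster_inv_smooth 0%N). Qed.

Definition ster_chart : chart R (sphere R n) d :=
  Chart dom_open openT map_img inv_dom (@sterK R n q0) invK map_cont inv_cont.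

Lemma ster_chart_atlas : sphere_atlas ster_chart.
Proof.
split; first exact: ster_inv_smooth.
by exists O, (ster_fun q0); split => //; exact: ster_fun_smooth.
Qed.

End StereographicChart.

Section RestrictChart.
Variables (R : realType) (T : topologicalType) (d : nat) (c : chart R T d).
Variables (U : set T) (oU : open U).

Definition restrict_chart : chart R T d.
Proof.
refine (@Chart R T d (cdom c `&` U) (cimg c `&` cinv c @^-1` U)
  (cmap c) (cinv c) _ (@open_cinv R T d c U oU) _ _ _ _ _ _).
- exact: openI (cdom_open c) oU.
- by move=> x [cx Ux]; split; [exact: cmap_img|rewrite /= cmapK].
- by move=> y [cy Uy]; split => //; exact: cinv_dom.
- by move=> x [cx _]; exact: cmapK.
- by move=> y [cy _]; exact: cinvK.
- by move=> x [cx _]; exact: cmap_continuous.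
- by move=> y [cy _]; exact: cinv_continuous.
Defined.

End RestrictChart.

Section SphereAtlas.
Variables (R : realType) (n : nat).

Lemma sphere_atlas_cover (x : sphere R n) :
  exists2 c, sphere_atlas c & cdom c x.
Proof.
have [x0|x0] := eqVneq (sphere_val x 0 0) 1; last first.
  by exists (ster_chart R (0, 0)); [exact: ster_chart_atlas|exact: x0].
exists (ster_chart R (0, 1)); first exact: ster_chart_atlas.
rewrite /= /ster_dom /=; apply/eqP => x1.
have := sphere_valP x; rewrite /sphere_set /= big_ord_recl/=.
rewrite big_ord_recl big_ord1 x0 (_ : lift _ _ = 1); last exact: val_inj.
rewrite x1 expr1n -addrA => /eqP; rewrite -subr_eq0 addrAC subrr add0r gt_eqF//.
by rewrite ltr_pwDl// sumr_ge0// => j _; rewrite sumr_ge0// => k _; rewrite sqr_ge0.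
Qed.

Lemma restrict_sphere_atlas (c : chart R (sphere R n) (2 * n + 1)) U
  (oU : open U) : sphere_atlas c -> sphere_atlas (restrict_chart c oU).
Proof.
move=> [cs [P [F [oP sF cF]]]]; split=> [k y [cy _]|]; first exact: cs.
by exists P, F; split => // x [/cF].
Qed.

Definition sphere_manifold : manifold R (2 * n + 1) :=
  Manifold (@sphere_hausdorff R n) (@sphere_second_countable R n)
    sphere_atlas_cover (@sphere_atlas_smooth R n).

End SphereAtlas.

Section Lens.
Variables (R : realType) (n : nat).
Implicit Types (w : R[i]) (b : 'I_n.+1 -> nat).

Definition zcoord (x : 'M[R]_(n.+1, 2)) (j : 'I_n.+1) : R[i] := (x j 0 +i* x j 1)%C.

(* multiplies each complex coordinate z_j by w ^+ b j *)
Definition diag_act w b (x : 'M[R]_(n.+1, 2)) : 'M[R]_(n.+1, 2) :=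
  \matrix_(j, k) let z := w ^+ b j * zcoord x j in
                 if k == 0 then complex.Re z else complex.Im z.

(* same orbit under the group generated by diag_act w b, which is finite when w
   is a root of unity *)
Definition lens_rel w b : rel (sphere R n) := fun x y =>
  `[< exists k, sphere_val y = iter k (diag_act w b) (sphere_val x) >].

Let norm2 (z : R[i]) : R := complex.Re z ^+ 2 + complex.Im z ^+ 2.

Let norm2M z z' : norm2 (z * z') = norm2 z * norm2 z'.
Proof. by case: z z' => [a b] [a' b']; rewrite /norm2 /=; ring. Qed.

Let norm2X z k : norm2 (z ^+ k) = norm2 z ^+ k.
Proof.
elim: k => [|k IH]; last by rewrite !exprS norm2M IH.
by rewrite /norm2 !expr0 /= expr1n expr0n addr0.
Qed.

Let norm2_root w k : (0 < k)%N -> w ^+ k = 1 -> norm2 w = 1.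
Proof.
move=> k0 wk; apply/eqP; rewrite -(pexpr_eq1 k0) ?addr_ge0 ?sqr_ge0//.
by rewrite -norm2X wk /norm2 /= expr1n expr0n addr0.
Qed.

Lemma zcoord_inj x y : (forall j, zcoord x j = zcoord y j) -> x = y.
Proof.
move=> xy; apply/matrixP => j k; have [x0 x1] := xy j.
case: k => -[|[|//]] k2; [rewrite (_ : Ordinal k2 = 0)//|rewrite (_ : Ordinal k2 = 1)//];
  exact: val_inj.
Qed.

Lemma zcoord_act w b x j : zcoord (diag_act w b x) j = w ^+ b j * zcoord x j.
Proof. by rewrite /zcoord !mxE /=; case: (_ * _). Qed.

Lemma diag_act1 b x : diag_act 1 b x = x.
Proof. by apply: zcoord_inj => j; rewrite zcoord_act expr1n mul1r. Qed.

Lemma diag_actM w w' b x : diag_act w b (diag_act w' b x) = diag_act (w * w') b x.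
Proof. by apply: zcoord_inj => j; rewrite !zcoord_act mulrA exprMn. Qed.

Lemma iter_diag_act w b k x : iter k (diag_act w b) x = diag_act (w ^+ k) b x.
Proof.
elim: k => [|k IH]; first by rewrite expr0 diag_act1.
by rewrite iterS IH diag_actM exprS.
Qed.

Lemma sphere_set_act w b k x :
  (0 < k)%N -> w ^+ k = 1 -> sphere_set x -> sphere_set (diag_act w b x).
Proof.
move=> k0 wk; rewrite /sphere_set /= => <-; apply: eq_bigr => j _.
have E (y : 'M[R]_(n.+1, 2)) : \sum_(l < 2) y j l ^+ 2 = norm2 (zcoord y j).
  rewrite big_ord_recl big_ord1 /norm2 /=; congr (_ + (y _ _) ^+ 2).
  exact: val_inj.
by rewrite !E zcoord_act norm2M norm2X (norm2_root k0 wk) expr1n mul1r.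
Qed.

Lemma diag_act_smooth w b : smooth_on setT (diag_act w b).
Proof.
have oT : open [set: 'M[R]_(n.+1, 2)] := openT.
have cst k (a : R) : Ck_on k setT (fun _ : 'M[R]_(n.+1, 2) => a).
  by move=> x _; exact: Ck_cst.
have co k i j : Ck_on k setT (fun x : 'M[R]_(n.+1, 2) => x i j : R).
  by apply: Ck_on_coord => //; exact: Ck_on_id.
move=> k; apply: Ck_on_mx => // i j.
case E : (w ^+ b i) => [u v].
apply: (@Ck_on_ext _ _ _ _ _ (fun x : 'M[R]_(n.+1, 2) =>
   (if j == 0 then u else v) * x i 0 + (if j == 0 then - v else u) * x i 1)) => //.
  by move=> x _; rewrite mxE /= E; case: (j == 0) => /=; ring.
by apply: Ck_onD => //; apply: Ck_onM.
Qed.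

Section Orbits.
Local Open Scope quotient_scope.
Variables (p : nat) (w : R[i]) (prim_w : p.-primitive_root w).
Variable b : 'I_n.+1 -> nat.

Let p_gt0 : (0 < p)%N := prim_order_gt0 prim_w.

Let root_wk k : (w ^+ k) ^+ p = 1.
Proof. by rewrite -exprM mulnC exprM (prim_expr_order prim_w) expr1n. Qed.

Definition sphere_act k (x : sphere R n) : sphere R n :=
  Sphere (sphere_set_act b p_gt0 (root_wk k) (sphere_valP x)).

Lemma sphere_actE k x :
  sphere_val (sphere_act k x) = diag_act (w ^+ k) b (sphere_val x).
Proof. by []. Qed.

Lemma sphere_actD k l x :
  sphere_act k (sphere_act l x) = sphere_act (k + l) x.
Proof.
by apply: sphere_val_inj; rewrite !sphere_actE diag_actM exprD.
Qed.

Lemma sphere_act_mod k x : sphere_act (k %% p) x = sphere_act k x.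
Proof. by apply: sphere_val_inj; rewrite !sphere_actE (prim_expr_mod prim_w). Qed.

Lemma sphere_act0 x : sphere_act 0 x = x.
Proof. by apply: sphere_val_inj; rewrite sphere_actE expr0 diag_act1. Qed.

Lemma lens_relP x y : reflect (exists k, y = sphere_act k x) (lens_rel w b x y).
Proof.
apply: (iffP (asboolP _)) => -[k yx]; exists k.
  by apply: sphere_val_inj; rewrite yx iter_diag_act.
by rewrite yx sphere_actE iter_diag_act.
Qed.

Lemma lens_rel_refl : reflexive (lens_rel w b).
Proof. by move=> x; apply/lens_relP; exists 0%N; rewrite sphere_act0. Qed.

Lemma lens_rel_sym : symmetric (lens_rel w b).
Proof.
suff H x y : lens_rel w b x y -> lens_rel w b y x.
  by move=> x y; apply/idP/idP; exact: H.
move=> /lens_relP[k ->]; apply/lens_relP; exists (p * k - k)%N.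
rewrite sphere_actD subnK; last by rewrite leq_pmull.
by rewrite -sphere_act_mod mulnC modnMl sphere_act0.
Qed.

Lemma lens_rel_trans : transitive (lens_rel w b).
Proof.
move=> y x z /lens_relP[k ->] /lens_relP[l ->].
by apply/lens_relP; exists (l + k)%N; rewrite sphere_actD.
Qed.

Canonical lens_equiv : equiv_rel (sphere R n) :=
  EquivRel (lens_rel w b) lens_rel_refl lens_rel_sym lens_rel_trans.

Definition lens : topologicalType :=
  quotient_topology {eq_quot lens_equiv}.

Definition lens_pi (x : sphere R n) : lens := \pi_lens x.

End Orbits.
End Lens.

Section LensTopology.
Variables (R : realType) (n p : nat) (w : R[i]).
Variables (prim_w : p.-primitive_root w) (b : 'I_n.+1 -> nat).
Let S := sphere R n.
Let L := lens prim_w b.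
Let pi : S -> L := @lens_pi R n p w prim_w b.
Let act : nat -> S -> S := sphere_act prim_w b.

Lemma lens_piP (x y : S) : pi x = pi y <-> exists k, y = act k x.
Proof.
have E : reflect (pi x = pi y) (lens_rel w b x y).
  exact: (@generic_quotient.eqmodP _ (lens_equiv prim_w b) x y).
have E' := lens_relP prim_w b x y.
by split=> H; [exact: elimT E' (introT E H)|exact: elimT E (introT E' H)].
Qed.

Lemma lens_pi_surj (q : L) : exists x, pi x = q.
Proof. by exists (generic_quotient.repr q); exact: generic_quotient.reprK. Qed.

Lemma lens_pi_continuous : continuous pi.
Proof. exact: pi_continuous. Qed.

Lemma open_lens (U : set L) : open (pi @^-1` U) -> open U.
Proof. by []. Qed.

Lemma sphere_act_continuous k : continuous (act k).
Proof.
move=> x; apply: sphere_continuous_at.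
apply: (@continuous_comp _ _ _ (@sphere_val R n) (diag_act (w ^+ k) b)).
  exact: sphere_val_continuous.
exact: (@diag_act_smooth R n (w ^+ k) b 0%N (sphere_val x) I).
Qed.

Lemma open_act k (U : set S) : open U -> open (act k @^-1` U).
Proof. by move=> oU; apply: open_comp oU => x _; exact: sphere_act_continuous. Qed.

Lemma open_pi (U : set S) : open U -> open (pi @` U).
Proof.
move=> oU; apply: open_lens.
rewrite (_ : _ @^-1` _ = \bigcup_k (act k @^-1` U)).
  by apply: bigcup_open => k _; exact: open_act.
apply/seteqP; split => [x [u Uu /esym/lens_piP[k uE]]|x [k _ Uk]].
  by exists k => //=; rewrite -uE.
by exists (act k x) => //; apply/esym/lens_piP; exists k.
Qed.

Lemma lens_second_countable : @second_countable L.
Proof.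
have [B cB [oB bB]] := @sphere_second_countable R n.
exists ((fun U => pi @` U) @` B).
  exact: card_le_trans (card_image_le _ _) cB.
split=> [_ [U BU <-]|q V Vq]; first exact/open_pi/oB.
have [x xq] := lens_pi_surj q.
have /bB[U [BU Ux] UV] : nbhs x (pi @^-1` V).
  by apply: lens_pi_continuous; rewrite xq.
exists (pi @` U); first by split; [exists U|exists x].
by move=> _ [u Uu <-]; exact: UV.
Qed.

Let finite_nbhs (T : topologicalType) (t : T) (A : nat -> set T) :
  (forall k, nbhs t (A k)) -> nbhs t (\bigcap_(k in `I_p) A k).
Proof.
move=> H; have K : nbhs t [set s | forall i : 'I_p, A i s].
  by apply: filter_forall => i; exact: H.
by apply: filterS K => s Hs k /= kp; exact: (Hs (Ordinal kp)).
Qed.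

Lemma act_sep (x y : S) k : act k x <> y -> exists U V : set S,
  [/\ nbhs x U, nbhs y V & forall u, U u -> ~ V (act k u)].
Proof.
move=> /eqP xy; have := @sphere_hausdorff R n.
rewrite open_hausdorff => /(_ _ _ xy)[[A B] /= [/set_mem Ax /set_mem By]].
move=> [oA oB /eqP AB].
exists (act k @^-1` A), B; split.
- exact: (open_nbhs_nbhs (conj (open_act k oA) Ax)).
- exact: (open_nbhs_nbhs (conj oB By)).
by move=> u Au Bu; have : (A `&` B) (act k u) by []; rewrite AB.
Qed.

Lemma lens_hausdorff : hausdorff_space L.
Proof.
rewrite open_hausdorff => q r qr.
have [x xq] := lens_pi_surj q; have [y yr] := lens_pi_surj r.
have H k : exists UV : set S * set S,
    [/\ nbhs x UV.1, nbhs y UV.2 & forall u, UV.1 u -> ~ UV.2 (act k u)].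
  have [|U [V HUV]] := @act_sep x y k; last by exists (U, V).
  move=> xy; move/eqP: qr; apply; rewrite -xq -yr.
  by apply/lens_piP; exists k.
have [UV HUV] := choice H.
pose U := (\bigcap_(k in `I_p) (UV k).1)°.
pose V := (\bigcap_(k in `I_p) (UV k).2)°.
have p0 : (0 < p)%N := prim_order_gt0 prim_w.
exists (pi @` U, pi @` V) => /=.
  rewrite !inE; split; [exists x => //|exists y => //].
    by apply: finite_nbhs => k; have [] := HUV k.
  by apply: finite_nbhs => k; have [] := HUV k.
split; [exact/open_pi/open_interior|exact/open_pi/open_interior|].
apply/eqP/seteqP; split => // _ [[u Uu <-] [v Vv]] /esym/lens_piP[k vE].
have kp : `I_p (k %% p)%N by rewrite /= ltn_mod.
have [_ _ /(_ u)] := HUV (k %% p)%N; apply.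
  exact: (interior_subset Uu).
have -> : act (k %% p) u = v by rewrite vE; exact: sphere_act_mod.
exact: (interior_subset Vv).
Qed.

(* The charts of the quotient manifold are those of the sphere, seen through the
   quotient map: c is the composition of the chart s of the sphere with the
   inverse of the restriction of pi to the domain of s. *)
Definition lens_atlas : set (chart R L (2 * n + 1)) :=
  [set c | exists2 s : chart R S (2 * n + 1), sphere_atlas s &
    [/\ cdom c = pi @` cdom s, cimg c = cimg s,
        forall x, cdom s x -> cmap c (pi x) = cmap s x &
        forall y, cimg s y -> cinv c y = pi (cinv s y)]].

Lemma lens_atlas_smooth c c' : lens_atlas c -> lens_atlas c' ->
  smooth_on (overlap c c') (transition c c').
Proof.
move=> [s As [_ ci _ cI]] [s' As' [c'd _ c'm _]] l y [Cy].
rewrite /= c'd => -[x' s'x']; rewrite cI -?ci// => /esym/lens_piP[k x'E].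
have [ss _] := As; have [_ [P [F [oP sF cF]]]] := As'.
pose A := cimg s `&` cinv s @^-1` (act k @^-1` cdom s').
have oA : open A by apply: open_cinv; apply: open_act; exact: cdom_open.
have Ay : A y by split; rewrite /= -?ci// -x'E.
suff : smooth_on A (transition c c') by exact.
move=> {}l; apply: (@Ck_on_ext R _ _ l A
    (F \o (diag_act (w ^+ k) b \o (sphere_val \o cinv s)))) => //.
  move=> z [sz dz]; rewrite /transition /= cI//.
  have -> : pi (cinv s z) = pi (act k (cinv s z)) by apply/lens_piP; exists k.
  by rewrite c'm//; have [_ <-] := cF _ dz.
apply: (smooth_on_comp (B := P)) => //.
  by move=> z [_ dz] /=; have [+ _] := cF _ dz.
apply: (smooth_on_comp (B := setT)) => //; first exact: openT.
  by move=> m z [sz _]; exact: ss.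
exact: diag_act_smooth.
Qed.

Section Descend.
Variables (s : chart R S (2 * n + 1)).
Hypothesis pi_inj : forall x y, cdom s x -> cdom s y -> pi x = pi y -> x = y.

Let lift_spec (q : L) : exists x : S,
  pi x = q /\ ((pi @` cdom s) q -> cdom s x).
Proof.
have [[x sx xq]|Nq] := pselect ((pi @` cdom s) q); first by exists x.
by have [x xq] := lens_pi_surj q; exists x.
Qed.

Let lift q := projT1 (cid (lift_spec q)).
Let liftK x : cdom s x -> lift (pi x) = x.
Proof.
move=> sx; have [H1 H2] := projT2 (cid (lift_spec (pi x))).
by apply: pi_inj => //; apply: H2; exists x.
Qed.

Definition descend : chart R L (2 * n + 1).
Proof.
refine (@Chart R L (2 * n + 1) (pi @` cdom s) (cimg s)
  (cmap s \o lift) (pi \o cinv s)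
  (open_pi (cdom_open s)) (cimg_open s) _ _ _ _ _ _).
- by move=> _ [x sx <-] /=; rewrite liftK//; exact: cmap_img.
- by move=> y sy /=; exists (cinv s y) => //; exact: cinv_dom.
- by move=> _ [x sx <-] /=; rewrite liftK// cmapK.
- by move=> y sy /=; rewrite liftK ?cinvK//; exact: cinv_dom.
- move=> _ [x sx <-] A /= /=; rewrite liftK// => As.
  have : nbhs x (cdom s `&` cmap s @^-1` A°).
    apply: open_nbhs_nbhs; split; first exact/open_cmap/open_interior.
    by split.
  rewrite nbhsE => -[B [oB Bx] BA].
  have : nbhs (pi x) (pi @` B).
    by apply: open_nbhs_nbhs; split; [exact: open_pi|exists x].
  apply: filterS => _ [z Bz <-] /=; have [sz Az] := BA _ Bz.
  by rewrite liftK//; exact: interior_subset Az.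
- move=> y sy; apply: (@continuous_comp _ _ _ (cinv s) pi).
    exact: cinv_continuous.
  exact: lens_pi_continuous.
Defined.

Lemma descend_atlas : sphere_atlas s -> lens_atlas descend.
Proof. by move=> As; exists s => //; split => // x sx /=; rewrite liftK. Qed.

End Descend.

Hypotheses (p_prime : prime p) (b_bounds : forall j, (1 <= b j <= p - 1)%N).

Lemma sphere_act_free k (x : S) : act k x = x -> (p %| k)%N.
Proof.
move=> kx; have := sphere_valP x; rewrite /sphere_set /= => xS.
have [j zj] : exists j, zcoord (sphere_val x) j != 0.
  apply/not_existsP => H; have x0 : sphere_val x = 0.
    apply: zcoord_inj => j; have /negP/negPn/eqP -> := H j.
    by rewrite /zcoord !mxE.
  move/eqP: xS; rewrite x0 big1 ?(eq_sym 0) ?oner_eq0// => j _.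
  by rewrite big1// => l _; rewrite mxE expr0n.
have /(congr1 (fun y => zcoord (sphere_val y) j)) := kx.
rewrite sphere_actE zcoord_act -{2}[zcoord _ j]mul1r => /(mulIf zj)/eqP.
rewrite -exprM -(prim_order_dvd prim_w) Euclid_dvdM// => /orP[//|].
have /andP[b1 b2] := b_bounds j => /(dvdn_leq b1).
by have := prime_gt1 p_prime; lia.
Qed.

Lemma pi_locally_inj (x : S) : exists U : set S, [/\ open U, U x &
  forall u v, U u -> U v -> pi u = pi v -> u = v].
Proof.
have H k : exists U : set S,
    nbhs x U /\ forall u, U u -> U (act k u) -> act k x = x.
  have [kx|kx] := pselect (act k x = x).
    by exists setT; split => //; exact: filterT.
  have [U [V [Ux Vx UV]]] := act_sep kx.
  exists (U `&` V); split; first exact: filterI.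
  by move=> u [Uu _] [_ /(UV _ Uu)].
have [U HU] := choice H.
exists (\bigcap_(k in `I_p) U k)°; split; first exact: open_interior.
  by apply: finite_nbhs => k; have [] := HU k.
move=> u v /interior_subset Uu /interior_subset Uv /lens_piP[k vE].
have kp : `I_p (k %% p)%N by rewrite /= ltn_mod prime_gt0.
have vE' : v = act (k %% p) u by rewrite vE; exact/esym/sphere_act_mod.
have [_ /(_ u (Uu _ kp))] := HU (k %% p)%N.
rewrite -vE' => /(_ (Uv _ kp)) /sphere_act_free.
rewrite /dvdn modn_mod => /eqP k0.
by rewrite vE' k0; exact/esym/sphere_act0.
Qed.

Lemma lens_atlas_cover (q : L) : exists2 c, lens_atlas c & cdom c q.
Proof.
have [x <-] := lens_pi_surj q.
have [U [oU Ux Uinj]] := pi_locally_inj x.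
have [s As sx] := sphere_atlas_cover x.
have inj u v : cdom (restrict_chart s oU) u -> cdom (restrict_chart s oU) v ->
  pi u = pi v -> u = v by move=> [_ Uu] [_ Uv]; exact: Uinj.
exists (descend inj); last by exists x.
exact/descend_atlas/restrict_sphere_atlas.
Qed.

Definition lens_space : manifold R (2 * n + 1) :=
  Manifold lens_hausdorff lens_second_countable lens_atlas_cover
    lens_atlas_smooth.

End LensTopology.

(* Main.v *)
(** Write E(c) for the complex line bundle of weight c on the lens space, c mod p.
    The tangent bundle plus a trivial real line bundle is E(b_0) + ... + E(b_n).
    Take for the b_j the (n+1)-st roots of unity mod p. The class of
    E(b_0) + ... + E(b_n) - (n+1) in the representation ring Z[X]/(X^p - 1) is then
    fixed by the substitution X := X^t, with t of order n+1 mod p. This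
    substitution acts on the quotient I^k/I^(k+1) = Z/p of powers of the augmentation
    ideal I = (X - 1) by t^k, which is not 1 for 0 < k <= n, so the class lies in
    I^(n+1). Now (X - 1)^(n+1) vanishes in the K-theory of the lens space: it is the
    difference of the odd and even parts of an exterior algebra, and these are
    isomorphic through Clifford multiplication by the nowhere zero equivariant map
    whose j-th component is the power of z_j of weight 1. Thus
    E(b_0) + ... + E(b_n) is stably trivial. Its real rank 2n+2 exceeds the dimension
    2n+1, so line bundles can be cancelled one at a time after a generic
    perturbation, and it is trivial. All bundle maps are matrices of polynomials
    in the z_j and their conjugates, hence Lipschitz on the sphere, so that a
    pigeonhole argument on a finite grid of perturbations replaces Sard's theorem.

    A trivialization of the tangent bundle plus a trivial line bundle is turned by
    the Gram-Schmidt process into an orthonormal frame for the given metric plus the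
    trivial one, and the tangential part of an orthonormal frame is a Parseval frame. *)

Require Import Defs.
From mathcomp Require Import all_boot all_order all_algebra.
From mathcomp Require Import complex.
From mathcomp Require Import all_classical all_reals all_analysis.
From mathcomp Require Import all_fingroup all_solvable all_field.
From mathcomp Require Import ring lra zify.

Set Implicit Arguments.
Unset Strict Implicit.
Unset Printing Implicit Defensive.

Import Order.TTheory GRing.Theory Num.Theory.
Import numFieldNormedType.Exports.

Local Open Scope ring_scope.

(** * Powers of the augmentation ideal *)

(** The nonzero elements of ['F_p] are [p.-1] roots of unity of that order, so one of them is
    primitive. Since [n.+1] divides [p.-1], a power of it has order exactly [n.+1]. *)
Lemma exists_root_unity_mod (n p : nat) : prime p -> (p = 1 %[mod n.+1])%N ->
  exists t : nat, (t ^ n.+1 = 1 %[mod p])%N /\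
    forall k, (0 < k < n.+1)%N -> (t ^ k != 1 %[mod p])%N.
Proof.
move=> p_pr p1; have p_gt1 := prime_gt1 p_pr.
have dvd : (n.+1 %| p.-1)%N.
  by rewrite -subn1; rewrite -eqn_mod_dvd; [apply/eqP|exact: ltnW].
have /hasP[z _] : has p.-1.-primitive_root (rem 0 (enum 'F_p)).
  apply: has_prim_root.
  - by rewrite -subn1 subn_gt0.
  - apply/allP => x; rewrite mem_rem_uniq ?enum_uniq// => /andP[/= x0 _].
    rewrite unity_rootE -(inj_eq (mulfI x0)) -exprS mulr1 prednK ?prime_gt0//.
    by apply/eqP; have := expf_card x; rewrite (card_Fp p_pr).
  - by rewrite rem_uniq ?enum_uniq.
  - by rewrite size_rem ?mem_enum// -cardE card_Fp.
move=> zp; have zprim := dvdn_prim_root zp dvd; set u := z ^+ _ in zprim.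
have E k : (u ^+ k == 1) = ((u : nat) ^ k == 1 %[mod p])%N.
  have uE : ((u : nat)%:R = u) by exact: natr_Zp.
  rewrite -{1}uE -natrX -val_eqE.
  by rewrite -(val_Fp_nat p_pr (u ^ k)) -(val_Fp_nat p_pr 1).
exists u; split=> [|k /andP[k0 kn]].
  by apply/eqP; rewrite -E (prim_expr_order zprim).
by rewrite -E -(prim_order_dvd zprim) gtnNdvd.
Qed.

Section AugmentationPower.
Variables (n p t : nat).
Hypotheses (p_pr : prime p) (tn : (t ^ n.+1 = 1 %[mod p])%N).
Hypothesis tk : forall k, (0 < k < n.+1)%N -> (t ^ k != 1 %[mod p])%N.

Let Y : {poly int} := 'X - 1.
Let Z : {poly int} := 'X^p - 1.
(** The preimage in [Z[X]] of the [k]-th power of the augmentation ideal of [Z[X]/(X^p - 1)]. *)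
Let inJ k (f : {poly int}) := exists g h, f = Y ^+ k * g + Z * h.

Let inJD k f g : inJ k f -> inJ k g -> inJ k (f + g).
Proof.
by move=> [a [b ->]] [c [d ->]]; exists (a + c), (b + d); rewrite !mulrDr addrACA.
Qed.

Let inJM k f g : inJ k f -> inJ k (f * g).
Proof.
by move=> [a [b ->]]; exists (a * g), (b * g); rewrite mulrDl !mulrA.
Qed.

Let inJZ k h : inJ k (Z * h).
Proof. by exists 0, h; rewrite mulr0 add0r. Qed.

(** First-order expansion at [1]. For [m = t] it gives the action of the substitution on [Y], for
    [m = p] it shows that [p Y] is a multiple of [Y^2] modulo [Z]. *)
Let expX_sub1 m : exists q, 'X^m - 1 = Y * (m%:R + Y * q).
Proof.
elim: m => [|m [q IH]]; first by exists 0; rewrite expr0 subrr mulr0 addr0 mulr0.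
exists (m%:R + Y * q + q); rewrite exprS.
have -> : 'X * 'X^m - 1 = Y * ('X^m - 1) + ('X^m - 1) + Y by rewrite /Y; ring.
by rewrite IH; ring.
Qed.

Let factor_at1 (g : {poly int}) : exists q, g = (g.[1])%:P + Y * q.
Proof.
have /factor_theorem[q qE] : root (g - (g.[1])%:P) 1 by rewrite rootE !hornerE subrr.
by exists q; rewrite /Y mulrC -polyC1 -qE addrC subrK.
Qed.

Let Xmod m : inJ n.+1 ('X^m - 'X^(m %% p)).
Proof.
rewrite {1}(divn_eq m p) exprD mulnC exprM.
rewrite -{2}['X^(m %% p)]mul1r -mulrBl; apply: inJM.
have -> : 'X^p = Z + 1 by rewrite /Z subrK.
elim: (m %/ p)%N => [|q IH]; first by rewrite expr0 subrr -(mulr0 Z).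
rewrite exprS mulrDl mul1r -addrA; exact: inJD (inJZ _ _) IH.
Qed.

Let f0 : {poly int} := \sum_(j < n.+1) 'X^(t ^ j %% p) - n.+1%:R.

Let inJ_le k l f : (k <= l)%N -> inJ l f -> inJ k f.
Proof.
move=> /subnKC <- [g [h ->]]; exists (Y ^+ (l - k) * g), h.
by rewrite exprD mulrA.
Qed.

(* The substitution [X := X^t] cyclically permutes the terms of [f0] modulo
   [X^p - 1] and multiplies [(X - 1)^k] by [t^k] modulo [(X - 1)^(k + 1)]. *)
Let f0_comp k : (k <= n)%N -> inJ k.+1 (f0 \Po 'X^t - f0).
Proof.
move=> kn; apply: (@inJ_le _ n.+1) => //.
rewrite /f0 rmorphB /= rmorph_nat opprB addrA subrK rmorph_sum /=.
under eq_bigr do rewrite rmorphXn /= comp_polyX -exprM.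
have E j : inJ n.+1 ('X^(t * (t ^ j %% p)) - 'X^(t ^ j.+1 %% p)).
  by rewrite expnS -modnMmr; exact: Xmod.
(* The first term of the original sum is moved to the end, where [t ^ n.+1 = 1] closes the cycle;
   both sums then run over the exponents [t ^ j.+1]. *)
rewrite [X in _ - X]big_ord_recl -[X in - X]addrC expn0.
have -> : 'X^(1 %% p) = 'X^(t ^ n.+1 %% p) :> {poly int} by rewrite tn.
rewrite -[X in _ - X](big_ord_recr n (fun j => 'X^(t ^ j.+1 %% p))) /=.
rewrite -sumrB; elim/big_ind: _ => //; first by exists 0, 0; rewrite !mulr0 addr0.
by move=> f g; exact: inJD.
Qed.

Let Z_comp : exists q, Z \Po 'X^t = Z * q.
Proof.
exists (\sum_(i < t) 'X^p ^+ i).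
by rewrite /Z rmorphB /= rmorphXn /= comp_polyX rmorph1 -subrX1 -!exprM mulnC.
Qed.

Let p_inJ k : (0 < k)%N -> inJ k.+1 (p%:R * Y ^+ k).
Proof.
case: k => // k _; have [q E] := expX_sub1 p.
exists (- q), (Y ^+ k); rewrite /Z E !exprS; ring.
Qed.

(** Induction on [k]. Write [f0] as [a Y^(k+1)] modulo the next power, with [a] an integer.
    Invariance under [X := X^t] puts [(t^(k+1) - 1) a Y^(k+1)] in that power, and [p_inJ] does the
    same for [p a Y^(k+1)]. The two factors are coprime, so [a Y^(k+1)] lies there too. *)
Let f0_inJ k : (k <= n)%N -> inJ k.+1 f0.
Proof.
elim: k => [|k IH] kn.
  have [q qE] := factor_at1 f0; exists q, 0; rewrite mulr0 addr0 expr1 {1}qE.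
  rewrite /f0 hornerD hornerN horner_sum.
  under eq_bigr do rewrite hornerXn expr1n.
  by rewrite sumr_const card_ord -polyC_natr hornerC subrr polyC0 add0r.
have [g [h fE]] := IH (ltnW kn).
have [q gE] := factor_at1 g; set a := g.[1] in gE.
have H1 : inJ k.+2 (f0 - Y ^+ k.+1 * a%:P).
  exists q, h; rewrite fE {1}gE (exprSr _ k.+1); ring.
have [r rE] := expX_sub1 t; have [s sE] := Z_comp.
have [u uE] : exists u, (t%:R + Y * r) ^+ k.+1 = (t ^ k.+1)%:R + Y * u.
  elim: k.+1 => [|m [u IHm]]; first by exists 0; rewrite expr0 expn0 mulr0 addr0.
  exists (t%:R * u + r * ((t ^ m)%:R + Y * u)).
  by rewrite exprS IHm expnS natrM; ring.
have [g' gE'] : exists g', g \Po 'X^t = a%:P + Y * g'.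
  exists ((t%:R + Y * r) * (q \Po 'X^t)).
  by rewrite gE rmorphD /= rmorphM /= comp_polyC rmorphB /= comp_polyX rmorph1 rE; ring.
have H2 : inJ k.+2 (f0 \Po 'X^t - (t ^ k.+1)%:R * Y ^+ k.+1 * a%:P).
  exists ((t ^ k.+1)%:R * g' + u * (a%:P + Y * g')), (s * (h \Po 'X^t)).
  rewrite fE rmorphD /= !rmorphM /= rmorphXn /= rmorphB /= comp_polyX rmorph1 rE.
  rewrite exprMn uE sE gE' (exprSr _ k.+1); ring.
have H3 : inJ k.+2 (((t ^ k.+1)%:R - 1) * Y ^+ k.+1 * a%:P).
  have := inJD (f0_comp kn) (inJD (inJM (-1) H2) H1).
  by congr inJ; ring.
have H4 : inJ k.+2 (p%:R * Y ^+ k.+1) by exact: p_inJ.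
have cop : coprimez (p%:Z) ((t ^ k.+1)%:Z - 1).
  have tN := tk (k := k.+1); have {}tN : (t ^ k.+1 != 1 %[mod p])%N by apply: tN.
  have t0 : (0 < t ^ k.+1)%N.
    rewrite expn_gt0; case: (posnP t) => // t0; move: tn.
    by rewrite t0 exp0n// mod0n modn_small ?prime_gt1.
  rewrite (_ : _ - 1 = (t ^ k.+1 - 1)%N%:Z); last by rewrite -subzn.
  rewrite /coprimez /gcdz !absz_nat.
  change (coprime p (t ^ k.+1 - 1)); by rewrite prime_coprime// -eqn_mod_dvd.
have [c [d]] := Bezoutz (p%:Z) ((t ^ k.+1)%:Z - 1).
rewrite (eqP cop) => cdE.
have E1 : (c%:~R * p%:R + d%:~R * ((t ^ k.+1)%:R - 1) : {poly int}) = 1.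
  have /(congr1 (fun z : int => z%:~R : {poly int})) := cdE.
  by rewrite rmorphD !rmorphM rmorphB /= !rmorph1.
have H5 : inJ k.+2 (Y ^+ k.+1 * a%:P).
  have := inJD (inJM (c%:~R * a%:P) H4) (inJM d%:~R H3).
  congr inJ; rewrite -[RHS]mul1r -[X in X * (_ * _)]E1; ring.
by have := inJD H1 H5; rewrite subrK.
Qed.

Lemma sum_roots_in_augmentation_power : exists g h : {poly int},
  \sum_(j < n.+1) 'X^(t ^ j %% p) - n.+1%:R
  = ('X - 1) ^+ n.+1 * g + ('X^p - 1) * h.
Proof. exact: f0_inJ. Qed.

End AugmentationPower.

Local Open Scope complex_scope.

(** * Equivariant matrices of polynomials and Clifford multiplication *)

Section ComplexPolynomials.
Variables (R : realType) (n : nat).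
Local Notation X := 'M[R]_(n.+1, 2).
Local Notation C := R[i].

(** Conjugates are included so that the class is closed under adjoints. The inductive form allows
    smoothness and Lipschitz bounds to be proved by structural induction. *)
Inductive cpoly : (X -> C) -> Prop :=
| cpoly_cst c : cpoly (fun=> c)
| cpoly_coord j : cpoly (fun x => zcoord x j)
| cpoly_coordJ j : cpoly (fun x => (zcoord x j)^*)
| cpolyD f g : cpoly f -> cpoly g -> cpoly (fun x => f x + g x)
| cpolyM f g : cpoly f -> cpoly g -> cpoly (fun x => f x * g x).

Lemma eq_cpoly f g : cpoly f -> f =1 g -> cpoly g.
Proof. by move=> cf /funext <-. Qed.

Lemma cpolyN f : cpoly f -> cpoly (fun x => - f x).
Proof.
by move=> cf; apply: eq_cpoly (cpolyM (cpoly_cst (-1)) cf) _ => x; rewrite mulN1r.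
Qed.

Lemma cpoly_sum I (r : seq I) (f : I -> X -> C) :
  (forall i, cpoly (f i)) -> cpoly (fun x => \sum_(i <- r) f i x).
Proof.
move=> cf; elim: r => [|i r IH].
  by apply: eq_cpoly (cpoly_cst 0) _ => x; rewrite big_nil.
by apply: eq_cpoly (cpolyD (cf i) IH) _ => x; rewrite big_cons.
Qed.

Lemma cpoly_prod I (r : seq I) (f : I -> X -> C) :
  (forall i, cpoly (f i)) -> cpoly (fun x => \prod_(i <- r) f i x).
Proof.
move=> cf; elim: r => [|i r IH].
  by apply: eq_cpoly (cpoly_cst 1) _ => x; rewrite big_nil.
by apply: eq_cpoly (cpolyM (cf i) IH) _ => x; rewrite big_cons.
Qed.

Lemma cpolyX f k : cpoly f -> cpoly (fun x => f x ^+ k).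
Proof.
move=> cf; elim: k => [|k IH]; first exact: cpoly_cst.
by apply: eq_cpoly (cpolyM cf IH) _ => x; rewrite exprS.
Qed.

Lemma cpolyJ f : cpoly f -> cpoly (fun x => (f x)^*).
Proof.
elim=> {f} [c|j|j|f g _ IHf _ IHg|f g _ IHf _ IHg].
- exact: cpoly_cst.
- exact: cpoly_coordJ.
- by apply: eq_cpoly (cpoly_coord j) _ => x; rewrite conjcK.
- by apply: eq_cpoly (cpolyD IHf IHg) _ => x; rewrite rmorphD.
- by apply: eq_cpoly (cpolyM IHf IHg) _ => x; rewrite rmorphM.
Qed.

Definition cpoly_mx M N (F : X -> 'M[C]_(M, N)) :=
  forall i j, cpoly (fun x => F x i j).

Lemma cpoly_det N (F : X -> 'M[C]_N) : cpoly_mx F -> cpoly (fun x => \det (F x)).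
Proof.
move=> cF; apply: cpoly_sum => s; apply: cpolyM; first exact: cpoly_cst.
by apply: cpoly_prod => i; exact: cF.
Qed.

Lemma cpoly_mulmx L M N (F : X -> 'M[C]_(L, M)) (G : X -> 'M[C]_(M, N)) :
  cpoly_mx F -> cpoly_mx G -> cpoly_mx (fun x => F x *m G x).
Proof.
move=> cF cG i j; apply: (@eq_cpoly (fun x => \sum_k F x i k * G x k j)).
  by apply: cpoly_sum => k; apply: cpolyM.
by move=> x; rewrite mxE.
Qed.

Lemma cpoly_addmx M N (F G : X -> 'M[C]_(M, N)) :
  cpoly_mx F -> cpoly_mx G -> cpoly_mx (fun x => F x + G x).
Proof.
by move=> cF cG i j; apply: eq_cpoly (cpolyD (cF i j) (cG i j)) _ => x; rewrite mxE.
Qed.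

Lemma cpoly_scalemx M N f (F : X -> 'M[C]_(M, N)) :
  cpoly f -> cpoly_mx F -> cpoly_mx (fun x => f x *: F x).
Proof.
by move=> cf cF i j; apply: eq_cpoly (cpolyM cf (cF i j)) _ => x; rewrite mxE.
Qed.

Lemma cpoly_adj N (F : X -> 'M[C]_N) : cpoly_mx F -> cpoly_mx (fun x => \adj (F x)).
Proof.
move=> cF i j; apply: (@eq_cpoly (fun x => cofactor (F x) j i)); last first.
  by move=> x; rewrite mxE.
apply: cpolyM; first exact: cpoly_cst.
apply: cpoly_det => k l.
by apply: eq_cpoly (cF (lift j k) (lift i l)) _ => x; rewrite !mxE.
Qed.

End ComplexPolynomials.

(** * Lists of weights and their classes in the representation ring *)

Definition catf (T : Type) M N (f : 'I_M -> T) (g : 'I_N -> T) (i : 'I_(M + N)) : T :=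
  match fintype.split i with inl j => f j | inr j => g j end.

Lemma catf_lshift T M N (f : 'I_M -> T) (g : 'I_N -> T) i : catf f g (lshift N i) = f i.
Proof.
rewrite /catf; case: split_ordP => [j /lshift_inj ->//|j /eqP].
by rewrite eq_lrshift.
Qed.

Lemma catf_rshift T M N (f : 'I_M -> T) (g : 'I_N -> T) i : catf f g (rshift M i) = g i.
Proof.
rewrite /catf; case: split_ordP => [j /eqP|j /rshift_inj ->//].
by rewrite eq_rlshift.
Qed.

(** The character of the representation with weights [f i], lifted from [Z[X]/(X^p - 1)] to [Z[X]];
    the relation [X^p = 1] enters only through [null_order]. *)
Definition wsum N (f : 'I_N -> nat) : {poly int} := \sum_i 'X^(f i).

Lemma wsum_catf M N (f : 'I_M -> nat) (g : 'I_N -> nat) :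
  wsum (catf f g) = wsum f + wsum g.
Proof.
rewrite /wsum big_split_ord /=; congr (_ + _); apply: eq_bigr => i _.
  by rewrite catf_lshift.
by rewrite catf_rshift.
Qed.

Lemma wsum_shift N (f : 'I_N -> nat) a : wsum (fun i => (f i + a)%N) = wsum f * 'X^a.
Proof. by rewrite /wsum mulr_suml; apply: eq_bigr => i _; rewrite exprD. Qed.

(** The coefficient of [X^k] counts the indices of weight [k], so equal sums mean equal multisets of
    weights. *)
Lemma wsum_perm N (f g : 'I_N -> nat) : wsum f = wsum g ->
  exists s : 'S_N, forall i, f (s i) = g i.
Proof.
move=> fg; have H : perm_eq [tuple g i | i < N] [tuple f i | i < N].
  apply/allP => k _ /=; rewrite !count_map -!enumT.
  have E (h : 'I_N -> nat) : (wsum h)`_k = (count (fun i => h i == k) (enum 'I_N))%:R.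
    rewrite coef_sum -sum1_count natr_sum big_enum_cond [RHS]big_mkcond /=.
    by apply: eq_bigr => i _; rewrite coefXn eq_sym; case: eqP.
  have := congr1 (fun q : {poly int} => q`_k) fg; rewrite /= !E => /eqP.
  by rewrite eqr_nat eq_sym.
have /tuple_permP[s sE] := H; exists s => i.
have /(congr1 (fun t => nth 0%N t i)) := sE.
by rewrite -!tnth_nth !tnth_mktuple.
Qed.

Lemma unitmx_inj (F : fieldType) N (A : 'M[F]_N) :
  (forall v : 'cV_N, A *m v = 0 -> v = 0) -> A \in unitmx.
Proof.
move=> H; rewrite -unitmx_tr -row_free_unit -kermx_eq0; apply/eqP/row_matrixP => i.
rewrite row0; apply: (can_inj trmxK); rewrite trmx0; apply: H.
by apply: (can_inj trmxK); rewrite trmx_mul trmxK trmx0 -row_mul mulmx_ker row0.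
Qed.

Section WeightedIso.
Variables (R : realType) (n p : nat) (lambda : R[i]) (b : 'I_n.+1 -> nat).
Hypotheses (p_prime : prime p) (lambda_prim : p.-primitive_root lambda).
Local Notation X := 'M[R]_(n.+1, 2).
Local Notation C := R[i].
Local Notation S := (@sphere_set R n).
Local Notation g := (diag_act lambda b).

Lemma root_unit k : lambda ^+ k != 0.
Proof.
rewrite expf_neq0//; apply/eqP => l0; have := prim_expr_order lambda_prim.
by rewrite l0 expr0n gtn_eqF ?prime_gt0// => /esym/eqP; rewrite oner_eq0.
Qed.

Lemma root_conj k : (lambda ^+ k)^* * lambda ^+ k = 1.
Proof.
rewrite mulrC -sqr_normc normrX; suff -> : `|lambda| = 1 by rewrite !expr1n.
have := prim_expr_order lambda_prim => /(congr1 Num.norm).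
by rewrite normrX normr1 => /eqP; rewrite pexpr_eq1 ?prime_gt0// => /eqP.
Qed.

(* In terms of the lens space, [F] is a homomorphism from the sum of the line
   bundles of weights [al j] to the sum of those of weights [be i]. *)
Definition weighted_mx M N (al : 'I_N -> nat) (be : 'I_M -> nat)
    (F : X -> 'M[C]_(M, N)) :=
  cpoly_mx F /\ forall x, S x -> forall i j,
    F (g x) i j * lambda ^+ al j = lambda ^+ be i * F x i j.

Definition weighted_iso N (al be : 'I_N -> nat) :=
  exists2 F, weighted_mx al be F & forall x, S x -> F x \in unitmx.

Definition adjmx M N (A : 'M[C]_(M, N)) : 'M[C]_(N, M) := (map_mx conjc A)^T.

(** The conjugate of a power of [lambda] is its inverse, so conjugating the equivariance relation
    exchanges source and target weights. *)
Lemma weighted_adj M N (al : 'I_N -> nat) (be : 'I_M -> nat) F :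
  weighted_mx al be F -> weighted_mx be al (fun x => adjmx (F x)).
Proof.
move=> [cF wF]; split=> [i j|x Sx i j].
  by apply: eq_cpoly (cpolyJ (cF j i)) _ => x; rewrite !mxE.
rewrite !mxE; have := congr1 conjc (wF x Sx j i); rewrite !rmorphM /= => E.
rewrite -[LHS]mulr1 -(root_conj (al i)).
transitivity ((F (g x) j i)^* * (lambda ^+ al i)^* * (lambda ^+ al i * lambda ^+ be j)).
  by ring.
rewrite E -[RHS]mulr1 -(root_conj (be j)); ring.
Qed.

Lemma weighted_mulmx L M N (al : 'I_N -> nat) (be : 'I_M -> nat) (ga : 'I_L -> nat) F G :
  weighted_mx be ga F -> weighted_mx al be G -> weighted_mx al ga (fun x => F x *m G x).
Proof.
move=> [cF wF] [cG wG]; split=> [|x Sx i j]; first exact: cpoly_mulmx.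
rewrite !mxE mulr_suml mulr_sumr; apply: eq_bigr => k _.
by rewrite -mulrA wG// mulrA wF// mulrA.
Qed.

Lemma weighted_addmx M N (al : 'I_N -> nat) (be : 'I_M -> nat) F G :
  weighted_mx al be F -> weighted_mx al be G -> weighted_mx al be (fun x => F x + G x).
Proof.
move=> [cF wF] [cG wG]; split=> [|x Sx i j]; first exact: cpoly_addmx.
by rewrite !mxE mulrDl mulrDr wF// wG.
Qed.

Lemma weighted_oppmx M N (al : 'I_N -> nat) (be : 'I_M -> nat) F :
  weighted_mx al be F -> weighted_mx al be (fun x => - F x).
Proof.
move=> [cF wF]; split=> [i j|x Sx i j].
  by apply: eq_cpoly (cpolyN (cF i j)) _ => x; rewrite mxE.
by rewrite !mxE mulNr mulrN wF.
Qed.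

Lemma weighted_shift M N (al : 'I_N -> nat) (be : 'I_M -> nat) F a :
  weighted_mx al be F -> weighted_mx (fun j => al j + a)%N (fun i => be i + a)%N F.
Proof.
move=> [cF wF]; split=> // x Sx i j.
by rewrite !exprD mulrA wF// -!mulrA [X in _ * X]mulrC.
Qed.

(** Such an [f] is a section of the line bundle of weight [a]. *)
Definition weighted a (f : X -> C) :=
  cpoly f /\ forall x, S x -> f (g x) = lambda ^+ a * f x.

Lemma weighted_scalar N (al : 'I_N -> nat) a f : weighted a f ->
  weighted_mx al (fun i => al i + a)%N (fun x => (f x)%:M).
Proof.
move=> [cf wf]; split=> [i j|x Sx i j].
  apply: (@eq_cpoly _ _ (fun x => f x * (i == j)%:R)).
    by apply: cpolyM => //; exact: cpoly_cst.
  by move=> x; rewrite mxE mulr_natr.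
rewrite !mxE; have [->|_] := eqVneq i j; last by rewrite !mulr0n mul0r mulr0.
by rewrite !mulr1n wf// exprD; ring.
Qed.

Lemma weighted_scale M N (al : 'I_N -> nat) (be : 'I_M -> nat) f F :
  weighted 0 f -> weighted_mx al be F -> weighted_mx al be (fun x => f x *: F x).
Proof.
move=> [cf wf] [cF wF]; split=> [|x Sx i j]; first exact: cpoly_scalemx.
by rewrite !mxE wf// expr0 mul1r -mulrA wF// mulrCA.
Qed.

Lemma weighted_block M1 M2 N1 N2 (al1 : 'I_N1 -> nat) (al2 : 'I_N2 -> nat)
    (be1 : 'I_M1 -> nat) (be2 : 'I_M2 -> nat) F11 F12 F21 F22 :
  weighted_mx al1 be1 F11 -> weighted_mx al2 be1 F12 ->
  weighted_mx al1 be2 F21 -> weighted_mx al2 be2 F22 ->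
  weighted_mx (catf al1 al2) (catf be1 be2)
    (fun x => block_mx (F11 x) (F12 x) (F21 x) (F22 x)).
Proof.
move=> [c11 w11] [c12 w12] [c21 w21] [c22 w22]; split=> [i j|x Sx i j].
  case: (split_ordP i) => k ->; case: (split_ordP j) => l ->.
  - by apply: eq_cpoly (c11 k l) _ => x; rewrite block_mxEul.
  - by apply: eq_cpoly (c12 k l) _ => x; rewrite block_mxEur.
  - by apply: eq_cpoly (c21 k l) _ => x; rewrite block_mxEdl.
  - by apply: eq_cpoly (c22 k l) _ => x; rewrite block_mxEdr.
case: (split_ordP i) => k ->; case: (split_ordP j) => l ->.
- by rewrite !block_mxEul !catf_lshift w11.
- by rewrite !block_mxEur catf_lshift catf_rshift w12.
- by rewrite !block_mxEdl catf_lshift catf_rshift w21.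
- by rewrite !block_mxEdr !catf_rshift w22.
Qed.

Lemma weighted_0mx M N (al : 'I_N -> nat) (be : 'I_M -> nat) :
  weighted_mx al be (fun=> 0).
Proof.
split=> [i j|x Sx i j]; last by rewrite mxE mul0r mulr0.
by apply: eq_cpoly (cpoly_cst _ 0) _ => x; rewrite mxE.
Qed.

Lemma weighted_eq M N (al al' : 'I_N -> nat) (be be' : 'I_M -> nat) F :
  al =1 al' -> be =1 be' -> weighted_mx al be F -> weighted_mx al' be' F.
Proof. by move=> /funext <- /funext <-. Qed.

(** The adjoint replaces the inverse, whose entries need not be polynomials. *)
Lemma weighted_iso_adj N (al be : 'I_N -> nat) : weighted_iso al be -> weighted_iso be al.
Proof.
move=> [F wF uF]; exists (fun x => adjmx (F x)); first exact: weighted_adj.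
by move=> x Sx; rewrite unitmx_tr map_unitmx uF.
Qed.

Lemma weighted_iso_cat M N (al be : 'I_M -> nat) (al' be' : 'I_N -> nat) :
  weighted_iso al be -> weighted_iso al' be' -> weighted_iso (catf al al') (catf be be').
Proof.
move=> [F wF uF] [G wG uG]; exists (fun x => block_mx (F x) 0 0 (G x)).
  by apply: weighted_block => //; exact: weighted_0mx.
by move=> x Sx; rewrite unitmxE det_ublock unitrM -!unitmxE uF// uG.
Qed.

Lemma weighted_iso_shift N (al be : 'I_N -> nat) a : weighted_iso al be ->
  weighted_iso (fun j => al j + a)%N (fun i => be i + a)%N.
Proof. by move=> [F wF uF]; exists F => //; exact: weighted_shift. Qed.

Lemma weighted_iso_refl N (al : 'I_N -> nat) : weighted_iso al al.
Proof.
exists (fun=> 1%:M); last by move=> *; exact: unitmx1.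
apply: (@weighted_eq _ _ al _ (fun i => al i + 0)%N) => // [i|]; first by rewrite addn0.
apply: weighted_scalar; split; first exact: cpoly_cst.
by move=> x _; rewrite mul1r.
Qed.

Lemma weighted_iso_perm N (al be : 'I_N -> nat) (s : 'S_N) :
  weighted_iso al be -> weighted_iso al (fun i => be (s i)).
Proof.
move=> [F [cF wF] uF]; exists (fun x => row_perm s (F x)); last first.
  by move=> x Sx; rewrite row_permE unitmx_mul unitmx_perm uF.
split=> [i j|x Sx i j]; last by rewrite !mxE wF.
by apply: eq_cpoly (cF (s i) j) _ => x; rewrite mxE.
Qed.

(* [f], read in the representation ring [Z[X]/(X^p - 1)], is an integral
   combination of line bundles whose class in K-theory is zero. *)
Definition null f :=
  exists N (al be : 'I_N -> nat), weighted_iso al be /\ f = wsum be - wsum al.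

Lemma nullD f h : null f -> null h -> null (f + h).
Proof.
move=> [M [al [be [w ->]]]] [N [al' [be' [w' ->]]]].
exists (M + N)%N, (catf al al'), (catf be be'); split; first exact: weighted_iso_cat.
by rewrite !wsum_catf opprD addrACA.
Qed.

Lemma nullN f : null f -> null (- f).
Proof.
move=> [M [al [be [w ->]]]]; exists M, be, al; split; first exact: weighted_iso_adj.
by rewrite opprB.
Qed.

Lemma null0 : null 0.
Proof.
exists 0%N, (fun=> 0%N), (fun=> 0%N); split; first exact: weighted_iso_refl.
by rewrite subrr.
Qed.

Lemma nullMXn f a : null f -> null (f * 'X^a).
Proof.
move=> [M [al [be [w ->]]]]; exists M, (fun j => al j + a)%N, (fun j => be j + a)%N.
by split; [exact: weighted_iso_shift|rewrite !wsum_shift mulrBl].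
Qed.

(** Null classes form an ideal: multiplication by [X^a] twists all weights by [a], and integer
    multiples are direct sums, up to exchanging the two sides. *)
Lemma nullM f h : null f -> null (f * h).
Proof.
move=> nf; rewrite -[h]coefK poly_def mulr_sumr.
elim/big_ind: _ => [|a c|i _]; [exact: null0|exact: nullD|].
rewrite -scalerAr -[h`_i]intz scaler_int.
have nfi := nullMXn i nf; have H k : null (f * 'X^i *+ k).
  elim: k => [|k IH]; first exact: null0.
  by rewrite mulrS; exact: nullD.
by case: (h`_i) => k; [exact: H|exact: nullN (H _)].
Qed.

(** The weights [0] and [p] define the same line bundle, so the identity is an isomorphism between
    them. *)
Lemma null_order : null ('X^p - 1).
Proof.
exists 1%N, (fun=> 0%N), (fun=> p); split; last by rewrite /wsum !big_ord1.
have [F [cF wF] uF] := @weighted_iso_refl 1 (fun=> 0%N); exists F => //; split=> // x Sx i j.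
by rewrite wF// expr0 (prim_expr_order lambda_prim).
Qed.

(* [F] is the Clifford multiplication by a list of weighted functions, on the
   exterior algebra of the sum of the corresponding line bundles *)
Definition clifford f (q : X -> C) := exists N (al be : 'I_N -> nat) F,
  [/\ weighted_mx al be F, f = wsum be - wsum al &
      forall x, F x *m adjmx (F x) = (q x)%:M /\ adjmx (F x) *m F x = (q x)%:M].

Lemma adjmx_block M1 M2 N1 N2 (A : 'M[C]_(M1, N1)) (B : 'M[C]_(M1, N2))
  (A' : 'M[C]_(M2, N1)) (B' : 'M[C]_(M2, N2)) :
  adjmx (block_mx A B A' B') = block_mx (adjmx A) (adjmx A') (adjmx B) (adjmx B').
Proof. by rewrite /adjmx map_block_mx tr_block_mx. Qed.

Lemma adjmxK M N : cancel (@adjmx M N) (@adjmx N M).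
Proof. by move=> A; apply/matrixP => i j; rewrite !mxE conjcK. Qed.

Lemma adjmx_scalar N (c : C) : adjmx (c%:M : 'M[C]_N) = (conjc c)%:M.
Proof. by rewrite /adjmx map_scalar_mx tr_scalar_mx. Qed.

Lemma adjmxN M N (A : 'M[C]_(M, N)) : adjmx (- A) = - adjmx A.
Proof. by apply/matrixP => i j; rewrite !mxE rmorphN. Qed.

Lemma clifford_start a s : weighted a s -> clifford ('X^a - 1) (fun x => s x * (s x)^*).
Proof.
move=> ws; exists 1%N, (fun=> 0%N), (fun=> (0 + a)%N), (fun x => (s x)%:M); split.
- exact: weighted_scalar.
- by rewrite /wsum !big_ord1.
- by move=> x; rewrite adjmx_scalar -!scalar_mxM; split; rewrite // mulrC.
Qed.

(** Adding a line bundle [L] to [E] turns the exterior algebra of [E] into its sum with its twist by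
    [L]. In the product of the block matrix with its adjoint the off-diagonal blocks cancel because
    [s] acts as a scalar, and the squared norms add up on the diagonal. *)
Lemma clifford_step f q a s : clifford f q -> weighted a s ->
  clifford (f * ('X^a - 1)) (fun x => q x + s x * (s x)^*).
Proof.
move=> [N [al [be [F [wF -> E]]]]] ws.
exists (N + N)%N, (catf (fun i => al i + a)%N be), (catf (fun i => be i + a)%N al),
  (fun x => block_mx (F x) (s x)%:M (- adjmx (s x)%:M) (adjmx (F x))); split.
- apply: weighted_block.
  + exact: weighted_shift.
  + exact: weighted_scalar.
  + by apply/weighted_oppmx/weighted_adj/weighted_scalar.
  + exact: weighted_adj.
- by rewrite !wsum_catf !wsum_shift; ring.
- move=> x; have [E1 E2] := E x.
  rewrite adjmx_block adjmxN !adjmxK !mulmx_block E1 E2 adjmx_scalar.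
  rewrite ?mulmxN ?mulNmx ?opprK -?scalar_mxM !mul_scalar_mx !mul_mx_scalar.
  rewrite !addNr !subrr [(s x)^* * _]mulrC -!raddfD /= [_ * _ + _]addrC.
  by rewrite -scalar_mx_block.
Qed.

Lemma clifford_null f q : clifford f q -> (forall x, S x -> q x != 0) -> null f.
Proof.
move=> [N [al [be [F [wF -> E]]]]] q0; exists N, al, be; split=> //; exists F => // x Sx.
have [E1 _] := E x; have : (q x)^-1 *: (F x *m adjmx (F x)) = 1%:M.
  by rewrite E1 scale_scalar_mx mulVf// q0.
by rewrite scalemxAr => /mulmx1_unit[].
Qed.

Hypothesis b_bounds : forall j, (1 <= b j <= p - 1)%N.

(** Since [b j] is invertible modulo [p], some power of [z_j] carries weight [a] to weight [c]. This
    supplies both the Clifford functions and the perturbations used for cancellation. *)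
Lemma weight_exists j a c : exists k, lambda ^+ (b j * k + a) = lambda ^+ c.
Proof.
have p_gt1 := prime_gt1 p_prime; have /andP[b1 b2] := b_bounds j.
have cop : coprime (b j) p.
  by rewrite coprime_sym prime_coprime//; apply/negP => /(dvdn_leq b1); lia.
have [[u v] /= uv] : exists uv : nat * nat, (b j * uv.1 = uv.2 * p + 1)%N.
  have [u v uv _] := egcdnP p b1; exists (u, v) => /=.
  by rewrite mulnC uv (eqP cop).
(* Here [u] inverts [b j] modulo [p], and [p * a - a] represents [- a] modulo [p] as a natural
   number. *)
have p_gt0 := prime_gt0 p_prime; exists (u * (c + (p * a - a)))%N.
rewrite mulnA uv mulnDl mul1n -mulnA.
rewrite [(v * _)%N]mulnC -mulnA mulnC -!addnA subnK; last by rewrite leq_pmull.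
have root1 k : (lambda ^+ k) ^+ p = 1.
  by rewrite -exprM mulnC exprM (prim_expr_order lambda_prim) expr1n.
rewrite addnCA !exprD !exprM (prim_expr_order lambda_prim) expr1n -!exprM mulnA exprM.
by rewrite root1 !mulr1.
Qed.

Lemma weighted_coord j k a : lambda ^+ (b j * k) = lambda ^+ a ->
  weighted a (fun x => zcoord x j ^+ k).
Proof.
move=> E; split=> [|x _]; first exact/cpolyX/cpoly_coord.
by rewrite zcoord_act exprMn -exprM E.
Qed.

Lemma sphere_coord_neq0 x : S x -> exists j, zcoord x j != 0.
Proof.
move=> xS; apply/not_existsP => H; have x0 : x = 0.
  apply: zcoord_inj => j; have /negP/negPn/eqP -> := H j.
  by rewrite /zcoord !mxE.
move: xS; rewrite /sphere_set /= x0 big1 => [/eqP|j _].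
  by rewrite eq_sym oner_eq0.
by rewrite big1// => l _; rewrite mxE expr0n.
Qed.

Lemma null_augmentation : null (('X - 1) ^+ n.+1).
Proof.
have [k kE] := choice (fun j => weight_exists j 0 1).
pose s j (x : X) := zcoord x j ^+ k j.
have ws j : weighted 1 (s j) by apply: weighted_coord; rewrite -(kE j) addn0.
have cl r j : clifford (('X - 1) ^+ (size r).+1)
    (fun x => \sum_(i <- j :: r) s i x * (s i x)^*).
  elim: r => [|i r IH].
    have -> : (fun x => \sum_(i <- [:: j]) s i x * (s i x)^*)
              = (fun x => s j x * (s j x)^*).
      by apply/funext => x; rewrite big_seq1.
    by rewrite expr1 -['X]expr1; exact: clifford_start.
  have -> : (fun x => \sum_(i <- [:: j, i & r]) s i x * (s i x)^*) =
      (fun x => \sum_(i <- j :: r) s i x * (s i x)^* + s i x * (s i x)^*).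
    by apply/funext => x; rewrite !big_cons -[RHS]addrA; congr (_ + _); exact: addrC.
  rewrite exprSr -{2}['X]expr1; exact: clifford_step.
have [j [r rE]] : exists j r, enum 'I_n.+1 = j :: r.
  have := size_enum_ord n.+1; case: (enum _) => [//|j r] _; by exists j, r.
have sz : (size r).+1 = n.+1 by have := size_enum_ord n.+1; rewrite rE.
rewrite -sz; apply: clifford_null (cl r j) _ => x Sx.
(* The scalar is the sum of the [|s i x|^2]; its term at a nonzero coordinate [z_l] is positive. *)
have [l xl] := sphere_coord_neq0 Sx.
rewrite -rE big_enum /= (eq_bigr (fun i => `|s i x| ^+ 2)); last first.
  by move=> i _; rewrite sqr_normc.
apply/eqP => /psumr_eq0P/(_ l isT) => /(_ (fun i _ => exprn_ge0 2 (normr_ge0 _)))/eqP.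
by rewrite expf_eq0 /= normr_eq0 expf_eq0 (negbTE xl) andbF.
Qed.

End WeightedIso.

Local Open Scope classical_set_scope.

(** * Generic perturbations on the sphere *)

Section Normc.
Variable R : realType.
Import ComplexField.Normc.
Implicit Types z w : R[i].

Lemma normc_0 : normc (0 : R[i]) = 0.
Proof. exact: normc0. Qed.

Lemma normcD_le z w : normc (z + w) <= normc z + normc w.
Proof. exact: (@le_normcD R z w). Qed.

Lemma normcB_le z w : normc (z - w) <= normc z + normc w.
Proof.
by apply: le_trans (normcD_le _ _) _; rewrite lerD2l (@normcN R w).
Qed.

Lemma normc_ge0 z : 0 <= normc z.
Proof. by case: z => a c /=; exact: sqrtr_ge0. Qed.

Lemma normc_sum I (r : seq I) (P : pred I) (F : I -> R[i]) :
  normc (\sum_(i <- r | P i) F i) <= \sum_(i <- r | P i) normc (F i).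
Proof.
elim/big_rec2: _ => [|i x y _ IH]; first by have := lexx (0 : R); rewrite -{1}normc_0.
by apply: le_trans (normcD_le _ _) _; rewrite lerD2l.
Qed.

Lemma normcX z k : normc (z ^+ k) = normc z ^+ k.
Proof. by elim: k => [|k IH]; [exact: normc1|rewrite !exprS normcM IH]. Qed.

Lemma sqr_normc_Re z : normc z ^+ 2 = complex.Re (z * z^*).
Proof.
case: z => a c /=; rewrite sqr_sqrtr ?addr_ge0 ?sqr_ge0//.
by rewrite mulrN opprK !expr2.
Qed.

Lemma Re_le_normc z : `|complex.Re z| <= normc z.
Proof.
case: z => a c /=; rewrite -sqrtr_sqr. apply: ler_wsqrtr.
by rewrite lerDl sqr_ge0.
Qed.

Lemma Im_le_normc z : `|complex.Im z| <= normc z.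
Proof.
case: z => a c /=; rewrite -sqrtr_sqr; apply: ler_wsqrtr.
by rewrite lerDr sqr_ge0.
Qed.

Lemma normc_le_ReIm z : normc z <= `|complex.Re z| + `|complex.Im z|.
Proof.
case: z => a c /=; rewrite -[leRHS]ger0_norm ?addr_ge0// -sqrtr_sqr.
apply: ler_wsqrtr; rewrite sqrrD !real_normK ?num_real//.
by rewrite addrAC lerDl mulrn_wge0// mulr_ge0.
Qed.

Lemma normc_conj z : normc z^* = normc z.
Proof. by case: z => a c /=; rewrite sqrrN. Qed.

Lemma normc_eq0 z : (normc z == 0) = (z == 0).
Proof.
by apply/eqP/eqP => [/eq0_normc|->]; rewrite ?normc_0.
Qed.

End Normc.

(** * Compactness of the sphere and bounds for polynomials on it *)

Section SphereAnalysis.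
Variables (R : realType) (n : nat).
Local Notation X := 'M[R]_(n.+1, 2).
Local Notation C := R[i].
Local Notation S := (@sphere_set R n).
Import ComplexField.Normc.

Lemma sphere_coord_le1 x i k : S x -> `|x i k| <= 1.
Proof.
rewrite /sphere_set /= (bigD1 i)//= (bigD1 k)//= -addrA => xS.
rewrite -(@ler_pXn2r _ 2)// ?nnegrE// expr1n real_normK ?num_real// -xS lerDl.
rewrite addr_ge0 ?sumr_ge0// => j _; first exact: sqr_ge0.
by rewrite sumr_ge0// => l _; exact: sqr_ge0.
Qed.

Lemma cpoly_Ck f : cpoly f -> forall k,
  Ck_on k setT (fun x : X => complex.Re (f x)) /\
  Ck_on k setT (fun x : X => complex.Im (f x)).
Proof.
have oT : open [set: X] := openT.
have cst k (a : R) : Ck_on k setT (fun _ : X => a) by move=> x _; exact: Ck_cst.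
have co k i j : Ck_on k setT (fun x : X => x i j : R).
  by apply: Ck_on_coord => //; exact: Ck_on_id.
elim=> {f} [c|j|j|f h _ IHf _ IHh|f h _ IHf _ IHh] k; split.
- exact: cst.
- exact: cst.
- exact: co.
- exact: co.
- exact: co.
- apply: (@Ck_on_ext _ _ _ _ _ (fun x : X => -1 * x j 1)) => //.
    by move=> x _; rewrite mulN1r.
  exact: Ck_onM.
- apply: (@Ck_on_ext _ _ _ _ _ (fun x : X => complex.Re (f x) + complex.Re (h x))) => //.
    by move=> x _; rewrite raddfD.
  by apply: Ck_onD => //; [case: (IHf k)|case: (IHh k)].
- apply: (@Ck_on_ext _ _ _ _ _ (fun x : X => complex.Im (f x) + complex.Im (h x))) => //.
    by move=> x _; rewrite raddfD.
  by apply: Ck_onD => //; [case: (IHf k)|case: (IHh k)].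
- apply: (@Ck_on_ext _ _ _ _ _ (fun x : X => complex.Re (f x) * complex.Re (h x)
     + -1 * (complex.Im (f x) * complex.Im (h x)))) => //.
    by move=> x _; case: (f x) (h x) => [? ?] [? ?] /=; rewrite mulN1r.
  have [f1 f2] := IHf k; have [h1 h2] := IHh k.
  by apply: Ck_onD => //; apply: Ck_onM => //; apply: Ck_onM.
- apply: (@Ck_on_ext _ _ _ _ _ (fun x : X => complex.Re (f x) * complex.Im (h x)
     + complex.Im (f x) * complex.Re (h x))) => //.
    by move=> x _; case: (f x) (h x) => [? ?] [? ?] /=.
  have [f1 f2] := IHf k; have [h1 h2] := IHh k.
  by apply: Ck_onD => //; apply: Ck_onM.
Qed.

(** Matrices are flattened to row vectors, for which closed and bounded sets are compact. *)
Lemma sphere_compact : compact S.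
Proof.
pose A : set 'rV[R]_(n.+1 * 2) := [set v | S (vec_mx v)].
have -> : S = vec_mx @` A.
  apply/seteqP; split=> [x Sx|_ [v Av <-]//].
  by exists (mxvec x); rewrite /A /= mxvecK.
have cv : continuous (vec_mx : 'rV[R]_(n.+1 * 2) -> X).
  move=> v; apply: (@Ck_on_mx _ _ _ _ 0 setT _ openT) => // i j.
  apply: (@Ck_on_ext _ _ _ _ _ (fun v : 'rV[R]_(n.+1 * 2) => v 0 (mxvec_index i j))).
  - exact: openT.
  - by move=> w _; rewrite mxE.
  - by apply: Ck_on_coord; [exact: openT|by apply: Ck_on_id; exact: openT].
apply: continuous_compact; first exact/continuous_subspaceT.
apply: bounded_closed_compact.
  exists 1; split; first exact: num_real.
  move=> M M1 v Av; rewrite /= [leLHS]/Num.Def.normr/= mx_normrE.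
  apply/bigmax_leP; split; first exact: ltW (lt_trans ltr01 M1).
  move=> [i l] _ /=; case/mxvec_indexP: l => j k; rewrite (ord1 i).
  have := sphere_coord_le1 j k Av; rewrite mxE => /le_trans; apply; exact: ltW.
have cS : continuous (fun v : 'rV[R]_(n.+1 * 2) =>
    \sum_j \sum_k (vec_mx v) j k ^+ 2 : R).
  move=> v; apply: (@Ck_on_sum _ _ _ 0 setT) => // [|j]; first exact: openT.
  apply: (@Ck_on_sum _ _ _ 0 setT) => // [|k]; first exact: openT.
  apply: (@Ck_on_ext _ _ _ _ _ (fun v : 'rV[R]_(n.+1 * 2) =>
     v 0 (mxvec_index j k) * v 0 (mxvec_index j k))).
  - exact: openT.
  - by move=> w _; rewrite mxE expr2.
  - have H : Ck_on 0 setT (fun v : 'rV[R]_(n.+1 * 2) => v 0 (mxvec_index j k)).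
      by apply: Ck_on_coord; [exact: openT|by apply: Ck_on_id; exact: openT].
    by apply: Ck_onM => //; exact: openT.
have -> : A = (fun v : 'rV[R]_(n.+1 * 2) =>
    \sum_j \sum_k (vec_mx v) j k ^+ 2) @^-1` [set 1] by [].
by apply: closed_comp => [v _|]; [exact: cS|exact: closed_eq].
Qed.

Lemma sphere_inhabited : S !=set0.
Proof.
exists (delta_mx 0 0); rewrite /sphere_set /= (bigD1 0)//= (bigD1 0)//= mxE !eqxx.
rewrite expr1n !big1 ?addr0// => j /negbTE j0; last first.
  by rewrite mxE j0 andbF expr0n.
by rewrite big1// => k _; rewrite mxE j0 expr0n.
Qed.

Lemma cpoly_pos_min f : cpoly f -> (forall x, S x -> 0 < complex.Re (f x)) ->
  exists2 m, 0 < m & forall x, S x -> m <= complex.Re (f x).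
Proof.
move=> cf f0; have [|c Sc cmin] := compact_EVT_min sphere_inhabited sphere_compact
    (f := fun x => complex.Re (f x)).
  by apply: continuous_subspaceT => x; have [+ _] := cpoly_Ck cf 0; exact.
by exists (complex.Re (f c)); [exact/f0/set_mem|move=> x Sx; apply/cmin/mem_set].
Qed.

(** A single [B] bounds both the values and the Lipschitz constant, measured in the maximum of the
    entries. This makes the induction pass through products, where the two terms of the product rule
    account for the factor [2]. *)
Lemma cpoly_lip f : cpoly f -> exists2 B, 0 <= B &
  (forall x, S x -> normc (f x) <= B) /\
  forall x y h, S x -> S y -> (forall i k, `|x i k - y i k| <= h) ->
    normc (f x - f y) <= B * h.
Proof.
have H j x : S x -> normc (zcoord x j) <= 2.
  move=> Sx; apply: le_trans (normc_le_ReIm _) _ => /=.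
  by rewrite -[2]/(1 + 1); apply: lerD; exact: sphere_coord_le1.
have L j (x y : X) h : (forall i k, `|x i k - y i k| <= h) ->
    normc (zcoord x j - zcoord y j) <= 2 * h.
  move=> xy; apply: le_trans (normc_le_ReIm _) _ => /=.
  by rewrite mulr_natl mulr2n; apply: lerD.
elim=> {f} [c|j|j|f g _ [Bf f0 [Hf Lf]] _ [Bg g0 [Hg Lg]]
    |f g _ [Bf f0 [Hf Lf]] _ [Bg g0 [Hg Lg]]].
- exists (normc c); first exact: normc_ge0.
  split=> // x y h _ _ xy; rewrite subrr normc_0 mulr_ge0 ?normc_ge0//.
  exact: le_trans (xy 0 0).
- by exists 2 => //; split=> [x|x y h _ _]; [exact: H|exact: L].
- exists 2 => //; split=> [x Sx|x y h _ _ xy].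
    by change (normc (zcoord x j)^* <= 2); rewrite normc_conj H.
  change (normc ((zcoord x j)^* - (zcoord y j)^*) <= 2 * h).
  by rewrite -rmorphB normc_conj L.
- exists (Bf + Bg); first exact: addr_ge0.
  split=> [x Sx|x y h Sx Sy xy].
    by apply: le_trans (normcD_le _ _) _; apply: lerD; [exact: Hf|exact: Hg].
  rewrite opprD addrACA mulrDl; apply: le_trans (normcD_le _ _) _.
  by apply: lerD; [exact: Lf|exact: Lg].
- exists (2 * Bf * Bg); first by rewrite !mulr_ge0.
  split=> [x Sx|x y h Sx Sy xy].
    rewrite normcM -mulrA mulr_natl mulr2n; apply: ler_wpDr; first exact: mulr_ge0.
    by apply: ler_pM; rewrite ?normc_ge0 ?Hf ?Hg.
  have -> : f x * g x - f y * g y = f x * (g x - g y) + (f x - f y) * g y by ring.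
  have -> : 2 * Bf * Bg * h = Bf * (Bg * h) + (Bf * h) * Bg by ring.
  apply: le_trans (normcD_le _ _) _; rewrite !normcM.
  by apply: lerD; apply: ler_pM; rewrite ?normc_ge0 ?Hf ?Hg ?Lf ?Lg.
Qed.

End SphereAnalysis.

(** * Cells on the sphere and the counting argument *)

Section Pigeonhole.
Variables (R : realType) (n : nat).
Local Notation X := 'M[R]_(n.+1, 2).
Local Notation C := R[i].
Local Notation S := (@sphere_set R n).
Import ComplexField.Normc.

Local Notation d := (2 * n + 1)%N.
Local Notation D := (2 * n.+1)%N.
Local Notation Q := ('I_n.+1 * 'I_2)%type.

(** The [D] squared coordinates have sum [1], so they cannot all be smaller than [1/D]. *)
Lemma big_coord x : S x -> exists q : Q, 1 <= D%:R * x q.1 q.2 ^+ 2.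
Proof.
move=> xS; apply/not_existsP => H.
have : \sum_(q : Q) D%:R * x q.1 q.2 ^+ 2 < \sum_(q : Q) (1 : R).
  apply: ltr_sum => [|q _]; last by have /negP := H q; rewrite -ltNge.
  by apply/hasP; exists (0, 0); rewrite ?mem_index_enum.
rewrite -mulr_sumr -(pair_big xpredT xpredT (fun i k => x i k ^+ 2)) /=.
move: xS; rewrite /sphere_set /= => ->.
by rewrite sumr_const card_prod !card_ord mulr1 mulnC ltxx.
Qed.

(** The cube of side [1/c] containing the coordinates of [x] other than [q]. The shift by [1] moves
    them to [[0, 2]], so the indices are at most [2 * c]; the number of cells grows like [c ^ d],
    with [d] the dimension of the sphere. *)
Definition cell c (q : Q) (x : X) : {ffun 'I_d -> 'I_(2 * c).+1} :=
  [ffun l => inord (Num.truncn (c%:R * (x (idx q l).1 (idx q l).2 + 1)))].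

(** The coordinates other than [q] differ by at most [1/c]. For the coordinate at [q], the sphere
    equation bounds the difference of squares [u^2 - v^2], and dividing by [u + v] costs at most a
    factor [D]: the signs agree, so [|u + v|] is at least [|u|], hence at least [1/D]. *)
Lemma cell_close c q x y : (0 < c)%N -> S x -> S y -> 1 <= D%:R * x q.1 q.2 ^+ 2 ->
  (0 <= x q.1 q.2) = (0 <= y q.1 q.2) -> cell c q x = cell c q y ->
  forall i k, `|x i k - y i k| <= (2 * D * d)%:R / c%:R.
Proof.
move=> c0 Sx Sy xq sgn xy; have c0' : 0 < c%:R :> R by rewrite ltr0n.
have xyl l : `|x (idx q l).1 (idx q l).2 - y (idx q l).1 (idx q l).2| <= c%:R^-1.
  have /ffunP/(_ l) := xy; rewrite !ffunE.
  set a := x _ _; set a' := y _ _.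
  have T (z : X) : S z -> let u := c%:R * (z (idx q l).1 (idx q l).2 + 1) in
      (0 <= u) && (Num.truncn u < (2 * c).+1)%N.
    move=> Sz /=; have := sphere_coord_le1 (idx q l).1 (idx q l).2 Sz.
    rewrite ler_norml => /andP[z1 z2].
    have u0 : 0 <= c%:R * (z (idx q l).1 (idx q l).2 + 1).
      by rewrite mulr_ge0// -[1]opprK subr_ge0.
    rewrite u0 /= ltnS -(ler_nat R); have /andP[+ _] := truncn_itv u0.
    move=> /le_trans; apply; rewrite natrM mulrC ler_wpM2r//.
    by rewrite -[2]/(1 + 1) lerD2r.
  have /andP[a0 aT] := T x Sx; have /andP[a0' aT'] := T y Sy.
  move=> /(congr1 val); rewrite /= !inordK//.
  have := truncn_itv a0; have := truncn_itv a0'; rewrite -/a -/a'.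
  move=> /andP[l1 l2] /andP[l3 l4] E.
  rewrite E in l3 l4; rewrite -(ler_pM2l c0') divff ?gt_eqF//.
  rewrite -[c%:R]ger0_norm ?ler0n// -normrM.
  rewrite -natr1 in l2 l4; rewrite ler_norml; apply/andP; split; nra.
have bnd : c%:R^-1 <= (2 * D * d)%:R / c%:R :> R.
  by rewrite -[leLHS]mul1r ler_wpM2r ?invr_ge0 ?ler0n// ler1n; lia.
move=> i k; have [qE|qE] := eqVneq (i, k) q; last first.
  by have := xyl (pos q (i, k)); rewrite posK//= => /le_trans; apply.
have [-> ->] : i = q.1 /\ k = q.2 by rewrite -qE.
set u := x _ _ in xq sgn *; set v := y _ _ in sgn *.
have sum (z : X) : S z ->
    z q.1 q.2 ^+ 2 + \sum_(l < d) z (idx q l).1 (idx q l).2 ^+ 2 = 1.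
  by move=> Sz; rewrite -(sum_idx q (fun q => z q.1 q.2 ^+ 2)); exact: Sz.
have E : u ^+ 2 - v ^+ 2 = \sum_(l < d)
   (y (idx q l).1 (idx q l).2 - x (idx q l).1 (idx q l).2) *
   (y (idx q l).1 (idx q l).2 + x (idx q l).1 (idx q l).2).
  under eq_bigr do rewrite -subr_sqr.
  rewrite sumrB; have := sum x Sx; have := sum y Sy; rewrite -/u -/v; lra.
have E2 : `|u ^+ 2 - v ^+ 2| <= (2 * d)%:R / c%:R.
  rewrite E; apply: le_trans (ler_norm_sum _ _ _) _.
  have -> : (2 * d)%:R / c%:R = \sum_(l < d) (c%:R^-1 * 2) :> R.
    by rewrite sumr_const card_ord -mulr_natl natrM; ring.
  apply: ler_sum => l _; rewrite normrM distrC; apply: ler_pM => //.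
  apply: le_trans (ler_normD _ _) _; rewrite -[2]/(1 + 1).
  by apply: lerD; exact: sphere_coord_le1.
have u1 : `|u| <= 1 by exact: sphere_coord_le1.
have uv : `|u| <= `|u + v|.
  have [u0|u0] := leP 0 u.
    by rewrite !ger0_norm ?addr_ge0 -?sgn ?lerDl// -sgn.
  have v0 : v < 0 by rewrite ltNge -sgn -ltNge.
  by rewrite !ltr0_norm ?addr_lt0//; lra.
have uu : 1 <= D%:R * `|u|.
  apply: le_trans xq _; rewrite ler_wpM2l ?ler0n// -(@real_normK _ u) ?num_real//.
  by rewrite expr2 ler_piMr.
have -> : (2 * D * d)%:R / c%:R = D%:R * ((2 * d)%:R / c%:R) :> R.
  by rewrite !natrM; ring.
apply: le_trans (_ : D%:R * `|u ^+ 2 - v ^+ 2| <= _); last by rewrite ler_wpM2l ?ler0n.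
rewrite subr_sqr normrM mulrCA -[leLHS]mulr1 ler_wpM2l//.
by apply: le_trans uu _; rewrite ler_wpM2l ?ler0n.
Qed.


Section Generic.
Variables (M : nat) (a0 : X -> C) (a : 'I_M -> X -> C) (e : 'I_n.+1 -> 'I_M -> nat).
Hypotheses (nM : (n < M)%N) (ca0 : cpoly a0) (ca : forall j, cpoly (a j)).
Hypothesis a_neq0 : forall x, S x -> a0 x != 0 \/ exists j, a j x != 0.

Let J := ('I_M * bool)%type.
Let grid K := {ffun 'I_n.+1 * J -> 'I_K.+1}.

(** Real and imaginary parts are multiples of [1/(K+1)] in [[0, 1)], so distinct coefficients are at
    distance at least [1/(K+1)]. *)
Let coef K (g : grid K) l j : C :=
  ((g (l, (j, false)))%:R / K.+1%:R) +i* ((g (l, (j, true)))%:R / K.+1%:R).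

Let coef_le2 K (g : grid K) l j : normc (coef g l j) <= 2.
Proof.
have H (i : 'I_K.+1) : `|i%:R / K.+1%:R : R| <= 1.
  by rewrite normf_div !normr_nat ler_pdivrMr ?ltr0n// mul1r ler_nat ltnW.
by apply: le_trans (normc_le_ReIm _) _; rewrite -[2]/(1 + 1) lerD ?H.
Qed.

Let zero K (g : grid K) x :=
  S x /\ forall j, a j x = \sum_l coef g l j * (a0 x * zcoord x l ^+ e l j).

(** At a zero of a perturbation every [|a j x|] is at most a constant times [|a0 x|], while the sum
    of all squared moduli has a positive minimum on the sphere. The bound is uniform in [K] and
    [g]. *)
Let a0_large : exists2 mu, 0 < mu &
  forall K (g : grid K) x, zero g x -> mu <= normc (a0 x).
Proof.
pose f x := a0 x * (a0 x)^* + \sum_j a j x * (a j x)^*.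
have cf : cpoly f.
  by apply: cpolyD; [|apply: cpoly_sum => j]; apply: cpolyM => //; exact: cpolyJ.
have fE x : complex.Re (f x) = normc (a0 x) ^+ 2 + \sum_j normc (a j x) ^+ 2.
  rewrite raddfD raddf_sum; congr (_ + _); first by rewrite sqr_normc_Re.
  by apply: eq_bigr => j _; rewrite sqr_normc_Re.
have [|m m0 mf] := cpoly_pos_min cf.
  move=> x Sx; rewrite fE; have [a00|[j aj0]] := a_neq0 Sx.
    rewrite ltr_pwDl ?sumr_ge0// => [|j _]; last exact: sqr_ge0.
    by rewrite exprn_gt0// lt_neqAle eq_sym normc_eq0 a00 normc_ge0.
  rewrite ltr_wpDl ?sqr_ge0// (bigD1 j)//= ltr_pwDl ?sumr_ge0// => [|i _].
    by rewrite exprn_gt0// lt_neqAle eq_sym normc_eq0 aj0 normc_ge0.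
  exact: sqr_ge0.
(* Both the coefficients and the coordinates [z_l] have modulus at most [2]. *)
pose T : R := 1 + \sum_(j < M) (\sum_(l < n.+1) 2 * 2 ^+ e l j) ^+ 2.
have T0 : 0 < T by rewrite ltr_pwDl// sumr_ge0// => j _; rewrite sqr_ge0.
exists (Num.sqrt (m / T)); first by rewrite sqrtr_gt0 divr_gt0.
move=> K g x [Sx zx]; rewrite -[leRHS]ger0_norm ?normc_ge0// -sqrtr_sqr ler_wsqrtr//.
rewrite ler_pdivrMr//; apply: le_trans (mf x Sx) _; rewrite fE mulrDr mulr1 lerD2l.
rewrite mulr_sumr ler_sum// => j _; rewrite -exprMn.
rewrite ler_pXn2r ?nnegrE ?normc_ge0//; last first.
  by rewrite mulr_ge0 ?normc_ge0// sumr_ge0.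
rewrite zx mulr_sumr; apply: le_trans (normc_sum _ _ _) _.
apply: ler_sum => l _; rewrite !normcM mulrCA ler_wpM2l ?normc_ge0//.
apply: ler_pM; rewrite ?normc_ge0// normcX lerXn2r ?nnegrE ?normc_ge0//.
apply: le_trans (normc_le_ReIm _) _; rewrite -[2]/(1 + 1).
by apply: lerD; exact: sphere_coord_le1.
Qed.

(* At a zero [x], the block of [g] attached to a coordinate which is large at [x]
   is a Lipschitz function of [x] and of the other blocks. *)
Let zero_inj : exists2 c, (0 < c)%N & forall K (g g' : grid K) x x' q,
  zero g x -> zero g' x' -> 1 <= D%:R * x q.1 q.2 ^+ 2 ->
  (0 <= x q.1 q.2) = (0 <= x' q.1 q.2) ->
  cell (c * K.+1) q x = cell (c * K.+1) q x' ->
  (forall l j, l != q.1 -> g (l, j) = g' (l, j)) -> g = g'.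
Proof.
have [mu mu0 a0_mu] := a0_large.
have cw l j : cpoly (fun x => a0 x * zcoord x l ^+ e l j).
  by apply: cpolyM => //; exact/cpolyX/cpoly_coord.
have [Ba HBa] := choice (fun j => let: ex_intro2 B B0 HB := cpoly_lip (ca j) in
  ex_intro (fun B => 0 <= B /\ forall x y h, S x -> S y ->
    (forall i k, `|x i k - y i k| <= h) -> normc (a j x - a j y) <= B * h)
  B (conj B0 HB.2)).
have [Bw HBw] := choice (fun lj => let: ex_intro2 B B0 HB := cpoly_lip (cw lj.1 lj.2) in
  ex_intro (fun B => 0 <= B /\ forall x y h, S x -> S y ->
    (forall i k, `|x i k - y i k| <= h) ->
    normc (a0 x * zcoord x lj.1 ^+ e lj.1 lj.2 -
           a0 y * zcoord y lj.1 ^+ e lj.1 lj.2) <= B * h)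
  B (conj B0 HB.2)).
pose B := \sum_j (Ba j + \sum_l 2 * Bw (l, j)).
(* The total [em] dominates every exponent [e l j], so that [del] bounds [|a0 x * z_i ^+ e i j|]
   from below for all [j] when [z_i] has modulus at least [1/D]. *)
pose em := (\sum_l \sum_j e l j)%N.
pose del := mu * (D%:R^-1) ^+ em.
have D0 : 0 < D%:R :> R by rewrite ltr0n; lia.
have del0 : 0 < del by rewrite mulr_gt0// exprn_gt0// invr_gt0.
pose H := (2 * D * d)%:R : R.
(* With cells of side [1/(c (K+1))], this choice makes the variation [B * h] smaller than
   [del / (K+1)]. *)
pose c := (Num.truncn (B * H / del)).+1.
have cP : B * H < c%:R * del.
  by rewrite -ltr_pdivrMr//; exact: truncnS_gt.
exists c => // K g g' x x' q [Sx zx] [Sx' zx'] xq sgn xx' gg'.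
have K0 : 0 < K.+1%:R :> R by rewrite ltr0n.
have c0 : 0 < c%:R :> R by rewrite ltr0n.
have cl := cell_close (muln_gt0 c K.+1 : (0 < c * K.+1)%N) Sx Sx' xq sgn xx'.
rewrite -/H in cl; set h := H / _ in cl.
have h0 : 0 <= h by rewrite divr_ge0 ?ler0n.
apply/ffunP => -[l [j s]]; have [->{l}|] := eqVneq l q.1; last exact: gg'.
set i := q.1 in xq sgn gg' *.
set w := fun l x => a0 x * zcoord x l ^+ e l j.
(* Subtract the two zero equations: outside block [i] the coefficients agree, so only the difference
   in block [i] remains beside terms that are Lipschitz in the point. *)
have E : (coef g i j - coef g' i j) * w i x =
    (a j x - a j x') - \sum_l coef g' l j * (w l x - w l x').
  have -> : \sum_l coef g' l j * (w l x - w l x') =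
      \sum_l coef g' l j * w l x - a j x'.
    by rewrite zx' -sumrB; apply: eq_bigr => l _; rewrite mulrBr.
  rewrite opprB addrA subrK zx -sumrB (bigD1 i)//= big1 ?addr0 ?mulrBl// => l li.
  by rewrite /coef !gg'// subrr.
have wi : del <= normc (w i x).
  rewrite normcM normcX; apply: ler_pM.
  - exact: ltW.
  - by rewrite exprn_ge0// invr_ge0 ltW.
  - exact: (a0_mu K g x (conj Sx zx)).
  have xi : D%:R^-1 <= normc (zcoord x i).
    have xi1 : `|x q.1 q.2| <= 1 by exact: sphere_coord_le1.
    have : D%:R^-1 <= `|x q.1 q.2|.
      rewrite -[leLHS]mul1r ler_pdivrMr// mulrC; apply: le_trans xq _.
      rewrite ler_wpM2l ?(ltW D0)// -(@real_normK _ (x q.1 q.2)) ?num_real//.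
      by rewrite expr2 ler_piMr.
    move=> /le_trans; apply; case: (q.2) => -[|[|//]] k2.
      rewrite (_ : Ordinal k2 = 0); last exact: val_inj.
      exact: (Re_le_normc (zcoord x i)).
    rewrite (_ : Ordinal k2 = 1); last exact: val_inj.
    exact: (Im_le_normc (zcoord x i)).
  apply: le_trans (_ : D%:R^-1 ^+ e i j <= _); last first.
    by rewrite lerXn2r ?nnegrE ?normc_ge0 ?invr_ge0// ltW.
  apply: ler_wiXn2l; rewrite ?invr_ge0 ?(ltW D0)//.
    by rewrite invf_le1// ler1n muln_gt0.
  by rewrite /em (bigD1 i)//= (bigD1 j)//= -addnA leq_addr.
have bnd : normc (coef g i j - coef g' i j) * del <= B * h.
  apply: le_trans (ler_wpM2l (normc_ge0 _) wi) _; rewrite -normcM E.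
  apply: le_trans (normcB_le _ _) _.
  apply: le_trans (_ : (Ba j + \sum_l 2 * Bw (l, j)) * h <= _); last first.
    rewrite ler_wpM2r// /B (bigD1 j)//= lerDl sumr_ge0// => k _.
    rewrite addr_ge0 ?sumr_ge0//; first by have [] := HBa k.
    by move=> l _; rewrite mulr_ge0//; have [] := HBw (l, k).
  rewrite mulrDl; apply: lerD; first by have [_] := HBa j; apply.
  apply: le_trans (normc_sum _ _ _) _; rewrite mulr_suml.
  apply: ler_sum => l _; rewrite normcM -mulrA; apply: ler_pM; rewrite ?normc_ge0 ?coef_le2//.
  by have [_] := HBw (l, j); apply.
apply/eqP/negPn/negP => neq.
(* Distinct grid values would be at least [1/(K+1)] apart, against the bound just obtained. *)
have sep : K.+1%:R^-1 <= normc (coef g i j - coef g' i j).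
  have S1 (u v : 'I_K.+1) : u != v -> K.+1%:R^-1 <= `|u%:R / K.+1%:R - v%:R / K.+1%:R : R|.
    move=> uv; rewrite -mulrBl normrM [X in _ <= _ * X]ger0_norm ?invr_ge0 ?ler0n//.
    rewrite ler_peMl ?invr_ge0 ?ler0n//.
    by case: (ltngtP u v) uv => [uv _|uv _|/val_inj ->]; rewrite ?eqxx//;
      [rewrite distrC|]; rewrite -natrB ?(ltnW uv)// normr_nat ler1n subn_gt0.
  case: s neq => neq.
    by apply: le_trans (S1 _ _ neq) _; exact: (Im_le_normc (coef g i j - coef g' i j)).
  by apply: le_trans (S1 _ _ neq) _; exact: (Re_le_normc (coef g i j - coef g' i j)).
have : B * H < B * H.
  apply: lt_le_trans cP _; have := le_trans (ler_wpM2r (ltW del0) sep) bnd.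
  rewrite /h natrM -(ler_pM2r (mulr_gt0 c0 K0)).
  have -> : K.+1%:R^-1 * del * (c%:R * K.+1%:R) = c%:R * del by field; rewrite gt_eqF.
  by have -> : B * (H / (c%:R * K.+1%:R)) * (c%:R * K.+1%:R) = B * H by field; rewrite !gt_eqF.
by rewrite ltxx.
Qed.

(** If every grid point had a zero, then by [zero_inj] it would be determined by a large coordinate
    of that zero, its sign, the cell, and the other [n] blocks. Counting would give
    [(K+1)^(2M) <= 2D ((2c+1)(K+1))^d]. As [d + 1 <= 2M], this fails for [K = 2D (2c+1)^d]. *)
Lemma generic_avoid : exists eps : 'I_n.+1 -> 'I_M -> C, forall x, S x ->
  exists j, a j x != a0 x * \sum_l eps l j * zcoord x l ^+ e l j.
Proof.
have [c c0 inj] := zero_inj.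
pose K := (2 * D * (2 * c).+1 ^ d)%N.
suff [g Hg] : exists g : grid K, forall x, ~ zero g x.
  exists (coef g) => x Sx; apply/not_existsP => H; apply: (Hg x); split=> // j.
  have /negP/negPn/eqP -> := H j; rewrite mulr_sumr.
  by apply: eq_bigr => l _; rewrite mulrCA.
apply/not_existsP => H.
have /choice[x xP] : forall g : grid K, exists x, zero g x.
  by move=> g; have /existsNP[x /contrapT] := H g; exists x.
have /choice[q qP] : forall g : grid K, exists q : Q, 1 <= D%:R * x g q.1 q.2 ^+ 2.
  by move=> g; apply: big_coord; have [] := xP g.
pose Phi (g : grid K) : Q * bool * {ffun 'I_d -> 'I_(2 * (c * K.+1)).+1} *
    {ffun 'I_n * J -> 'I_K.+1} :=
  (q g, 0 <= x g (q g).1 (q g).2, cell (c * K.+1) (q g) (x g),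
   [ffun lj => g (lift (q g).1 lj.1, lj.2)]).
have Phi_inj : injective Phi.
  move=> g g' [qq sgn cc ff]; apply: (inj K g g' (x g) (x g') (q g)) => //.
  - by rewrite sgn qq.
  - by rewrite cc qq.
  - move=> l j; case: (unliftP (q g).1 l) => [l' ->|->]; last by rewrite eqxx.
    move=> _.
    by have /ffunP/(_ (l', j)) := ff; rewrite !ffunE /= qq.
have := leq_card _ Phi_inj.
rewrite !card_prod !card_ffun !card_prod !card_ord card_bool.
rewrite mulSn expnD leq_pmul2r ?expn_gt0//.
apply/negP; rewrite -ltnNge.
apply: (@leq_ltn_trans (2 * D * ((2 * c).+1 * K.+1) ^ d)).
  rewrite (_ : n.+1 * 2 * 2 = 2 * D)%N; last lia.
  by rewrite leq_mul2l leq_exp2r; [apply/orP; right; nia|lia].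
rewrite expnMn mulnA -/K; apply: (@leq_trans (K.+1 ^ d.+1)).
  by rewrite expnS ltn_mul2r ltnSn expn_gt0.
by rewrite leq_exp2l; lia.
Qed.

End Generic.
End Pigeonhole.

(** * Cancellation of line bundles *)

Section Cancellation.
Variables (R : realType) (n p : nat) (lambda : R[i]) (b : 'I_n.+1 -> nat).
Hypotheses (p_prime : prime p) (lambda_prim : p.-primitive_root lambda).
Hypothesis b_bounds : forall j, (1 <= b j <= p - 1)%N.
Local Notation X := 'M[R]_(n.+1, 2).
Local Notation C := R[i].
Local Notation S := (@sphere_set R n).
Local Notation g := (diag_act lambda b).
Local Notation weighted_mx := (weighted_mx lambda b).
Local Notation weighted_iso := (weighted_iso lambda b).
Import ComplexField.Normc.

Lemma sphere_act_set x : S x -> S (g x).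
Proof.
exact: (sphere_set_act b (prime_gt0 p_prime) (prim_expr_order lambda_prim)).
Qed.

Lemma root_sum N (al : 'I_N -> nat) :
  \prod_i lambda ^+ al i = lambda ^+ (\sum_i al i)%N.
Proof.
by apply: (big_ind2 (fun x y => x = lambda ^+ y)) => // _ u _ v -> ->; rewrite exprD.
Qed.

(** The action multiplies the determinant by a ratio of powers of [lambda], which has modulus
    one. *)
Lemma weighted_det N (al be : 'I_N -> nat) F x : weighted_mx al be F -> S x ->
  \det (F (g x)) * (\det (F (g x)))^* = \det (F x) * (\det (F x))^*.
Proof.
move=> [_ wF] Sx.
have E : \det (F (g x)) * lambda ^+ (\sum_i al i)%N =
    lambda ^+ (\sum_i be i)%N * \det (F x).
  have P (h : 'I_N -> nat) :
      \det (diag_mx (\row_j lambda ^+ h j)) = lambda ^+ (\sum_i h i)%N.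
    by rewrite det_diag -root_sum; apply: eq_bigr => i _; rewrite mxE.
  rewrite -!P -!det_mulmx; congr determinant; apply/matrixP => i j.
  by rewrite mul_mx_diag mul_diag_mx !mxE wF.
have := congr1 (fun z => z * z^*) E; rewrite /= !rmorphM /=.
set u := lambda ^+ _; set v := lambda ^+ _.
have Hu : u^* * u = 1 := root_conj p_prime lambda_prim _.
have Hv : v^* * v = 1 := root_conj p_prime lambda_prim _.
set D := \det _; set D' := \det _ => {}E.
transitivity (D * u * (D^* * u^*)).
  by rewrite -[LHS]mulr1 -Hu; ring.
by rewrite E -[RHS]mulr1 -Hv; ring.
Qed.

Section CancelOne.
Variables (M : nat) (al be : 'I_(1 + M) -> nat) (F : X -> 'M[C]_(1 + M)).
Hypotheses (nM : (n < M)%N) (wF : weighted_mx al be F).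
Hypotheses (uF : forall x, S x -> F x \in unitmx) (albe : al ord0 = be ord0).

Let c := al ord0.
Let al' (j : 'I_M) := al (rshift 1 j).
Let be' (j : 'I_M) := be (rshift 1 j).
Let Delta x := \det (F x) * (\det (F x))^*.
(** The multiple by [Delta x] of the preimage under [F x] of the first basis vector. The adjugate
    keeps it polynomial, and the conjugate determinant makes the factor [Delta] invariant. *)
Let v x : 'cV[C]_(1 + M) := (\det (F x))^* *: col ord0 (\adj (F x)).

Let Delta_neq0 x : S x -> Delta x != 0.
Proof. by move=> /uF; rewrite unitmxE unitfE => d0; rewrite mulf_neq0// conjc_eq0. Qed.

Let vE x : F x *m v x = Delta x *: col_mx 1%:M 0.
Proof.
rewrite -scalemxAr colE mulmxA mul_mx_adj -colE; apply/matrixP => i j.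
rewrite !mxE; case: splitP => k ik; rewrite !mxE.
  have -> : i = ord0 by apply: val_inj; rewrite /= ik; case: k {ik} => -[].
  by rewrite (ord1 k) (ord1 j) eqxx !mulr1n mulr1 mulrC.
have -> : (i == ord0) = false by apply/negbTE/eqP => i0; move: ik; rewrite i0.
by rewrite mulr0n !mulr0.
Qed.

Let v_neq0 x : S x -> v x != 0.
Proof.
move=> Sx; apply/eqP => v0; have := vE x; rewrite v0 mulmx0 => /(congr1 (@usubmx _ 1 M 1)).
rewrite linearZ /= col_mxKu linear0 => /matrixP/(_ ord0 ord0); rewrite !mxE mulr1 => /esym/eqP.
by rewrite (negbTE (Delta_neq0 Sx)).
Qed.

Let F_inj x (w w' : 'cV_(1 + M)) : S x -> F x *m w = F x *m w' -> w = w'.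
Proof. by move=> /uF uFx /(congr1 (mulmx (invmx (F x)))); rewrite !mulKmx. Qed.

(** Equivariance is checked after applying the injective [F (g x)], where [vE] makes both sides
    multiples of the first basis vector; [albe] matches their weights. *)
Let weighted_v : weighted_mx (fun _ : 'I_1 => c) al v.
Proof.
split=> [|x Sx i j].
  have [cF _] := wF; apply: cpoly_scalemx; first exact/cpolyJ/cpoly_det.
  by move=> i j; apply: eq_cpoly (cpoly_adj cF i ord0) _ => x; rewrite [RHS]mxE.
rewrite (ord1 j); pose w : 'cV_(1 + M) := \col_i (lambda ^+ al i * v x i 0).
have E : F (g x) *m (lambda ^+ c *: v (g x)) = F (g x) *m w.
  apply/colP => k; rewrite -scalemxAr vE /Delta (weighted_det wF Sx) -/(Delta x).
  transitivity (lambda ^+ be k * (F x *m v x) k 0).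
    rewrite vE !mxE; case: splitP => l kl; rewrite !mxE ?mulr0//.
    have -> : k = ord0 by apply: val_inj; rewrite /= kl; case: l {kl} => -[].
    by rewrite -albe.
  rewrite !mxE mulr_sumr; apply: eq_bigr => l _.
  by rewrite [w _ _]mxE mulrA -(wF.2 x Sx) -mulrA.
have /colP/(_ i) := F_inj (sphere_act_set Sx) E.
by rewrite mxE [w _ _]mxE mulrC.
Qed.

Let a0 x := v x ord0 0.
Let a x : 'cV[C]_M := dsubmx (v x).

Let vcE x : v x = col_mx (a0 x)%:M (a x).
Proof.
rewrite -[LHS]vsubmxK; congr col_mx; apply/matrixP => i j.
rewrite (ord1 i) (ord1 j) [RHS]mxE eqxx mulr1n [LHS]mxE; congr (v x _ _).
exact: val_inj.
Qed.

Let weighted_a : weighted_mx (fun _ : 'I_1 => c) al' a.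
Proof.
have [cv wv] := weighted_v; split=> [i j|x Sx i j]; last first.
  have := wv x Sx (rshift 1 i) j; rewrite /a.
  by move: (v (g x)) (v x) => V V' E; rewrite !mxE.
apply: eq_cpoly (cv (rshift 1 i) j) _ => x; rewrite /a.
by move: (v x) => V; rewrite mxE.
Qed.

Let weighted_a0 : weighted lambda b 0 a0.
Proof.
have [cv wv] := weighted_v; split=> [|x Sx]; first exact: cv.
have := wv x Sx ord0 0; rewrite -/c expr0 mul1r mulrC.
exact: (mulfI (root_unit p_prime lambda_prim c)).
Qed.

(** The entries of [t] are combinations of powers of the [z_l], with exponents chosen to carry
    weight [c] to weight [al' j]. Since [v] vanishes nowhere, [a0] and [a] have no common zero and
    [generic_avoid] applies. *)
Let t_exists : exists t : X -> 'cV[C]_M,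
  weighted_mx (fun _ : 'I_1 => c) al' t /\
  forall x, S x -> a x - a0 x *: t x != 0.
Proof.
have /choice[e eE] : forall lj : 'I_n.+1 * 'I_M, exists k,
    lambda ^+ (b lj.1 * k + c) = lambda ^+ al' lj.2.
  by move=> lj; exact: weight_exists p_prime lambda_prim b_bounds _ _ _.
have [|||eps Heps] := @generic_avoid R n M a0 (fun j x => a x j 0)
    (fun l j => e (l, j)) nM.
- by have [] := weighted_a0.
- by move=> j; exact: weighted_a.1.
- move=> x Sx; have [a00|] := eqVneq (a0 x) 0; last by left.
  right; apply/not_existsP => H; have /eqP := v_neq0 Sx; apply.
  rewrite vcE a00 (_ : a x = 0).
    by rewrite raddf0 col_mx0.
  by apply/colP => j; have /negP/negPn/eqP E := H j; rewrite [RHS]mxE -[RHS]E.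
exists (fun x => \col_j \sum_l eps l j * zcoord x l ^+ e (l, j)); split.
  split=> [i j|x Sx i j].
    apply: (@eq_cpoly _ _ (fun x => \sum_l eps l i * zcoord x l ^+ e (l, i))).
      apply: cpoly_sum => l; apply: cpolyM; first exact: cpoly_cst.
      exact/cpolyX/cpoly_coord.
    by move=> x; rewrite mxE.
  rewrite !mxE mulr_suml mulr_sumr; apply: eq_bigr => l _.
  rewrite zcoord_act exprMn -exprM -(eE (l, i)) /= exprD; ring.
move=> x Sx; apply/eqP => /colP H; have [j /eqP] := Heps x Sx; apply.
by have := H j; rewrite !mxE => /eqP; rewrite subr_eq0 => /eqP.
Qed.

(* [v = (a0, a)] spans the preimage under [F] of the first summand of the target.
   An automorphism of the source makes first [a' = a - a0 t], then the first
   coordinate [a0 + tau |a'|^2] nowhere zero; [G] is then the block of [F] between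
   the remaining summands. *)
Lemma cancel_one : weighted_iso al' be'.
Proof.
have [t [wt a'_neq0]] := t_exists; set a' := fun x => a x - a0 x *: t x in a'_neq0.
have wa' : weighted_mx (fun _ : 'I_1 => c) al' a'.
  by apply: weighted_addmx weighted_a (weighted_oppmx _); exact: weighted_scale.
pose N2 x := (adjmx (a' x) *m a' x) 0 0.
have cN2 : cpoly N2.
  exact: (cpoly_mulmx (weighted_adj p_prime lambda_prim wa').1 wa'.1 0 0).
have N2E x : complex.Re (N2 x) = \sum_j normc (a' x j 0) ^+ 2.
  rewrite /N2 mxE raddf_sum; apply: eq_bigr => j _.
  by rewrite !mxE mulrC sqr_normc_Re.
have [x Sx|m m0 Hm] := cpoly_pos_min cN2.
  rewrite N2E; have [j a'j] : exists j, a' x j 0 != 0.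
    apply/not_existsP => H; have /eqP := a'_neq0 x Sx; apply; apply/colP => j.
    by have /negP/negPn/eqP -> := H j; rewrite mxE.
  rewrite (bigD1 j)//= ltr_pwDl ?sumr_ge0// => [|i _]; last exact: sqr_ge0.
  by rewrite exprn_gt0// lt_neqAle eq_sym normc_eq0 a'j normc_ge0.
have [B B0 [HB _]] := cpoly_lip weighted_a0.1.
(* As [B] bounds [|a0|] and [m] bounds [|a'|^2] from below, [a0 + tau |a'|^2] cannot vanish. *)
pose tau := (B + 1) / m.
have tauP x : S x -> normc (a0 x) < tau * complex.Re (N2 x).
  move=> Sx; apply: le_lt_trans (HB x Sx) _; apply: lt_le_trans (_ : tau * m <= _).
    by rewrite divfK ?gt_eqF// ltrDl.
  by rewrite ler_wpM2l ?Hm// divr_ge0 ?addr_ge0// ltW.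
pose A x := drsubmx (F x : 'M[C]_(1 + M, 1 + M)).
pose u x := dlsubmx (F x : 'M[C]_(1 + M, 1 + M)).
have wA : weighted_mx al' be' A.
  split=> [i j|x Sx i j]; last by rewrite !mxE wF.2.
  by apply: eq_cpoly (wF.1 (rshift 1 i) (rshift 1 j)) _ => x; rewrite /A !mxE.
have l0 : lshift M (0 : 'I_1) = ord0 by exact: val_inj.
have wu : weighted_mx (fun _ : 'I_1 => c) be' u.
  split=> [i j|x Sx i j]; last by rewrite !mxE (ord1 j) l0 wF.2.
  by apply: eq_cpoly (wF.1 (rshift 1 i) (lshift M j)) _ => x; rewrite /u !mxE.
pose G x := A x - tau%:C *: ((u x + A x *m t x) *m adjmx (a' x)).
exists G.
  apply: weighted_addmx => //; apply: weighted_oppmx; apply: weighted_scale.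
    by split=> [|x _]; [exact: cpoly_cst|rewrite expr0 mul1r].
  apply: (@weighted_mulmx _ _ _ _ _ _ _ al' (fun _ : 'I_1 => c)).
    exact: weighted_addmx wu (weighted_mulmx wA wt).
  exact: (weighted_adj p_prime lambda_prim wa').
move=> x Sx; apply: unitmx_inj => y Gy.
pose s := (adjmx (a' x) *m y) 0 0.
have sE : adjmx (a' x) *m y = s%:M by rewrite [LHS]mx11_scalar.
(* A lift of the kernel vector [y] of [G x] for which the lower block of [F x *m Y] is
   [G x *m y = 0]. Hence [Y] is proportional to [v x]. *)
pose Y : 'cV_(1 + M) := col_mx (- (tau%:C * s))%:M (y - (tau%:C * s) *: t x).
pose r := (F x *m Y) ord0 0.
have FY : F x *m Y = r *: col_mx 1%:M 0.
  rewrite -[LHS](@vsubmxK _ 1 M 1) scale_col_mx; congr col_mx.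
    by rewrite [LHS]mx11_scalar mxE l0 -/r scale_scalar_mx mulr1.
  rewrite scaler0 /Y -[F x]submxK mul_block_col col_mxKd -/(A x) -/(u x).
  rewrite -[RHS]Gy /G mulmxBl -scalemxAl -mulmxA sE !mul_mx_scalar scalerA.
  by rewrite mulmxBr -scalemxAr scaleNr scalerDr opprD addrCA.
have YE : Delta x *: Y = r *: v x.
  by apply: (F_inj Sx); rewrite -scalemxAr FY -[RHS]scalemxAr vE !scalerA mulrC.
move: YE; rewrite /Y vcE !scale_col_mx => /eq_col_mx[].
rewrite !scale_scalar_mx => /matrixP/(_ 0 0); rewrite !mxE !mulr1n => E1.
rewrite scalerBr => /eqP; rewrite subr_eq => /eqP E2.
have E3 : Delta x *: y = r *: a' x.
  by rewrite E2 /a' scalerBr !scalerA -E1 [in RHS]mulrN scaleNr opprK.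
have E4 : Delta x * s = r * N2 x.
  have : adjmx (a' x) *m (Delta x *: y) = adjmx (a' x) *m (r *: a' x) by rewrite E3.
  by rewrite -!scalemxAr sE => /matrixP/(_ 0 0);
    rewrite [LHS]mxE [RHS]mxE [s%:M _ _]mxE mulr1n.
(* Otherwise the two proportionality relations give [a0 = - tau |a'|^2], which the choice of [tau]
   excludes. *)
have r0 : r = 0.
  apply/eqP/negPn/negP => r0.
  have E5 : a0 x = - (tau%:C * N2 x).
    apply: (mulfI r0); rewrite -E1 mulrN mulrN mulrCA E4; ring.
  have : normc (a0 x) < normc (a0 x).
    apply: lt_le_trans (tauP x Sx) _; apply: le_trans (Re_le_normc _).
    rewrite E5 raddfN normrN /=.
    have -> : complex.Re (tau%:C * N2 x) = tau * complex.Re (N2 x).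
      by case: (N2 x) => ? ? /=; rewrite mul0r subr0.
    exact: ler_norm.
  by rewrite ltxx.
move: E3; rewrite r0 scale0r => /eqP; rewrite scaler_eq0 (negbTE (Delta_neq0 Sx)) /=.
by move/eqP.
Qed.

End CancelOne.

Lemma cancel_common M N (al be : 'I_(N + M) -> nat) : (n < M)%N ->
  (forall i : 'I_N, al (lshift M i) = be (lshift M i)) -> weighted_iso al be ->
  weighted_iso (fun i => al (rshift N i)) (fun i => be (rshift N i)).
Proof.
move=> nM; elim: N al be => [|N IH] al be E w.
  have H (f : 'I_(0 + M) -> nat) : (fun i => f (rshift 0 i)) = f.
    by apply/funext => i; congr f; exact: val_inj.
  by rewrite !H.
have [F wF uF] := w.
have nNM : (n < N + M)%N by rewrite ltn_addl.
have H (i : 'I_M) : rshift N.+1 i = rshift 1 (rshift N i) :> 'I_(1 + (N + M)).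
  exact: val_inj.
have E0 : al (ord0 : 'I_(1 + (N + M))) = be (ord0 : 'I_(1 + (N + M))).
  have l0 : lshift M (ord0 : 'I_N.+1) = ord0 :> 'I_(1 + (N + M)) by exact: val_inj.
  by have := E ord0; rewrite l0.
have := IH _ _ _ (cancel_one nNM wF uF E0).
have -> : (fun i => al (rshift N.+1 i)) = (fun i => al (rshift 1 (rshift N i))).
  by apply/funext => i; rewrite -H.
have -> : (fun i => be (rshift N.+1 i)) = (fun i => be (rshift 1 (rshift N i))).
  by apply/funext => i; rewrite -H.
apply=> i; have l1 : lshift M (lift ord0 i) = rshift 1 (lshift M i) :> 'I_(1 + (N + M)).
  exact: val_inj.
by have := E (lift ord0 i); rewrite l1.
Qed.

(** Nullity gives an isomorphism from [ga] to [de] such that [de + al] and [ga + be] have the same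
    weights up to order. Adding [al] yields an isomorphism from [ga + al] to [ga + be], and [ga] is
    cancelled. *)
Lemma weighted_iso_stable M (al be : 'I_M -> nat) : (n < M)%N ->
  null lambda b (wsum be - wsum al) -> weighted_iso al be.
Proof.
move=> nM [N [ga [de [w E]]]].
have [s sE] : exists s : 'S_(N + M), forall i, catf de al (s i) = catf ga be i.
  apply: wsum_perm; rewrite !wsum_catf; apply/eqP.
  by rewrite -subr_eq0 opprD addrACA -E addrA subrK subrr.
have w' := weighted_iso_perm s (weighted_iso_cat w (weighted_iso_refl lambda b al)).
have [||F wF uF] := @cancel_common M N (catf ga al) (catf ga be) nM.
- by move=> i; rewrite !catf_lshift.
- have -> : catf ga be = (fun i => catf de al (s i)) by apply/funext => i; rewrite sE.
  exact: w'.
exists F => //; apply: weighted_eq wF => i; by rewrite catf_rshift.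
Qed.

End Cancellation.

Lemma exists_trivial_weights (R : realType) (n p : nat) (lambda : R[i]) :
  prime p -> (p = 1 %[mod n.+1])%N -> p.-primitive_root lambda ->
  exists b : 'I_n.+1 -> nat, (forall j, (1 <= b j <= p - 1)%N) /\
    weighted_iso lambda b (fun _ : 'I_n.+1 => 0%N) b.
Proof.
move=> p_pr p1 lP; have [t [tn tk]] := exists_root_unity_mod p_pr p1.
pose b (j : 'I_n.+1) := (t ^ j %% p)%N.
have b_bounds j : (1 <= b j <= p - 1)%N.
  have p0 := prime_gt0 p_pr; apply/andP; split; last first.
    by have := ltn_pmod (t ^ j) p0; rewrite -/(b j); lia.
  rewrite lt0n -/(dvdn p _); apply/negP => pt.
  (* If [p] divided a power of [t] it would divide [t], against [t ^ n.+1 = 1] modulo [p]. *)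
  have pt1 : (p %| t)%N by case: (val j) pt => [|k]; rewrite ?Euclid_dvdX//= => /andP[].
  have : (p %| t ^ n.+1)%N by rewrite dvdn_exp.
  by rewrite /dvdn tn modn_small ?prime_gt1.
exists b; split=> //.
apply: (weighted_iso_stable p_pr lP b_bounds (ltnSn n)).
have [u [v uv]] := sum_roots_in_augmentation_power p_pr tn tk.
have -> : wsum b - wsum (fun _ : 'I_n.+1 => 0%N) = ('X - 1) ^+ n.+1 * u + ('X^p - 1) * v.
  by rewrite -uv /wsum sumr_const card_ord.
apply: nullD; apply: (nullM p_pr lP); last exact: (null_order b lP).
exact: (null_augmentation p_pr lP b_bounds).
Qed.

(** * Orthonormalization *)

Lemma Ck_on_sqrt (R : realType) (V : normedModType R) k (A : set V) (f : V -> R) :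
  open A -> (forall x, A x -> 0 < f x) -> Ck_on k A f ->
  Ck_on k A (fun x => Num.sqrt (f x)).
Proof.
move=> oA f0; elim: k => [|k IH] Hf.
  move=> x Ax /=; apply: (@continuous_comp _ _ _ f Num.sqrt); first exact: Hf.
  exact: sqrt_continuous.
have [df Df] := (Ck_onS _ _ _).1 Hf.
have ds x : A x -> differentiable (Num.sqrt : R -> R) (f x).
  by move=> Ax; apply/derivable1_diffP; have [] := is_derive1_sqrt (f0 x Ax).
apply/Ck_onS; split=> [x Ax|v].
  by apply: (@differentiable_comp _ _ _ _ f Num.sqrt); [exact: df|exact: ds].
apply: (@Ck_on_ext _ _ _ _ _ (fun x => (2 * Num.sqrt (f x))^-1 * 'D_v f x)) => //.
  move=> x Ax; have dfx := df x Ax; have dsx := ds x Ax.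
  have dc := differentiable_comp dfx dsx.
  rewrite [RHS](deriveE _ dc) (diff_comp dfx dsx) /= -(deriveE _ dfx).
  rewrite (diff1E dsx) derive1E mulrC.
  by rewrite derive_sqrt ?f0.
apply: Ck_onM => //; apply: Ck_onV => //.
  by move=> x Ax; rewrite mulf_neq0// gt_eqF ?sqrtr_gt0 ?f0.
apply: Ck_onM => //; first by move=> x _; exact: Ck_cst.
exact: IH (Ck_onW Hf).
Qed.

Section Cholesky.
Variables (R : realType) (T : Type) (sm : (T -> R) -> Prop).
Hypothesis sm_cst : forall c, sm (fun=> c).
Hypothesis smD : forall f g, sm f -> sm g -> sm (fun x => f x + g x).
Hypothesis smM : forall f g, sm f -> sm g -> sm (fun x => f x * g x).
Hypothesis smV : forall f, (forall x, f x != 0) -> sm f -> sm (fun x => (f x)^-1).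
Hypothesis sm_sqrt : forall f, (forall x, 0 < f x) -> sm f -> sm (fun x => Num.sqrt (f x)).

Let smE f g : sm f -> f =1 g -> sm g.
Proof. by move=> sf /funext <-. Qed.

Let sm_mx M N (F : T -> 'M[R]_(M, N)) := forall i j, sm (fun x => F x i j).

Let sm_mulmx L M N (F : T -> 'M[R]_(L, M)) (G : T -> 'M[R]_(M, N)) :
  sm_mx F -> sm_mx G -> sm_mx (fun x => F x *m G x).
Proof.
move=> sF sG i j.
suff H (r : seq 'I_M) : sm (fun x => \sum_(k <- r) F x i k * G x k j).
  by apply: smE (H _) _ => x; rewrite mxE.
elim: r => [|k r IH]; first by apply: smE (sm_cst 0) _ => x; rewrite big_nil.
by apply: smE (smD (smM (sF i k) (sG k j)) IH) _ => x; rewrite big_cons.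
Qed.

Let sm_scale M N f (F : T -> 'M[R]_(M, N)) :
  sm f -> sm_mx F -> sm_mx (fun x => f x *: F x).
Proof. by move=> sf sF i j; apply: smE (smM sf (sF i j)) _ => x; rewrite mxE. Qed.

Let sm_opp M N (F : T -> 'M[R]_(M, N)) : sm_mx F -> sm_mx (fun x => - F x).
Proof.
move=> sF i j; apply: smE (smM (sm_cst (-1)) (sF i j)) _ => x.
by rewrite mxE mulN1r.
Qed.

Let sm_add M N (F G : T -> 'M[R]_(M, N)) :
  sm_mx F -> sm_mx G -> sm_mx (fun x => F x + G x).
Proof. by move=> sF sG i j; apply: smE (smD (sF i j) (sG i j)) _ => x; rewrite mxE. Qed.

(** Gram-Schmidt by induction on the size: the first diagonal entry [a] is a positive pivot and the
    Schur complement [D'] is again symmetric and positive definite. Only sums, products, inverses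
    and square roots of positive functions occur, hence the closure properties asked of [sm]. *)
Lemma cholesky N (G : T -> 'M[R]_N) : (forall i j, sm (fun x => G x i j)) ->
  (forall x, (G x)^T = G x) ->
  (forall x (v : 'rV_N), v != 0 -> 0 < (v *m G x *m v^T) 0 0) ->
  exists2 A : T -> 'M[R]_N, (forall i j, sm (fun x => A x i j)) &
    forall x, A x *m G x *m (A x)^T = 1%:M.
Proof.
elim: N G => [|N IH] G sG symG posG.
  exists (fun=> 1%:M) => [|x]; first by case.
  by apply/matrixP => -[].
pose a x := G x ord0 ord0; pose r x : 'rV[R]_N := @ursubmx _ 1 N 1 N (G x).
pose D x : 'M[R]_N := @drsubmx _ 1 N 1 N (G x).
have GE x : G x = block_mx (a x)%:M (r x) (r x)^T (D x).
  have ul : @ulsubmx _ 1 N 1 N (G x) = (a x)%:M.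
    by rewrite [LHS]mx11_scalar !mxE; congr ((G x _ _)%:M); exact: val_inj.
  have dl : @dlsubmx _ 1 N 1 N (G x) = (r x)^T by rewrite /r trmx_ursub symG.
  by rewrite -[LHS](@submxK _ 1 N 1 N) ul dl.
have posB x (v : 'rV[R]_(1 + N)) : v != 0 ->
    0 < (v *m block_mx (a x)%:M (r x) (r x)^T (D x) *m v^T) 0 0.
  by move=> /(posG x); rewrite GE.
have a0 x : 0 < a x.
  have /(posB x) : (row_mx 1%:M 0 : 'rV[R]_(1 + N)) != 0.
    apply/eqP => /(congr1 (@lsubmx _ _ 1 N)); rewrite row_mxKl linear0.
    by move=> /matrixP/(_ 0 0) /eqP; rewrite !mxE oner_eq0.
  rewrite mul_row_block !mul0mx !addr0 mul1mx tr_row_mx mul_row_col trmx1 trmx0.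
  by rewrite mulmx0 addr0 mulmx1 mxE eqxx mulr1n.
have aN0 x : a x != 0 by rewrite gt_eqF.
have sr : sm_mx r by move=> i j; apply: smE (sG _ _) _ => x; rewrite !mxE.
have srT : sm_mx (fun x => (r x)^T).
  by move=> i j; apply: smE (sr j i) _ => x; rewrite [RHS]mxE.
have sD : sm_mx D by move=> i j; apply: smE (sG _ _) _ => x; rewrite !mxE.
pose D' x := D x - (a x)^-1 *: ((r x)^T *m r x).
have symD x : (D x)^T = D x by rewrite /D trmx_drsub symG.
have [A' sA' A'E] : exists2 A : T -> 'M[R]_N, (forall i j, sm (fun x => A x i j)) &
    forall x, A x *m D' x *m (A x)^T = 1%:M.
  apply: IH => [|x|x v v0].
  - apply: sm_add => //; apply: sm_opp; apply: sm_scale; last exact: sm_mulmx.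
    by apply: smV => //; exact: sG.
  - by rewrite raddfB /= linearZ /= trmx_mul trmxK symD.
  (* The first entry is chosen to minimize the quadratic form of [G x] over extensions of [v]; the
     value at [w] is that of the Schur complement at [v]. *)
  pose w : 'rV[R]_(1 + N) := row_mx (- (a x)^-1 *: (v *m (r x)^T)) v.
  have /(posB x) : w != 0.
    by apply/eqP => /(congr1 (@rsubmx _ _ 1 N)); rewrite row_mxKr linear0; exact/eqP.
  rewrite (_ : w *m _ *m w^T = v *m D' x *m v^T)//.
  rewrite mul_row_block tr_row_mx mul_row_col.
  rewrite mul_mx_scalar scalerA mulrN divff// scaleN1r addNr mul0mx add0r.
  by rewrite /D' mulmxBr -!scalemxAl -scalemxAr mulmxA scaleNr addrC.
pose s x := (Num.sqrt (a x))^-1.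
have s0 x : Num.sqrt (a x) != 0 by rewrite gt_eqF ?sqrtr_gt0.
have ss : sm s by apply: smV => //; apply: sm_sqrt => //; exact: sG.
(* This block solves [a B + A' r^T = 0], which clears the off-diagonal part. *)
pose B x := - (a x)^-1 *: (A' x *m (r x)^T).
have sB : sm_mx B.
  apply: sm_scale; last exact: sm_mulmx.
  by apply: smE (smM (sm_cst (-1)) (smV aN0 (sG _ _))) _ => x; rewrite mulN1r.
have sA (i j : 'I_(1 + N)) : sm (fun x => block_mx (s x)%:M 0 (B x) (A' x) i j).
  case: (split_ordP i) => k ->; case: (split_ordP j) => l ->.
  - by apply: smE ss _ => x; rewrite block_mxEul (ord1 k) (ord1 l) mxE eqxx mulr1n.
  - by apply: smE (sm_cst 0) _ => x; rewrite block_mxEur mxE.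
  - by apply: smE (sB k l) _ => x; rewrite block_mxEdl.
  - by apply: smE (sA' k l) _ => x; rewrite block_mxEdr.
exists (fun x => block_mx (s x)%:M 0 (B x) (A' x) : 'M[R]_(1 + N)) => [|x]; first exact: sA.
rewrite GE; set B4 := block_mx (a x)%:M _ _ _; set A4 := block_mx (s x)%:M _ _ _.
suff: A4 *m B4 *m A4^T = 1%:M by [].
rewrite /A4 /B4 mulmx_block tr_block_mx mulmx_block trmx0 !mul0mx !addr0 !mulmx0 !addr0.
rewrite tr_scalar_mx -!scalar_mxM !mul_scalar_mx !mul_mx_scalar.
have -> : a x *: B x + A' x *m (r x)^T = 0.
  by rewrite /B scalerA mulrN divff// scaleN1r addNr.
rewrite scaler0 mul0mx !add0r scalar_mx_block.
congr block_mx.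
- congr (_%:M); rewrite /s -{2}[a x]sqr_sqrtr ?ltW//; field; exact: s0.
- rewrite /B linearZ /= trmx_mul trmxK scalerA -scalemxAl.
  by rewrite mulrN mulfK// scaleNr addNr.
- rewrite -[RHS](A'E x); congr (_ *m _).
  by rewrite /B /D' mulmxBr -scalemxAl -scalemxAr mulmxA scaleNr addrC.
Qed.

End Cholesky.

(** * The tangent bundle of the lens space *)

(** The difference quotients on the two sides coincide. *)
Lemma derive_comp_linear (R : realType) (V W : normedModType R) (f : V -> W)
    (g : V -> V) (a v : V) :
  (forall h : R, g (h *: v + a) = h *: g v + g a) ->
  'D_v (f \o g) a = 'D_(g v) f (g a).
Proof.
move=> gE; rewrite /derive.
set u := fun h : R => _; set u' := fun h : R => _; suff -> : u = u' by [].
by apply/funext => h; rewrite /u /u' /= gE.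
Qed.

Section LensTangent.
Variables (R : realType) (n p : nat) (lambda : R[i]) (b : 'I_n.+1 -> nat).
Hypotheses (lambda_prim : p.-primitive_root lambda) (p_prime : prime p).
Hypothesis b_bounds : forall j, (1 <= b j <= p - 1)%N.
Local Notation X := 'M[R]_(n.+1, 2).
Local Notation S := (@sphere_set R n).
Local Notation sph := (sphere R n).
Local Notation d := (2 * n + 1)%N.
Local Notation L := (lens_space lambda_prim p_prime b_bounds).
Local Notation pi := (@lens_pi R n p lambda lambda_prim b).
Local Notation act := (sphere_act lambda_prim b).
Local Notation rot k := (diag_act (lambda ^+ k) b).
Local Notation lchart := (chart R L d).

Definition dot (x y : X) : R := \sum_j \sum_k x j k * y j k.

Lemma dotC x y : dot x y = dot y x.
Proof. by apply: eq_bigr => j _; apply: eq_bigr => k _; rewrite mulrC. Qed.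

Lemma dotDl x y z : dot (x + y) z = dot x z + dot y z.
Proof.
rewrite -big_split; apply: eq_bigr => j _; rewrite -big_split; apply: eq_bigr => k _.
by rewrite mxE mulrDl.
Qed.

Lemma dotZl a x y : dot (a *: x) y = a * dot x y.
Proof.
rewrite mulr_sumr; apply: eq_bigr => j _; rewrite mulr_sumr; apply: eq_bigr => k _.
by rewrite mxE mulrA.
Qed.

Lemma dot_suml N (v : 'I_N -> R) (e : 'I_N -> X) y :
  dot (\sum_k v k *: e k) y = \sum_k v k * dot (e k) y.
Proof.
have dot0 : dot 0 y = 0 by rewrite -(scale0r 0) dotZl mul0r.
rewrite (big_morph (fun x => dot x y) (fun x z => dotDl x z y) dot0).
by apply: eq_bigr => k _; exact: dotZl.
Qed.

Lemma dot_sphere x : S x <-> dot x x = 1.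
Proof.
suff -> : dot x x = \sum_j \sum_k x j k ^+ 2 by [].
by apply: eq_bigr => j _; apply: eq_bigr => k _; rewrite expr2.
Qed.

Lemma dot_gt0 x : x != 0 -> 0 < dot x x.
Proof.
move=> x0; have [[j k] /= xjk] : exists jk : 'I_n.+1 * 'I_2, x jk.1 jk.2 != 0.
  apply/not_existsP => H; move/eqP: x0; apply; apply/matrixP => j k.
  by have /negP/negPn/eqP := H (j, k); rewrite /= mxE.
rewrite /dot (bigD1 j)//= (bigD1 k)//= -addrA ltr_pwDl// -?expr2 ?exprn_even_gt0//.
by rewrite addr_ge0 ?sumr_ge0// => i _; rewrite -?expr2 ?sqr_ge0// sumr_ge0// => l _;
  rewrite -expr2 sqr_ge0.
Qed.

Lemma dot_rot k x y : dot (rot k x) (rot k y) = dot x y.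
Proof.
have E (z w : X) : dot z w = \sum_j complex.Re (zcoord z j * (zcoord w j)^*).
  apply: eq_bigr => j _; rewrite big_ord_recl big_ord1 /= mulrN opprK.
  by congr (_ + z _ _ * w _ _); exact: val_inj.
rewrite !E; apply: eq_bigr => j _; rewrite !zcoord_act rmorphM mulrACA.
by rewrite -exprM [X in X * _]mulrC (root_conj p_prime lambda_prim) mul1r.
Qed.

Lemma rot_scale k a x : rot k (a *: x) = a *: rot k x.
Proof.
apply/matrixP => i j; rewrite !mxE /zcoord !mxE; case: (lambda ^+ k ^+ b i) => u v /=.
by case: (j == 0); ring.
Qed.

Lemma rotD k x y : rot k (x + y) = rot k x + rot k y.
Proof.
apply/matrixP => i j; rewrite !mxE /zcoord !mxE; case: (lambda ^+ k ^+ b i) => u v /=.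
by case: (j == 0); ring.
Qed.

Lemma rot_inv k : exists l, forall x, rot l (rot k x) = x.
Proof.
exists (p * k - k)%N => x; rewrite diag_actM -exprD subnK; last first.
  by rewrite leq_pmull// prime_gt0.
by rewrite exprM (prim_expr_order lambda_prim) expr1n diag_act1.
Qed.

Lemma rot_neq0 k x : x != 0 -> rot k x != 0.
Proof.
apply: contra => /eqP x0; have [l lK] := rot_inv k.
by have := lK x; rewrite x0 -(scale0r (0 : X)) rot_scale !scale0r => <-.
Qed.

Definition len x : R := Num.sqrt (dot x x).

(** Radial retraction to the sphere; the arbitrary unit vector at [0] keeps all values on the
    sphere. *)
Definition normalize (x : X) : X := if x == 0 then delta_mx 0 0 else (len x)^-1 *: x.

Lemma len_gt0 x : x != 0 -> 0 < len x.
Proof. by move=> x0; rewrite sqrtr_gt0 dot_gt0. Qed.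

Lemma normalize_sphere x : S (normalize x).
Proof.
apply/dot_sphere; rewrite /normalize; case: eqVneq => [_|x0].
  rewrite /dot (bigD1 0)//= (bigD1 0)//= mxE !eqxx mulr1 !big1 ?addr0// => j /negbTE j0.
    by rewrite big1// => k _; rewrite mxE j0 mul0r.
  by rewrite mxE j0 andbF mul0r.
have l0 : len x != 0 by rewrite gt_eqF// len_gt0.
rewrite dotZl dotC dotZl -[dot x x]sqr_sqrtr ?ltW ?dot_gt0// -/(len x).
by field.
Qed.

Definition nrm (x : X) : sph := Sphere (normalize_sphere x).

Lemma sphere_neq0 (x : sph) : sphere_val x != 0.
Proof.
apply/eqP => x0; have /dot_sphere := sphere_valP x.
by rewrite x0 -(scale0r 0) dotZl mul0r => /esym/eqP; rewrite oner_eq0.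
Qed.

Lemma nrm_sphere (x : sph) : nrm (sphere_val x) = x.
Proof.
apply: sphere_val_inj; rewrite SphereK /normalize (negbTE (sphere_neq0 x)).
by rewrite /len ((dot_sphere _).1 (sphere_valP x)) sqrtr1 invr1 scale1r.
Qed.

Lemma nrm_rot k x : x != 0 -> nrm (rot k x) = act k (nrm x).
Proof.
move=> x0; apply: sphere_val_inj; rewrite sphere_actE !SphereK /normalize.
by rewrite (negbTE x0) (negbTE (rot_neq0 k x0)) /len dot_rot rot_scale.
Qed.

Lemma pi_nrm_rot k x : x != 0 -> pi (nrm (rot k x)) = pi (nrm x).
Proof. by move=> x0; apply/esym/lens_piP; exists k; exact: nrm_rot. Qed.

Lemma neq0_open : open [set x : X | x != 0].
Proof.
have -> : [set x : X | x != 0] = (fun x : X => `|x|) @^-1` [set t : R | t != 0].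
  by apply/seteqP; split=> x; rewrite /= normr_eq0.
by apply: open_comp => [x _|]; [exact: norm_continuous|exact: open_neq].
Qed.

Lemma Ck_coord M N k (A : set 'M[R]_(M, N)) i j :
  open A -> Ck_on k A (fun x : 'M[R]_(M, N) => x i j : R).
Proof. by move=> oA; apply: Ck_on_coord => //; exact: Ck_on_id. Qed.

Lemma dot_smooth (V : normedModType R) k (A : set V) (f g : V -> X) : open A ->
  Ck_on k A f -> Ck_on k A g -> Ck_on k A (fun x => dot (f x) (g x)).
Proof.
move=> oA cf cg; apply: Ck_on_sum => // i; apply: Ck_on_sum => // j.
by apply: Ck_onM => //; exact: Ck_on_coord.
Qed.

Lemma len_smooth k : Ck_on k [set x : X | x != 0] len.
Proof.
apply: Ck_on_sqrt; [exact: neq0_open|by move=> x; exact: dot_gt0|].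
by apply: dot_smooth; [exact: neq0_open|apply: Ck_on_id..]; exact: neq0_open.
Qed.

Lemma normalize_smooth : smooth_on [set x : X | x != 0] normalize.
Proof.
move=> k; apply: Ck_on_mx => [|i j]; first exact: neq0_open.
apply: (@Ck_on_ext _ _ _ _ _ (fun x : X => (len x)^-1 * x i j)).
- exact: neq0_open.
- by move=> x /negbTE x0; rewrite /normalize x0 mxE.
apply: Ck_onM; [exact: neq0_open| |exact/Ck_coord/neq0_open].
apply: Ck_onV; [exact: neq0_open| |exact: len_smooth].
by move=> x x0; rewrite gt_eqF// len_gt0.
Qed.

Lemma nrm_continuous x : x != 0 -> {for x, continuous nrm}.
Proof.
move=> x0; apply: sphere_continuous_at.
exact: (normalize_smooth 0%N x0).
Qed.

Lemma open_nrm (V : set sph) : open V -> open [set x : X | x != 0 /\ V (nrm x)].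
Proof.
move=> oV; rewrite openE => x [x0 Vx]; apply: filterI.
  exact: (open_nbhs_nbhs (conj neq0_open x0)).
exact: (nrm_continuous x0 (open_nbhs_nbhs (conj oV Vx))).
Qed.

(** A chart of the lens space extended along rays to an open set of the ambient space, so that
    tangent vectors become ambient directional derivatives. *)
Definition chart_nrm (c : lchart) (x : X) : 'rV[R]_d := cmap c (pi (nrm x)).

Definition chart_nrm_dom (c : lchart) : set X := [set x | x != 0 /\ cdom c (pi (nrm x))].

Lemma chart_nrm_dom_open c : open (chart_nrm_dom c).
Proof.
apply: (@open_nrm (pi @^-1` cdom c)); apply: open_comp (cdom_open c) => x _.
exact: lens_pi_continuous.
Qed.

(** Locally a chart of the lens space is a chart of the sphere after a fixed rotation: the [k] found
    at [x] works on a whole neighbourhood. *)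
Lemma lens_atlas_local c x : atlas c -> chart_nrm_dom c x ->
  exists s k (A : set X), [/\ sphere_atlas s, open A, A x,
    cimg c = cimg s & forall y, A y ->
    [/\ y != 0, cdom s (act k (nrm y)), chart_nrm_dom c y &
        chart_nrm c y = cmap s (act k (nrm y))]].
Proof.
move=> [s As [cd ci cm cI]] [x0]; rewrite cd => -[z sz /esym/lens_piP[k zE]].
exists s, k, [set y : X | y != 0 /\ (act k @^-1` cdom s) (nrm y)]; split=> //.
- by apply: open_nrm; apply: open_act; exact: cdom_open.
- by split; rewrite //= -zE.
move=> y [y0 sy]; have E : pi (nrm y) = pi (act k (nrm y)) by apply/lens_piP; exists k.
split=> //; last by rewrite /chart_nrm E cm.
by split=> //; rewrite cd E; exists (act k (nrm y)).
Qed.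

Lemma chart_nrm_smooth c : atlas c -> smooth_on (chart_nrm_dom c) (chart_nrm c).
Proof.
move=> Ac m x cx; have [s [k [A [As oA Ax ci HA]]]] := lens_atlas_local Ac cx.
suff : smooth_on A (chart_nrm c) by exact.
have [_ [P [F [oP sF cF]]]] := As.
move=> {}m; apply: (@Ck_on_ext R _ _ m A (F \o (rot k \o normalize))) => //.
  move=> y /HA[y0 sy _ ->]; have [_ <-] := cF _ sy.
  by rewrite sphere_actE.
apply: (smooth_on_comp (B := P)) => //.
  by move=> y /HA[y0 sy _ _]; have [+ _] := cF _ sy.
apply: (smooth_on_comp (B := setT)) => //; first exact: openT.
  by move=> l y /HA[y0 _ _ _]; exact: normalize_smooth.
exact: diag_act_smooth.
Qed.

Lemma chart_nrm_diff c x : atlas c -> chart_nrm_dom c x -> differentiable (chart_nrm c) x.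
Proof. by move=> Ac cx; have [] := chart_nrm_smooth Ac 1%N cx. Qed.

(** The image of the ambient vector [e] at [x] under the differential of [pi \o nrm], read in every
    chart; the value [0] elsewhere is the one that [is_tangent] prescribes. *)
Definition push (x : sph) (e : X) (c : lchart) : 'rV[R]_d :=
  if `[< atlas c /\ cdom c (pi x) >] then 'D_e (chart_nrm c) (sphere_val x) else 0.

Lemma pushE x e (c : lchart) : atlas c -> cdom c (pi x) ->
  push x e c = 'D_e (chart_nrm c) (sphere_val x).
Proof. by move=> Ac cx; rewrite /push asboolT. Qed.

Lemma chart_nrm_dom_sphere (c : lchart) (x : sph) :
  cdom c (pi x) -> chart_nrm_dom c (sphere_val x).
Proof. by move=> cx; split; [exact: sphere_neq0|rewrite /= nrm_sphere]. Qed.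

Lemma push_tangent x q e : pi x = q -> @is_tangent R d L q (push x e).
Proof.
move=> <-; split=> [c nc|c c' Ac Ac' cx c'x]; first by rewrite /push asboolF.
rewrite !pushE//; have hx := chart_nrm_dom_sphere cx; have hx' := chart_nrm_dom_sphere c'x.
have hE : chart_nrm c (sphere_val x) = cmap c (pi x) by rewrite /chart_nrm nrm_sphere.
have dh := chart_nrm_diff Ac hx.
have dt : differentiable (transition c c') (chart_nrm c (sphere_val x)).
  rewrite hE; have ov : overlap c c' (cmap c (pi x)).
    by split; [exact: cmap_img|rewrite /= cmapK].
  by have [] := atlas_smooth Ac Ac' 1%N ov.
have E : \forall y \near sphere_val x, chart_nrm c' y = (transition c c' \o chart_nrm c) y.
  apply: filterS (open_nbhs_nbhs (conj (@chart_nrm_dom_open c) hx)) => y [y0 cy].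
  by rewrite /= /transition /= /chart_nrm cmapK.
rewrite (near_eq_derive _ E) (deriveE _ (differentiable_comp dh dt)).
by rewrite (diff_comp dh dt) /= -(deriveE _ dh) hE.
Qed.

Lemma push_linear x a e e' : push x (a *: e + e') = a *: push x e + push x e'.
Proof.
apply/funext => c; rewrite !fctE /push; case: asboolP => [[Ac cx]|_].
  have dh := chart_nrm_diff Ac (chart_nrm_dom_sphere cx).
  by rewrite !(deriveE _ dh) linearP.
by rewrite scaler0 addr0.
Qed.

(** Since [chart_nrm c] is invariant under rotations, equivariant ambient fields descend to the lens
    space. *)
Lemma push_rot k x e : push (act k x) (rot k e) = push x e.
Proof.
apply/funext => c; rewrite /push.
have <- : pi x = pi (act k x) by apply/lens_piP; exists k.
case: asboolP => [[Ac cx]|//].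
have E : \forall y \near sphere_val x, chart_nrm c y = (chart_nrm c \o rot k) y.
  apply: filterS (open_nbhs_nbhs (conj neq0_open (sphere_neq0 x))) => y y0.
  by rewrite /= /chart_nrm pi_nrm_rot.
rewrite (near_eq_derive _ E) derive_comp_linear// => h.
by rewrite rotD rot_scale.
Qed.

(* [normalize] is recovered from [chart_nrm c], so that its derivative vanishes
   along [e]; then [e] is proportional to [x] since [y = len y *: normalize y]. *)
Lemma push_kernel x e (c : lchart) : atlas c -> cdom c (pi x) -> push x e c = 0 ->
  exists mu, e = mu *: sphere_val x.
Proof.
move=> Ac cx; rewrite pushE// => De0; have hx := chart_nrm_dom_sphere cx.
have [s [k [A [As oA Ax ci HA]]]] := lens_atlas_local Ac hx.
have [ss _] := As; have [l lK] := rot_inv k.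
have dh := chart_nrm_diff Ac hx.
pose psi := rot l \o (sphere_val \o cinv s).
have hs : cimg s (chart_nrm c (sphere_val x)).
  by have [_ sx _ ->] := HA _ Ax; exact: cmap_img.
have dpsi : differentiable psi (chart_nrm c (sphere_val x)).
  have [//] : Ck_at 1 psi (chart_nrm c (sphere_val x)).
  apply: (smooth_on_comp (A := cimg s) (B := setT)) => //.
  - exact: cimg_open.
  - exact: openT.
  - exact: diag_act_smooth.
have E : \forall y \near sphere_val x, normalize y = (psi \o chart_nrm c) y.
  apply: filterS (open_nbhs_nbhs (conj oA Ax)) => y /HA[y0 sy _ /= ->].
  by rewrite /psi /= cmapK// sphere_actE lK.
have Dn : 'D_e normalize (sphere_val x) = 0.
  rewrite (near_eq_derive _ E) (deriveE _ (differentiable_comp dh dpsi)).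
  by rewrite (diff_comp dh dpsi) /= -(deriveE _ dh) De0 linear0.
have x0 := sphere_neq0 x.
have dn : differentiable normalize (sphere_val x) by have [] := normalize_smooth 1%N x0.
have dl : differentiable len (sphere_val x) by have [] := len_smooth 1%N x0.
exists ('D_e len (sphere_val x)); apply/matrixP => i j.
have El : \forall y \near sphere_val x,
    (fun y : X => y i j : R) y = (fun y : X => len y * normalize y i j : R) y.
  apply: filterS (open_nbhs_nbhs (conj neq0_open x0)) => y y0.
  rewrite /normalize (negbTE y0) mxE mulrA divff ?mul1r//.
  by rewrite gt_eqF// len_gt0.
have D1 : 'D_e (fun y : X => y i j : R) (sphere_val x) = e i j.
  have /matrixP/(_ i j) := @derive_id R X (sphere_val x) e.
  rewrite derive_mx ?mxE//; exact: derivable_id.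
have dnij : derivable (fun y : X => normalize y i j : R) (sphere_val x) e.
  apply: diff_derivable.
  by apply: (@differentiable_comp _ _ _ _ normalize (fun N : X => N i j : R));
    [exact: dn|exact: differentiable_coord].
rewrite -D1 (near_eq_derive _ El) deriveM//; last exact: diff_derivable.
have -> : 'D_e (fun y : X => normalize y i j : R) (sphere_val x) = 0.
  by have /matrixP/(_ i j) := Dn; rewrite derive_mx ?mxE//; exact: diff_derivable.
rewrite scaler0 add0r mxE.
have -> : normalize (sphere_val x) = sphere_val x.
  by have /(congr1 sphere_val) := nrm_sphere x.
by rewrite mulrC.
Qed.

End LensTangent.

(** * Parseval frames *)

Section SmoothFunctions.
Variables (R : realType) (d : nat) (M : manifold R d).

Definition smooth_fun (f : M -> R) := forall c, atlas c ->
  smooth_on (cimg c) (fun y => f (cinv c y) : R).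

Lemma smooth_fun_cst a : smooth_fun (fun=> a).
Proof. by move=> c _ k x _; exact: Ck_cst. Qed.

Lemma smooth_funD f g : smooth_fun f -> smooth_fun g -> smooth_fun (fun x => f x + g x).
Proof.
by move=> sf sg c Ac k; apply: (Ck_onD (cimg_open c)); [exact: sf|exact: sg].
Qed.

Lemma smooth_funM f g : smooth_fun f -> smooth_fun g -> smooth_fun (fun x => f x * g x).
Proof.
by move=> sf sg c Ac k; apply: (Ck_onM (cimg_open c)); [exact: sf|exact: sg].
Qed.

Lemma smooth_funV f : (forall x, f x != 0) -> smooth_fun f -> smooth_fun (fun x => (f x)^-1).
Proof.
by move=> f0 sf c Ac k; apply: (Ck_onV (cimg_open c)) => //; exact: sf.
Qed.

Lemma smooth_fun_sqrt f : (forall x, 0 < f x) -> smooth_fun f ->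
  smooth_fun (fun x => Num.sqrt (f x)).
Proof.
by move=> f0 sf c Ac k; apply: (Ck_on_sqrt (cimg_open c)) => //; exact: sf.
Qed.

Lemma tcoord_sum (x : M) N (v : 'I_N -> R) (u : 'I_N -> tangent x) c :
  tcoord (\sum_k v k *: u k) c = \sum_k v k *: tcoord (u k) c.
Proof.
by rewrite (big_morph (fun w : tangent x => tcoord w c) (id1 := 0) (op1 := +%R)).
Qed.

Variable g : riemannian_metric M.

Lemma metric_suml (x : M) N (v : 'I_N -> R) (u : 'I_N -> tangent x) w :
  g x (\sum_k v k *: u k) w = \sum_k v k * g x (u k) w.
Proof.
have g0 : g x 0 w = 0.
  have := metric_linear g w 0 0 (0 : tangent x); rewrite scale0r addr0 mul0r add0r.
  by have := metric_linear g w 1 0 (0 : tangent x); rewrite scale1r addr0 mul1r;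
    move/eqP; rewrite -subr_eq0 opprD addrA subrr sub0r oppr_eq0 => /eqP.
have gD : {morph g x^~ w : a c / a + c}.
  by move=> a c; have := metric_linear g w 1 a c; rewrite scale1r mul1r.
rewrite (big_morph (fun u => g x u w) gD g0); apply: eq_bigr => k _.
by rewrite -[X in g x X w]addr0 metric_linear g0 addr0.
Qed.

Lemma metric_sum (x : M) N K (v : 'I_N -> R) (u : 'I_N -> tangent x)
    (v' : 'I_K -> R) (u' : 'I_K -> tangent x) :
  g x (\sum_k v k *: u k) (\sum_l v' l *: u' l) =
  \sum_k \sum_l v k * v' l * g x (u k) (u' l).
Proof.
rewrite metric_suml; apply: eq_bigr => k _.
rewrite Defs.metric_sym metric_suml mulr_sumr; apply: eq_bigr => l _.
by rewrite Defs.metric_sym mulrA.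
Qed.

Lemma metric_field_smooth (s t : vector_field M) : smooth_fun (fun x => g x (s x) (t x)).
Proof.
move=> c Ac; have [G sG GE] := metric_smooth g Ac; move=> k.
have oc := cimg_open c.
apply: (@Ck_on_ext _ _ _ _ _ (fun y => \sum_i \sum_j
    s (cinv c y) c 0 j * G y j i * t (cinv c y) c 0 i)) => //.
  move=> y cy; rewrite GE; last exact: cinv_dom.
  rewrite cinvK// mxE; apply: eq_bigr => i _.
  by rewrite !mxE mulr_suml.
apply: Ck_on_sum => // i; apply: Ck_on_sum => // j.
apply: Ck_onM => //; first (apply: Ck_onM => //).
- by apply: Ck_on_coord => //; exact: (vfield_smooth s Ac).
- by apply: Ck_on_coord => //; exact: sG.
- by apply: Ck_on_coord => //; exact: (vfield_smooth t Ac).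
Qed.

Lemma sum_field_subproof N (f : 'I_N -> M -> R) (s : 'I_N -> vector_field M) :
  (forall k, smooth_fun (f k)) -> forall c, atlas c ->
  smooth_on (cimg c) (fun y => tcoord (\sum_k f k (cinv c y) *: s k (cinv c y)) c).
Proof.
move=> sf c Ac k; have oc := cimg_open c; apply: Ck_on_mx => // i j.
apply: (@Ck_on_ext _ _ _ _ _ (fun y =>
    \sum_l f l (cinv c y) * tcoord (s l (cinv c y)) c i j)) => //.
  move=> y _; rewrite tcoord_sum summxE; apply: eq_bigr => l _; by rewrite mxE.
apply: Ck_on_sum => // l; apply: Ck_onM => //; first exact: sf.
by apply: Ck_on_coord => //; exact: (vfield_smooth (s l) Ac).
Qed.

Definition sum_field N (f : 'I_N -> M -> R) (s : 'I_N -> vector_field M)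
    (sf : forall k, smooth_fun (f k)) : vector_field M :=
  @VectorField _ _ M (fun x => \sum_k f k x *: s k x) (sum_field_subproof s sf).

(* The pairs [(s k, h k)] frame the sum of the tangent bundle and of a trivial line
   bundle. *)
Lemma parseval_of_trivialization N (s : 'I_N -> vector_field M) (h : 'I_N -> M -> R) :
  N = d.+1 -> (forall k, smooth_fun (h k)) ->
  (forall x (v : 'I_N -> R), \sum_k v k *: s k x = 0 -> \sum_k v k * h k x = 0 ->
     forall k, v k = 0) ->
  exists sigma : 'I_N -> vector_field M, parseval_frame g sigma.
Proof.
move=> NE sh indep; subst N.
(* The Gram matrix of the pairs [(s k, h k)] in the sum of the tangent bundle and a trivial line. *)
pose Gr (x : M) : 'M[R]_d.+1 := \matrix_(k, l) (g x (s k x) (s l x) + h k x * h l x).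
have GrE x (v w : 'rV_d.+1) : (v *m Gr x *m w^T) 0 0 =
    g x (\sum_k v 0 k *: s k x) (\sum_k w 0 k *: s k x)
    + (\sum_k v 0 k * h k x) * (\sum_k w 0 k * h k x).
  rewrite metric_sum mulr_suml -big_split /= mxE.
  rewrite (eq_bigr (fun l => \sum_k v 0 k * Gr x k l * w 0 l)); last first.
    by move=> l _; rewrite !mxE mulr_suml.
  rewrite exchange_big; apply: eq_bigr => k _.
  rewrite mulr_sumr -big_split; apply: eq_bigr => l _.
  by rewrite mxE /=; ring.
have sGr k l : smooth_fun (fun x => Gr x k l).
  move=> c Ac m; apply: (@Ck_on_ext _ _ _ _ _ (fun y =>
      g (cinv c y) (s k (cinv c y)) (s l (cinv c y)) + h k (cinv c y) * h l (cinv c y))).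
  - exact: cimg_open.
  - by move=> y _; rewrite mxE.
  - exact: (smooth_funD (metric_field_smooth (s k) (s l)) (smooth_funM (sh k) (sh l)) Ac).
have [x|x v v0|A sA AE] := cholesky smooth_fun_cst smooth_funD smooth_funM
    smooth_funV smooth_fun_sqrt sGr.
- by apply/matrixP => k l; rewrite !mxE Defs.metric_sym [h l x * _]mulrC.
- rewrite GrE -expr2; set w := \sum_k _; set a := \sum_k _.
  have [w0|w0] := eqVneq w 0; last by rewrite ltr_pwDl ?sqr_ge0// metric_pos.
  have a0 : a != 0.
    apply: contraNneq v0 => a0; apply/eqP/rowP => k.
    by rewrite mxE (indep x (v 0) w0 a0).
  rewrite ltr_wpDl ?exprn_even_gt0// w0.
  have := metric_linear g 0 0 0 (0 : tangent x); rewrite scale0r addr0 mul0r add0r.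
  have := metric_linear g 0 1 0 (0 : tangent x); rewrite scale1r addr0 mul1r.
  by move=> /eqP; rewrite -subr_eq0 opprD addrA subrr sub0r oppr_eq0 => /eqP ->.
exists (fun k => sum_field s (sA k)) => x u.
pose sg k := \sum_l A x k l *: s l x; pose hh k := \sum_l A x k l * h l x.
have ortho k l : g x (sg k) (sg l) + hh k * hh l = (k == l)%:R.
  have /matrixP/(_ k l) := AE x; rewrite [RHS]mxE => <-.
  have -> : (A x *m Gr x *m (A x)^T) k l =
      (row k (A x) *m Gr x *m (row l (A x))^T) 0 0.
    rewrite !mxE; apply: eq_bigr => i _; rewrite !mxE; congr (_ * _).
    by apply: eq_bigr => j _; rewrite !mxE.
  rewrite GrE /sg /hh; congr (g x _ _ + _ * _); apply: eq_bigr => i _; by rewrite mxE.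
have [c Ac cx] := atlas_cover x; have [G _ GE] := metric_smooth g Ac.
(* The rows of [B] are the orthonormalized pairs in the chart [c], and [G'] is the metric extended
   to the trivial line. *)
pose B : 'M[R]_(d.+1, d + 1) := \matrix_k row_mx (sg k c) (hh k)%:M.
pose G' : 'M[R]_(d + 1) := block_mx (G (cmap c x)) 0 0 1%:M.
have rowB k : row k B = row_mx (sg k c) (hh k)%:M by rewrite rowK.
have BE : B *m G' *m B^T = 1%:M.
  apply/matrixP => k l; rewrite [RHS]mxE -ortho GE//.
  have -> : (B *m G' *m B^T) k l = (row k B *m G' *m (row l B)^T) 0 0.
    rewrite !mxE; apply: eq_bigr => i _; rewrite !mxE; congr (_ * _).
    by apply: eq_bigr => j _; rewrite !mxE.
  rewrite !rowB mul_row_block tr_row_mx mul_row_col !mulmx0 addr0 add0r mulmx1.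
  by rewrite tr_scalar_mx -scalar_mxM [LHS]mxE; congr (_ + _); rewrite mxE eqxx mulr1n.
(* There are as many pairs as the rank [d + 1], so a one-sided inverse is two-sided: orthonormality
   becomes the Parseval identity. *)
have BBG : B^T *m (B *m G') = 1%:M.
  have eqd : d.+1 = (d + 1)%N by rewrite addn1.
  move: (B *m G') (B^T) BE; rewrite -eqd => P Q; exact: mulmx1C.
(* With trivial component [0], the vector [u] pairs only with the tangential parts of the frame. *)
pose U : 'rV[R]_(d + 1) := row_mx (u c) 0.
have gu k : g x u (sg k) = (U *m G' *m B^T) 0 k.
  rewrite GE//; have -> : (U *m G' *m B^T) 0 k = (U *m G' *m (row k B)^T) 0 0.
    by rewrite !mxE; apply: eq_bigr => i _; rewrite !mxE.
  rewrite rowB mul_row_block tr_row_mx mul_row_col !mulmx0 !mul0mx addr0 add0r mul0mx.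
  by rewrite addr0.
have gu' k : g x u (sg k) = (B *m G' *m U^T) k 0.
  rewrite Defs.metric_sym GE//.
  have -> : (B *m G' *m U^T) k 0 = (row k B *m G' *m U^T) 0 0.
    rewrite !mxE; apply: eq_bigr => i _; rewrite !mxE; congr (_ * _).
    by apply: eq_bigr => j _; rewrite !mxE.
  rewrite rowB mul_row_block tr_row_mx mul_row_col !mulmx0 trmx0 !mulmx0 addr0.
  by rewrite addr0.
rewrite (eq_bigr (fun k => (U *m G' *m B^T) 0 k * (B *m G' *m U^T) k 0)); last first.
  by move=> k _; rewrite real_normK ?num_real// expr2 -gu -gu'.
have -> : \sum_k (U *m G' *m B^T) 0 k * (B *m G' *m U^T) k 0 =
    ((U *m G' *m B^T) *m (B *m G' *m U^T)) 0 0 by rewrite [RHS]mxE.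
have -> : (U *m G' *m B^T) *m (B *m G' *m U^T) = U *m G' *m (B^T *m (B *m G')) *m U^T.
  by rewrite !mulmxA.
rewrite BBG mulmx1 mul_row_block tr_row_mx mul_row_col !mulmx0 !mul0mx !addr0 mul0mx.
by rewrite addr0 GE.
Qed.

End SmoothFunctions.

(** * Vector fields on the lens space from equivariant maps *)

Section LensFields.
Variables (R : realType) (n p : nat) (lambda : R[i]) (b : 'I_n.+1 -> nat).
Hypotheses (lambda_prim : p.-primitive_root lambda) (p_prime : prime p).
Hypothesis b_bounds : forall j, (1 <= b j <= p - 1)%N.
Local Notation X := 'M[R]_(n.+1, 2).
Local Notation S := (@sphere_set R n).
Local Notation sph := (sphere R n).
Local Notation d := (2 * n + 1)%N.
Local Notation L := (lens_space lambda_prim p_prime b_bounds).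
Local Notation pi := (@lens_pi R n p lambda lambda_prim b).
Local Notation act := (sphere_act lambda_prim b).
Local Notation rot k := (diag_act (lambda ^+ k) b).
Local Notation lchart := (chart R L d).
Local Notation push := (@push R n p lambda b lambda_prim p_prime b_bounds).

Lemma push_sum x N (v : 'I_N -> R) (e : 'I_N -> X) :
  push x (\sum_k v k *: e k) = \sum_k v k *: push x (e k).
Proof.
have tc0 : push x 0 = 0.
  have := push_linear lambda_prim p_prime b_bounds x 1 0 0.
  rewrite scale1r addr0 scale1r => /eqP.
  by rewrite -subr_eq0 opprD addrA subrr sub0r oppr_eq0 => /eqP.
have tcD : {morph push x : u v / u + v}.
  move=> u w; have := push_linear lambda_prim p_prime b_bounds x 1 u w.
  by rewrite !scale1r.
rewrite (big_morph _ tcD tc0); apply: eq_bigr => k _.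
have := push_linear lambda_prim p_prime b_bounds x (v k) (e k) 0.
by rewrite tc0 !addr0.
Qed.

Definition lens_lift (q : L) : sph :=
  projT1 (cid (@lens_pi_surj R n p lambda lambda_prim b q)).

Lemma lens_liftK q : pi (lens_lift q) = q.
Proof. exact: (projT2 (cid (@lens_pi_surj R n p lambda lambda_prim b q))). Qed.

Section Field.
Variable e : X -> X.
Hypothesis e_smooth : smooth_on setT e.
Hypothesis e_equiv : forall x, S x -> e (diag_act lambda b x) = diag_act lambda b (e x).

Lemma equiv_rot k (x : sph) : e (rot k (sphere_val x)) = rot k (e (sphere_val x)).
Proof.
elim: k x => [|k IH] x; first by rewrite expr0 !diag_act1.
have E y : rot k.+1 y = diag_act lambda b (rot k y) by rewrite diag_actM exprS.
rewrite !E -IH -e_equiv//; exact: (sphere_valP (act k x)).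
Qed.

Definition field_val (q : L) : tangent q :=
  Tangent (introT (asboolP _)
    (push_tangent p_prime b_bounds (e (sphere_val (lens_lift q))) (lens_liftK q))).

(** Two preimages of [q] differ by a rotation, under which [e] is equivariant, so the chosen lift
    may be replaced by any other. *)
Lemma field_valE q x : pi x = q -> tcoord (field_val q) = push x (e (sphere_val x)).
Proof.
rewrite -{1}(lens_liftK q) => /esym/lens_piP[k ->] /=.
by rewrite sphere_actE equiv_rot push_rot.
Qed.

(** The radial component of [e], which is the coordinate in the trivial line bundle. *)
Definition height (q : L) : R := dot (e (sphere_val (lens_lift q))) (sphere_val (lens_lift q)).

Lemma heightE q x : pi x = q -> height q = dot (e (sphere_val x)) (sphere_val x).
Proof.
rewrite /height -{1}(lens_liftK q) => /esym/lens_piP[k ->].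
by rewrite sphere_actE equiv_rot (dot_rot b lambda_prim p_prime).
Qed.

Lemma e_lift_smooth (s : chart R sph d) : sphere_atlas s ->
  smooth_on (cimg s) (fun y => e (sphere_val (cinv s y))).
Proof.
move=> [ss _]; apply: (smooth_on_comp (B := setT) (f := sphere_val \o cinv s)) => //.
  exact: cimg_open.
exact: openT.
Qed.

Lemma height_smooth : smooth_fun height.
Proof.
move=> c [s As [cd ci _ cI]] k; rewrite ci.
apply: (@Ck_on_ext _ _ _ _ _ (fun y =>
    dot (e (sphere_val (cinv s y))) (sphere_val (cinv s y)))).
- exact: cimg_open.
- by move=> y sy; rewrite (heightE (x := cinv s y))// cI.
apply: dot_smooth; first exact: cimg_open.
  exact: e_lift_smooth.
by have [ss _] := As; exact: ss.
Qed.

Lemma field_smooth c : atlas c ->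
  smooth_on (cimg c) (fun y => tcoord (field_val (cinv c y)) c).
Proof.
move=> Ac; have [s As [cd ci _ cI]] := Ac; rewrite ci.
have oc := cimg_open s; have [ss _] := As.
have inD y : cimg s y -> chart_nrm_dom c (sphere_val (cinv s y)).
  move=> sy; split; first exact: sphere_neq0.
  by rewrite /= nrm_sphere -cI//; apply: cinv_dom; rewrite ci.
(* Expanding in the ambient basis separates the smooth entries of [e] from the partial derivatives
   of the fixed map [chart_nrm c]. *)
pose D i j (x : X) : 'rV[R]_d := 'D_(delta_mx i j) (chart_nrm c) x.
have sD i j k : Ck_on k (chart_nrm_dom c) (D i j).
  by have [_ /(_ (delta_mx i j))] := (Ck_onS _ _ _).1 (chart_nrm_smooth Ac k.+1).
move=> k; apply: Ck_on_mx => // a l.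
apply: (@Ck_on_ext _ _ _ _ _ (fun y => \sum_i \sum_j
    e (sphere_val (cinv s y)) i j * D i j (sphere_val (cinv s y)) a l)) => //.
  move=> y sy; have hy := inD y sy; have dh := chart_nrm_diff Ac hy.
  rewrite (field_valE (x := cinv s y)) ?cI// pushE//; last first.
    by rewrite -cI//; apply: cinv_dom; rewrite ci.
  rewrite (deriveE _ dh) [in RHS](matrix_sum_delta (e _)) linear_sum summxE.
  apply: eq_bigr => i _; rewrite linear_sum summxE; apply: eq_bigr => j _.
  by rewrite linearZ /= mxE -(deriveE _ dh).
apply: Ck_on_sum => // i; apply: Ck_on_sum => // j; apply: Ck_onM => //.
  by apply: Ck_on_coord => //; exact: e_lift_smooth.
apply: (Ck_on_comp (B := chart_nrm_dom c) (f := sphere_val \o cinv s)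
  (g := fun x => D i j x a l)) => //.
- exact: chart_nrm_dom_open.
- exact: ss.
- by apply: Ck_on_coord; [exact: chart_nrm_dom_open|exact: sD].
Qed.

Definition lens_field : vector_field L := VectorField field_smooth.

End Field.

End LensFields.

(** * The frame given by the columns of the trivialization *)

Section Frame.
Variables (R : realType) (n p : nat) (lambda : R[i]) (b : 'I_n.+1 -> nat).
Hypotheses (lambda_prim : p.-primitive_root lambda) (p_prime : prime p).
Hypothesis b_bounds : forall j, (1 <= b j <= p - 1)%N.
Local Notation X := 'M[R]_(n.+1, 2).
Local Notation S := (@sphere_set R n).
Local Notation L := (lens_space lambda_prim p_prime b_bounds).

Section Column.
Variables (z : R[i]) (f : X -> 'I_n.+1 -> R[i]).
Hypothesis cf : forall i, cpoly (fun x => f x i).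
Hypothesis wf : forall x, S x -> forall i,
  f (diag_act lambda b x) i = lambda ^+ b i * f x i.

(** The factor [z] will be [1] or ['i], so that each complex column yields two real fields. *)
Definition column (x : X) : X := \matrix_(i, k)
  if k == 0 then complex.Re (z * f x i) else complex.Im (z * f x i).

Lemma zcoord_column x i : zcoord (column x) i = z * f x i.
Proof. by rewrite /zcoord !mxE /=; case: (z * _). Qed.

Lemma column_smooth : smooth_on setT column.
Proof.
move=> m; apply: Ck_on_mx => [|i k]; first exact: openT.
have [cRe cIm] := cpoly_Ck (cpolyM (cpoly_cst _ z) (cf i)) m.
have [k0|k0] := boolP (k == 0).
  apply: Ck_on_ext cRe; first exact: openT.
  by move=> x _; rewrite mxE k0.
apply: Ck_on_ext cIm; first exact: openT.
by move=> x _; rewrite mxE (negbTE k0).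
Qed.

Lemma column_equiv x : S x -> column (diag_act lambda b x) = diag_act lambda b (column x).
Proof.
move=> Sx; apply: zcoord_inj => i; rewrite zcoord_act !zcoord_column wf//.
exact: mulrCA.
Qed.

End Column.

Lemma zcoord_sum N (v : 'I_N -> R) (e : 'I_N -> X) i :
  zcoord (\sum_k v k *: e k) i = \sum_k (v k)%:C * zcoord (e k) i.
Proof.
have zD (x y : X) : zcoord (x + y) i = zcoord x i + zcoord y i.
  by rewrite /zcoord !mxE.
have z0 : zcoord (0 : X) i = 0 by rewrite /zcoord !mxE.
rewrite (big_morph (fun x : X => zcoord x i) zD z0); apply: eq_bigr => k _.
rewrite /zcoord /= !mxE; apply/eqP; rewrite eq_complex /=.
by rewrite !mul0r subr0 addr0 !eqxx.
Qed.

(** The columns of [F] and their multiples by ['i] are [2 * n + 2] equivariant maps, independent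
    over the reals at each point of the sphere. Their tangential and radial parts trivialize the sum
    of the tangent bundle and a trivial line. *)
Lemma parseval_of_weighted_iso (g : riemannian_metric L) :
  weighted_iso lambda b (fun _ : 'I_n.+1 => 0%N) b ->
  exists sigma : 'I_(2 * n + 2) -> vector_field L, parseval_frame g sigma.
Proof.
move=> [F [cF wF] uF].
have wF' j x : S x -> forall i, F (diag_act lambda b x) i j = lambda ^+ b i * F x i j.
  by move=> Sx i; rewrite -(wF x Sx) mulr1.
have cE : #|{: 'I_n.+1 * bool}| = (2 * n + 2)%N.
  by rewrite card_prod card_ord card_bool; lia.
pose ix (k : 'I_(2 * n + 2)) : 'I_n.+1 * bool := enum_val (cast_ord (esym cE) k).
pose rk (q : 'I_n.+1 * bool) : 'I_(2 * n + 2) := cast_ord cE (enum_rank q).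
have ixK : cancel ix rk by move=> k; rewrite /ix /rk enum_valK cast_ordKV.
have rkK : cancel rk ix by move=> q; rewrite /ix /rk cast_ordK enum_rankK.
pose z (s : bool) : R[i] := if s then 'i else 1.
pose e k := column (z (ix k).2) (fun x i => F x i (ix k).1).
have sm k : smooth_on setT (e k) by apply: column_smooth => i; exact: cF.
have eqv k x : S x -> e k (diag_act lambda b x) = diag_act lambda b (e k x).
  by apply: column_equiv => y Sy i; exact: wF'.
pose fs k := lens_field lambda_prim p_prime b_bounds (sm k) (eqv k).
pose hs k (q : L) := height (e k) q.
apply: (@parseval_of_trivialization _ _ L g _ fs hs).
- by lia.
- by move=> k; exact: (height_smooth (sm k) (eqv k)).
move=> q v v_field v_height.
pose x : sphere R n := lens_lift (q : L).
have xq : lens_pi lambda_prim b x = q by exact: lens_liftK.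
have [c Ac cq] := atlas_cover q.
have cx : cdom c (lens_pi lambda_prim b x) by rewrite xq.
have tc0 : push x (\sum_k v k *: e k (sphere_val x)) c = 0.
  have /(congr1 (fun u : tangent q => tcoord u c)) := v_field.
  rewrite tcoord_sum push_sum fct_sumE => E; rewrite -[RHS]E.
  apply: eq_bigr => k _; rewrite fctE; congr (_ *: _).
(* A combination with zero tangential part is a multiple of the position vector, and the vanishing
   of its height makes that multiple zero. *)
have [mu muE] := push_kernel Ac cx tc0.
have e0 : \sum_k v k *: e k (sphere_val x) = 0.
  rewrite muE (_ : mu = 0) ?scale0r//.
  have := congr1 (fun y => dot y (sphere_val x)) muE.
  rewrite dotZl ((dot_sphere _).1 (sphere_valP x)) mulr1 dot_suml => <-.
  by rewrite -[RHS]v_height; apply: eq_bigr.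
(* The real coefficients of a column and of its multiple by ['i] are the two parts of one complex
   coefficient, so the relation reads [F *m w = 0]. *)
pose w : 'cV[R[i]]_n.+1 := \col_j (v (rk (j, false)) +i* v (rk (j, true))).
have w0 : F (sphere_val x) *m w = 0.
  apply/colP => i; rewrite [RHS]mxE.
  have := congr1 (fun y => zcoord y i) e0; rewrite /= zcoord_sum.
  rewrite [X in _ = X -> _](_ : _ = 0); last by rewrite /zcoord !mxE.
  move=> <-; rewrite (reindex rk) /=; last by exists ix => a _; [exact: rkK|exact: ixK].
  pose f j s := (v (rk (j, s)))%:C * zcoord (e (rk (j, s)) (sphere_val x)) i.
  rewrite [RHS](eq_bigr (fun q => f q.1 q.2)); last by case.
  rewrite -(pair_bigA _ f) /= mxE.
  apply: eq_bigr => j _; rewrite big_bool /f !zcoord_column !rkK /= mxE.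
  case: (F _ _ _) => u u'; apply/eqP; rewrite eq_complex /=; apply/andP.
  by split; apply/eqP; ring.
have : w = 0 by rewrite -(mulKmx (uF _ (sphere_valP x)) w) w0 mulmx0.
move=> /colP we0 k; rewrite -(ixK k); case: (ix k) => j s.
by have := we0 j; rewrite !mxE => /eqP; rewrite eq_complex /= => /andP[/eqP va /eqP vb];
  case: s.
Qed.

End Frame.

Theorem corollary4p11 (R : realType) (n p : nat) (lambda : R[i])
    (n_gt0 : (0 < n)%N) (p_prime : prime p) (p_mod : (p = 1 %[mod n.+1])%N)
    (lambda_prim : p.-primitive_root lambda) :
  exists (b : 'I_n.+1 -> nat) (b_bounds : forall j, (1 <= b j <= p - 1)%N),
  forall g : riemannian_metric (lens_space lambda_prim p_prime b_bounds),
  exists sigma : 'I_(2 * n + 2) ->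
                 vector_field (lens_space lambda_prim p_prime b_bounds),
    parseval_frame g sigma.
Proof.
have [b [b_bounds b_iso]] := exists_trivial_weights p_prime p_mod lambda_prim.
by exists b, b_bounds => g; exact: parseval_of_weighted_iso.
Qed.
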